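(* Let $k$ be a field with $\operatorname{char}k=0$ or $\operatorname{char}k>13$, let $J$ be an Albert algebra over $k$, $G=\operatorname{Aut}(J)$ (of type $F_4$), $W=e^\perp$ the $26$-dimensional space of traceless elements, and let $V'=\{\sum_iX_iY_i\in\mathrm{S}^2W\mid\sum_iX_i\cdot Y_i=0\}$, which is the ($324$-dimensional) irreducible $G$-representation of highest weight $2\omega_4$. Define bilinear products on $\mathrm{S}^2W$ by $$\begin{aligned}ab\odot_1cd=\;&\tfrac16\big(\langle a,c\rangle bd+\langle a,d\rangle bc+\langle b,c\rangle ad+\langle b,d\rangle ac\big)+2\big((a*c)(b*d)+(a*d)(b*c)\big)\\&-\tfrac{2}{3\cdot26}\big(\langle a,c\rangle\langle b,d\rangle+\langle a,d\rangle\langle b,c\rangle\big)\mathrm{id}_W,\end{aligned}$$ $$\begin{aligned}ab\odot_2cd=\;&\tfrac12\big(\langle a,c\rangle(bd*\mathrm{id}_W+2bd)+\langle a,d\rangle(bc*\mathrm{id}_W+2bc)+\langle b,c\rangle(ad*\mathrm{id}_W+2ad)+\langle b,d\rangle(ac*\mathrm{id}_W+2ac)\big)\\&-\tfrac{20}{3\cdot26}\big(\langle a,c\rangle\langle b,d\rangle+\langle a,d\rangle\langle b,c\rangle\big)\mathrm{id}_W\end{aligned}$$ for $a,b,c,d\in W$. Then the space of commutative $G$-equivariant (bilinear) products on $V'$ is spanned by (the restrictions to $V'$ of) $\odot_1$ and $\odot_2$.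
   Context: The split Albert algebra is $\mathcal H_3(\mathbb O)$, the $3\times3$ hermitian matrices over the split octonions $\mathbb O$, with Jordan product $x\cdot y=\tfrac12(xy+yx)$ and trace form $\langle x,y\rangle=\operatorname{Tr}(x\cdot y)$. An Albert algebra over $k$ is a $k$-algebra $J$ with a bilinear form $\langle\cdot,\cdot\rangle$ becoming isomorphic to $\mathcal H_3(\mathbb O)$ with its trace form over $\bar k$. $e$ is the identity of $J$, $W=e^\perp$, $\pi:J\to W$, $\pi(x)=x-\tfrac13\langle x,e\rangle e$, and $x*y:=\pi(x\cdot y)$. In $\mathrm{S}^2W$, $ab$ denotes the symmetric product of $a,b\in W$; $\mathrm{S}^2W$ is identified with the space of operators on $W$ symmetric for $\langle\cdot,\cdot\rangle$ via $ab\mapsto\tfrac12(a\langle b,\cdot\rangle+b\langle a,\cdot\rangle)$, so $\mathrm{id}_W\in\mathrm{S}^2W$. The product $*$ on $\mathrm{S}^2W$ is the bilinear product with $ab*cd=(a*c)(b*d)+(a*d)(b*c)$. *)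

(* Defs.v *)
From mathcomp Require Import all_boot all_order all_algebra.

Set Implicit Arguments.
Unset Strict Implicit.
Unset Printing Implicit Defensive.

Import GRing.Theory.
Local Open Scope ring_scope.

(* Split octonions: the Cayley-Dickson double of the split quaternions M_2,
   whose canonical involution is the adjugate and whose norm is \det.  The norm
   of (a, b) is \det a - \det b. *)
Section SplitOctonions.
Variable K : comNzRingType.

Definition octonion : Type := ('M[K]_2 * 'M[K]_2)%type.

Definition omul (x y : octonion) : octonion :=
  (x.1 *m y.1 + \adj y.2 *m x.2, y.2 *m x.1 + x.2 *m \adj y.1).

Definition oconj (x : octonion) : octonion := (\adj x.1, - x.2).

End SplitOctonions.

(* 3 x 3 matrices over the octonions; MathComp has no product of matrices with
   nonassociative entries. *)
Section HermitianOctonionMatrices.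
Variable K : fieldType.
Implicit Types X Y : 'M[octonion K]_3.

Definition omulmx X Y : 'M[octonion K]_3 :=
  \matrix_(i, j) \sum_l omul (X i l) (Y l j).

Definition hermitian X : Prop := forall i j, X j i = oconj (X i j).

Definition h3mul X Y : 'M[octonion K]_3 :=
  \matrix_(i, j) (2^-1 *: (omulmx X Y i j + omulmx Y X i j)).

(* A diagonal entry of a hermitian matrix is a scalar octonion (c%:M, 0), and
   half the trace of its first component recovers the scalar c. *)
Definition h3tr X : K := \sum_i 2^-1 * \tr (X i i).1.

Definition h3form X Y : K := h3tr (h3mul X Y).

End HermitianOctonionMatrices.

Section Algebra.
Variables (k : fieldType) (J : vectType k).

Local Notation n := (\dim {:J}).
Local Notation E i := ((vbasis {:J})`_i).

Definition coords (x : J) : 'rV[k]_n := \row_i coord (vbasis {:J}) i x.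

(* The scalar extension of J along f : k -> R is R^n, the free R-module on the
   basis [vbasis {:J}] of J. *)
Section ScalarExtension.
Variables (R : comNzRingType) (f : {rmorphism k -> R}).

Definition ext_mul (mul : {bilinear J -> J -> J}) (x y : 'rV[R]_n) : 'rV[R]_n :=
  \sum_i \sum_j (x 0 i * y 0 j) *: map_mx f (coords (mul (E i) (E j))).

Definition ext_form (form : {biscalar J}) (x y : 'rV[R]_n) : R :=
  \sum_i \sum_j x 0 i * y 0 j * f (form (E i) (E j)).

(* The R-points of the group scheme Aut(J), acting on row vectors by
   x |-> x *m g. *)
Definition aut_points (mul : {bilinear J -> J -> J}) (g : 'M[R]_n) : Prop :=
  (exists2 h : 'M[R]_n, g *m h = 1%:M & h *m g = 1%:M) /\
  (forall x y, ext_mul mul x y *m g = ext_mul mul (x *m g) (y *m g)).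

End ScalarExtension.

(* K with f is an algebraic closure of k, and phi is an isomorphism from the
   scalar extension of J to K onto H_3(octonion K). *)
Definition albert (mul : {bilinear J -> J -> J}) (form : {biscalar J}) : Prop :=
  exists (K : closedFieldType) (f : {rmorphism k -> K})
         (phi : 'rV[K]_n -> 'M[octonion K]_3),
    (forall z : K, algebraicOver f z) /\
    (forall (c : K) (x y : 'rV[K]_n) i j,
       phi (c *: x + y) i j = c *: phi x i j + phi y i j) /\
    injective phi /\
    (forall X, hermitian X <-> exists x, phi x = X) /\
    (forall x y, phi (ext_mul f mul x y) = h3mul (phi x) (phi y)) /\
    (forall x y, ext_form f form x y = h3form (phi x) (phi y)).

(* S^2 J is the space of symmetric matrices in 'M_n: the matrix A stands for
   \sum_(i, j) A i j * (E i)(E j).  S^2 W is the span of the products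
   [symp a b] with a, b in W. *)
Definition symp (a b : J) : 'M[k]_n :=
  2^-1 *: ((coords a)^T *m coords b + (coords b)^T *m coords a).

(* The bilinear product taking (ab, cd) to q a b c d, for q quadrilinear,
   symmetric in its first two and in its last two arguments. *)
Definition sym_prod (q : J -> J -> J -> J -> 'M[k]_n) (A B : 'M[k]_n) :
    'M[k]_n :=
  \sum_i \sum_j \sum_r \sum_s (A i j * B r s) *: q (E i) (E j) (E r) (E s).

Variables (mul : {bilinear J -> J -> J}) (form : {biscalar J}) (e : J).

Definition inW (x : J) : Prop := form x e = 0.

Definition projW (x : J) : J := x - (3^-1 * form x e) *: e.

Definition mulW (x y : J) : J := projW (mul x y).

Definition inV' (A : 'M[k]_n) : Prop :=
  exists (m : nat) (X Y : 'I_m -> J),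
    (forall i, inW (X i) /\ inW (Y i)) /\
    \sum_i mul (X i) (Y i) = 0 /\
    A = \sum_i symp (X i) (Y i).

(* The operator of an element of S^2 J: the operator of [symp a b] is
   x |-> 2^-1 *: (form b x *: a + form a x *: b). *)
Definition sym_op (A : 'M[k]_n) : 'End(J) :=
  linfun (fun x => \sum_i \sum_j (A i j * form (E j) x) *: E i).

(* For a nondegenerate form [sym_op] is bijective.  The operators of elements
   of S^2 W vanish on e, so the one restricting to the identity of W is the
   projection onto W along e. *)
Definition idW : 'M[k]_n := ((linfun sym_op)^-1)%VF (linfun projW).

Definition star : 'M[k]_n -> 'M[k]_n -> 'M[k]_n :=
  sym_prod (fun a b c d =>
    symp (mulW a c) (mulW b d) + symp (mulW a d) (mulW b c)).

Definition odot1 : 'M[k]_n -> 'M[k]_n -> 'M[k]_n :=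
  sym_prod (fun a b c d =>
    6^-1 *: (form a c *: symp b d + form a d *: symp b c
             + form b c *: symp a d + form b d *: symp a c)
    + 2 *: (symp (mulW a c) (mulW b d) + symp (mulW a d) (mulW b c))
    - (2 / (3 * 26)) *:
        ((form a c * form b d + form a d * form b c) *: idW)).

Definition odot2 : 'M[k]_n -> 'M[k]_n -> 'M[k]_n :=
  sym_prod (fun a b c d =>
    2^-1 *: (form a c *: (star (symp b d) idW + 2 *: symp b d)
             + form a d *: (star (symp b c) idW + 2 *: symp b c)
             + form b c *: (star (symp a d) idW + 2 *: symp a d)
             + form b d *: (star (symp a c) idW + 2 *: symp a c))
    - (20 / (3 * 26)) *:
        ((form a c * form b d + form a d * form b c) *: idW)).

(* A product on V' is a function on all of 'M_n of which only the restriction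
   to V' matters. *)
Definition bilinear_on_V' (p : 'M[k]_n -> 'M[k]_n -> 'M[k]_n) : Prop :=
  (forall A B, inV' A -> inV' B -> inV' (p A B)) /\
  (forall c A A' B, inV' A -> inV' A' -> inV' B ->
     p (c *: A + A') B = c *: p A B + p A' B) /\
  (forall c A B B', inV' A -> inV' B -> inV' B' ->
     p A (c *: B + B') = c *: p A B + p A B').

Definition commutative_on_V' (p : 'M[k]_n -> 'M[k]_n -> 'M[k]_n) : Prop :=
  forall A B, inV' A -> inV' B -> p A B = p B A.

(* The graph of the R-bilinear extension of p to the R-span of V' in 'M[R]_n,
   which is the scalar extension of V'. *)
Definition ext_prod_graph (R : comNzRingType) (f : {rmorphism k -> R})
    (p : 'M[k]_n -> 'M[k]_n -> 'M[k]_n) (A B C : 'M[R]_n) : Prop :=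
  exists (m l : nat) (r : 'I_m -> R) (s : 'I_l -> R)
         (X : 'I_m -> 'M[k]_n) (Y : 'I_l -> 'M[k]_n),
    (forall i, inV' (X i)) /\ (forall j, inV' (Y j)) /\
    A = \sum_i r i *: map_mx f (X i) /\
    B = \sum_j s j *: map_mx f (Y j) /\
    C = \sum_i \sum_j (r i * s j) *: map_mx f (p (X i) (Y j)).

(* Equivariance under the group scheme G = Aut(J): for every commutative
   k-algebra R, the extended product commutes with G(R).  A point g sends ab to
   (a *m g)(b *m g), so it acts on symmetric matrices by A |-> g^T *m A *m g. *)
Definition aut_equivariant (p : 'M[k]_n -> 'M[k]_n -> 'M[k]_n) : Prop :=
  forall (R : comNzRingType) (f : {rmorphism k -> R}) (g : 'M[R]_n),
    aut_points f mul g ->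
    forall A B C, ext_prod_graph f p A B C ->
      ext_prod_graph f p (g^T *m A *m g) (g^T *m B *m g) (g^T *m C *m g).

End Algebra.

(* Main.v *)
(* V' is irreducible with highest weight vector v^2, where v is a highest weight vector of W;
   let w be a lowest weight vector.  Over an algebraic closure, an equivariant product Phi
   satisfies the Leibniz rule for the derivations of J (apply equivariance at the points
   1 + eps D over the dual numbers).  Since v^2 generates V' under the lowering operators and
   w^2 under the raising operators, Phi is determined by Phi(v^2, w^2), which has weight 0 and
   is killed by the lowering operators that kill v^2 and w^2.  The space of such elements of V'
   has dimension at most 2, and the values at (v^2, w^2) of the two given products are
   independent, so Phi is a combination of them; the coefficients descend to k by linear
   algebra.  The same criterion shows that the two products map V' x V' to V': apply it to the
   contraction X Y |-> X . Y of the product, which takes values in J. *)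

From HB Require Import structures.
From Stdlib Require Import ZArith.
From mathcomp Require Import all_boot all_order all_algebra ssrZ.
From mathcomp Require Import ring zify.
Require Import Defs.

Set Implicit Arguments.
Unset Strict Implicit.
Unset Printing Implicit Defensive.

Import GRing.Theory.
Local Open Scope ring_scope.

(** * Algebras in coordinates and the products on symmetric matrices *)

(** The isomorphism with the matrix algebra exists only over an algebraic closure K, whereas
    equivariance quantifies over all commutative k-algebras. The two settings are joined by matrix
    expressions that make sense over any commutative ring: V' is the kernel of one linear map, and
    both products belong to a four-parameter family [prodmx]. Automorphisms preserve this family
    over every ring because the form is recovered from the multiplication: [<x, y>] is one ninth of
    the trace of multiplication by x . y. The basis, the weights and the lowering operators live
    over K only; their consequences return to k because k -> K is injective.

    Representation theory is replaced by integer certificates, which also work in positive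
    characteristic. That v^2 generates V', and that two coordinates determine the possible value at
    (v^2, w^2), are identities over Z, checked by computation, whose denominators are products of 2
    and 3. The prime 13 appears when the two products are compared: up to the factors 234 and 702,
    their coordinates at (v^2, w^2) have determinant 48 . 1404, and 1404 = 4 . 27 . 13. *)

Section Coordinates.
Variables (R : comNzRingType) (n : nat).
Implicit Types (L N : 'I_n -> 'M[R]_n) (x y : 'rV[R]_n) (A B g D : 'M[R]_n).

(* An algebra on row vectors is given by the matrices [L i] of left multiplication by the
   basis vectors, so that the product of x and y is [y *m lcomb L x]; [contract] is the map
   sending x^T y to this product. *)
Definition lcomb L x : 'M[R]_n := \sum_i x 0 i *: L i.

Definition contract L A : 'rV[R]_n := \sum_i row i A *m L i.

Lemma lcomb_is_linear L : linear (lcomb L).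
Proof.
move=> a x y; rewrite /lcomb scaler_sumr -big_split; apply: eq_bigr => i _.
by rewrite !mxE scalerDl scalerA.
Qed.
HB.instance Definition _ L :=
  GRing.isLinear.Build R 'rV[R]_n 'M[R]_n _ (lcomb L) (lcomb_is_linear L).

Lemma contract_is_linear L : linear (contract L).
Proof.
move=> a x y; rewrite /contract scaler_sumr -big_split; apply: eq_bigr => i _.
by rewrite linearP mulmxDl scalemxAl.
Qed.
HB.instance Definition _ L :=
  GRing.isLinear.Build R 'M[R]_n 'rV[R]_n _ (contract L) (contract_is_linear L).

Lemma lcomb_delta L i : lcomb L (delta_mx 0 i) = L i.
Proof.
rewrite /lcomb (bigD1 i) //= big1 ?addr0 => [|j ne]; rewrite mxE eqxx ?eqxx ?scale1r //=.
by rewrite (negPf ne) scale0r.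
Qed.

Lemma lcomb_mulr L x B : lcomb L x *m B = lcomb (fun i => L i *m B) x.
Proof. by rewrite /lcomb mulmx_suml; apply: eq_bigr => i _; rewrite scalemxAl. Qed.

Lemma eq_lcomb L N x : L =1 N -> lcomb L x = lcomb N x.
Proof. by move=> LN; apply: eq_bigr => i _; rewrite LN. Qed.

Lemma lcomb_mul L x B : lcomb L (x *m B) = \sum_i x 0 i *: lcomb L (row i B).
Proof.
rewrite mulmx_sum_row (linear_sum (lcomb L)).
by apply: eq_bigr => i _; rewrite linearZ.
Qed.

Lemma mulmx_quadratic m (X Y : 'M[R]_(m, n)) (z : 'M[R]_m) :
  X^T *m z *m Y = \sum_i \sum_j z i j *: ((row i X)^T *m row j Y).
Proof.
apply/matrixP => k l; rewrite mxE summxE.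
under eq_bigr => j _ do rewrite mxE mulr_suml.
rewrite exchange_big /=; apply: eq_bigr => i _; rewrite summxE; apply: eq_bigr => j _.
by rewrite !mxE big_ord1 !mxE mulrCA mulrA.
Qed.

Definition trace_col L : 'cV[R]_n := \col_j \tr (L j).

Lemma trace_colE L x : x *m trace_col L = (\tr (lcomb L x))%:M.
Proof.
apply/matrixP => i j; rewrite !ord1 !mxE eqxx mulr1n linear_sum.
by apply: eq_bigr => l _; rewrite linearZ !mxE.
Qed.

Lemma contract_outer L x y : contract L (x^T *m y) = y *m lcomb L x.
Proof.
rewrite /contract /lcomb mulmx_sumr; apply: eq_bigr => i _.
have -> : row i (x^T *m y) = x 0 i *: y by apply/rowP => j; rewrite !mxE big_ord1 !mxE.
by rewrite -scalemxAr -scalemxAl.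
Qed.

Section Products.
Variables (L : 'I_n -> 'M[R]_n) (Q Q' : 'M[R]_n) (e : 'rV[R]_n) (c t : R).

Definition traceless_proj : 'M[R]_n := 1%:M - t *: (Q *m e^T *m e).
Definition idT : 'M[R]_n := Q' - t *: (e^T *m e).
Definition lmulT i : 'M[R]_n := L i *m traceless_proj.

(** Row r of [lmulT i] is the traceless product of basis vectors i and r. For symmetric matrices the
    two terms of the product on S^2 W have the same sum, whence the factor 2. *)
Definition starmx A B : 'M[R]_n :=
  2 *: \sum_i \sum_j A i j *: ((lmulT i)^T *m B *m lmulT j).

Definition anticomm A B : 'M[R]_n := A *m Q *m B + B *m Q *m A.

(* A symmetric matrix A stands for \sum A i j (E i)(E j).  On symmetric matrices,
   2 [anticomm] is the product with the four terms <a, c> bd, ..., twice the trace is the one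
   with the two terms <a, c><b, d>, ..., and [idT] is id_W. *)
Definition prodmx (d : R * R * R * R) A B : 'M[R]_n :=
  let: (d1, d2, d3, d4) := d in
  d1 *: anticomm A B + d2 *: starmx A B + d3 *: starmx (anticomm A B) idT
  + (d4 * \tr (A *m Q *m B *m Q)) *: idT.

(* Vanishes exactly on V'; a single matrix, so that V' is the kernel of one linear map that
   commutes with base change. *)
Definition constraints A : 'M[R]_(n + n, 1 + n) :=
  block_mx (A *m (Q *m e^T)) (A - A^T) 0 (\matrix_(i < n) contract L A).

(** What is kept of an Albert algebra over a ring with no split basis at hand: identities between
    matrices, hence stable under base change. The essential one is [traceE]: it expresses the form
    through the multiplication, so that [is_aut] need only speak of the latter. *)
Record albert_axioms : Prop := AlbertAxioms {
  unitl : lcomb L e = 1%:M;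
  unitr : forall i, e *m L i = delta_mx 0 i;
  mulC : forall i j, row j (L i) = row i (L j);
  traceE : forall i j, Q i j = c * \tr (lcomb L (row j (L i)));
  gram_inv : Q *m Q' = 1%:M
}.

Definition is_aut g : Prop :=
  (exists2 h, g *m h = 1%:M & h *m g = 1%:M) /\
  forall i, g *m lcomb L (row i g) = L i *m g.


Lemma trace_form_conj g d : g *m d = 1%:M -> forall X Y : 'M[R]_n,
  g *m X = Y *m g -> \tr X = \tr Y.
Proof.
move=> gd X Y e1; have dg : d *m g = 1%:M by apply: mulmx1C.
by rewrite -[X]mul1mx -dg -mulmxA e1 mulmxA mxtrace_mulC !mulmxA gd mul1mx.
Qed.

Lemma constraintsP A : constraints A = 0 <->
  [/\ A^T = A, A *m (Q *m e^T) = 0 & contract L A = 0].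
Proof.
split=> [|[sA wA cA]].
  rewrite /constraints -[RHS](@block_mx0 _ n n 1 n) => /eq_block_mx[-> /eqP sA _ cA].
  split=> //; first by move: sA; rewrite subr_eq0 => /eqP.
  apply/rowP => j; have n0 : (0 < n)%N by apply: leq_trans (ltn_ord j).
  by move: cA => /matrixP/(_ (Ordinal n0) j); rewrite !mxE.
rewrite /constraints wA sA subrr cA -[RHS](@block_mx0 _ n n 1 n).
by congr block_mx; apply/matrixP=> i j; rewrite !mxE.
Qed.

Lemma constraints_is_linear : linear constraints.
Proof.
move=> a A B; rewrite /constraints scale_block_mx add_block_mx; congr block_mx.
- by rewrite mulmxDl scalemxAl.
- by rewrite linearP opprD scalerBr addrACA.
- by rewrite scaler0 addr0.
- by apply/matrixP=> i j; rewrite linearP !mxE.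
Qed.
HB.instance Definition _ := GRing.isLinear.Build R 'M[R]_n 'M[R]_(n + n, 1 + n) _
  constraints constraints_is_linear.

Lemma starmxP a A A' B : starmx (a *: A + A') B = a *: starmx A B + starmx A' B.
Proof.
rewrite /starmx !scalerA mulrC -scalerA -scalerDr; congr (_ *: _).
rewrite scaler_sumr -big_split; apply: eq_bigr => i _ /=.
rewrite scaler_sumr -big_split; apply: eq_bigr => j _ /=.
by rewrite !mxE scalerDl scalerA.
Qed.

Lemma starmxPr a A B B' : starmx A (a *: B + B') = a *: starmx A B + starmx A B'.
Proof.
rewrite /starmx !scalerA mulrC -scalerA -scalerDr; congr (_ *: _).
rewrite scaler_sumr -big_split; apply: eq_bigr => i _ /=.
rewrite scaler_sumr -big_split; apply: eq_bigr => j _ /=.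
by rewrite mulmxDr mulmxDl -scalemxAr -scalemxAl scalerDr !scalerA mulrC.
Qed.

Lemma starmxZl a A B : starmx (a *: A) B = a *: starmx A B.
Proof.
have star0 : starmx 0 B = 0.
  by have := starmxP (-1) 0 0 B; rewrite scaler0 addr0 scaleN1r addNr.
by rewrite -[a *: A]addr0 starmxP star0 addr0.
Qed.

Lemma starmxZr a A B : starmx A (a *: B) = a *: starmx A B.
Proof.
have star0 : starmx A 0 = 0.
  by have := starmxPr (-1) A 0 0; rewrite scaler0 addr0 scaleN1r addNr.
by rewrite -[a *: B]addr0 starmxPr star0 addr0.
Qed.

Lemma anticommC A B : anticomm A B = anticomm B A.
Proof. by rewrite /anticomm addrC. Qed.

Lemma anticommP a A A' B : anticomm (a *: A + A') B = a *: anticomm A B + anticomm A' B.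
Proof.
rewrite /anticomm !(mulmxDl, mulmxDr) -!(scalemxAl, scalemxAr) scalerDr.
by rewrite addrACA.
Qed.

Lemma anticommPr a A B B' : anticomm A (a *: B + B') = a *: anticomm A B + anticomm A B'.
Proof. by rewrite anticommC anticommP !(anticommC A). Qed.

Lemma scaler4DE (d1 d2 d3 d4 a : R) (X X' Y Y' Z Z' I : 'M[R]_n) u u' :
  d1 *: (a *: X + X') + d2 *: (a *: Y + Y') + d3 *: (a *: Z + Z') + (d4 * (a * u + u')) *: I
  = a *: (d1 *: X + d2 *: Y + d3 *: Z + (d4 * u) *: I)
    + (d1 *: X' + d2 *: Y' + d3 *: Z' + (d4 * u') *: I).
Proof.
rewrite !scalerDr !scalerA mulrDr scalerDl !(mulrCA d4 a) !(mulrC a).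
by rewrite !addrA -!(addrAC _ (d1 *: X')) -!(addrAC _ (d2 *: Y')) -!(addrAC _ (d3 *: Z')).
Qed.

Lemma prodmxP d a A A' B : prodmx d (a *: A + A') B = a *: prodmx d A B + prodmx d A' B.
Proof.
case: d => [[[d1 d2] d3] d4]; rewrite /prodmx anticommP !starmxP !mulmxDl -!scalemxAl mxtraceD mxtraceZ.
exact: scaler4DE.
Qed.

Lemma prodmxPr d a A B B' : prodmx d A (a *: B + B') = a *: prodmx d A B + prodmx d A B'.
Proof.
case: d => [[[d1 d2] d3] d4]; rewrite /prodmx anticommPr starmxP starmxPr.
rewrite !(mulmxDl, mulmxDr) -!(scalemxAl, scalemxAr) mxtraceD mxtraceZ.
exact: scaler4DE.
Qed.

Section Automorphism.
Hypothesis alb : albert_axioms.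
Variable g : 'M[R]_n.
Hypothesis gP : is_aut g.

Lemma aut_lcomb x : g *m lcomb L (x *m g) = lcomb L x *m g.
Proof.
rewrite lcomb_mulr -(eq_lcomb _ (gP.2)) lcomb_mul mulmx_sumr.
by apply: eq_bigr => i _; rewrite -scalemxAr.
Qed.

(** An automorphism conjugates multiplication by [e *m g] into multiplication by [e], which is the
    identity; evaluating at [e] gives the claim. *)
Lemma aut_unit : e *m g = e.
Proof.
have [[d gd dg] _] := gP.
have eL x : e *m lcomb L x = x.
  rewrite /lcomb mulmx_sumr [RHS]row_sum_delta; apply: eq_bigr => i _.
  by rewrite -scalemxAr (unitr alb).
have : lcomb L (e *m g) = 1%:M.
  by rewrite -[LHS]mul1mx -dg -mulmxA aut_lcomb (unitl alb) mul1mx.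
by move=> le; rewrite -{2}[e]mulmx1 -le eL.
Qed.

Lemma gram_sym : Q^T = Q.
Proof. by apply/matrixP=> i j; rewrite mxE !(traceE alb) (mulC alb). Qed.

Let row_gram i : row i Q = c *: (L i *m trace_col L)^T.
Proof.
apply/rowP => j; rewrite !mxE (traceE alb); congr (_ * _).
have /matrixP/(_ 0 0) := trace_colE L (row j (L i)).
by rewrite -row_mul !mxE eqxx mulr1n => <-.
Qed.

Let aut_trace_col : g *m trace_col L = trace_col L.
Proof.
have [[d gd _] _] := gP; apply/row_matrixP => i; rewrite row_mul trace_colE
  [row i (trace_col L)]rowE trace_colE.
congr _%:M; apply: (trace_form_conj gd); rewrite lcomb_delta; exact: gP.2.
Qed.

(** By [traceE] the form is a multiple of the trace of multiplication by x . y, and conjugation by g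
    does not change this trace. *)
Lemma aut_gram : g *m Q *m g^T = Q.
Proof.
apply/row_matrixP => i; rewrite !row_mul.
have -> : row i g *m Q = c *: (lcomb L (row i g) *m trace_col L)^T.
  rewrite mulmx_sum_row /lcomb mulmx_suml linear_sum scaler_sumr; apply: eq_bigr => k _.
  by rewrite row_gram -scalemxAl [X in _ = _ *: X]linearZ /= !scalerA mulrC.
by rewrite -scalemxAl -trmx_mul mulmxA gP.2 -mulmxA aut_trace_col row_gram.
Qed.

Lemma aut_idT : g^T *m idT *m g = idT.
Proof.
have [[d gd dg] _] := gP.
have QgT : Q *m g^T = d *m Q by rewrite -{2}aut_gram !mulmxA dg mul1mx.
rewrite /idT mulmxBr mulmxBl -scalemxAr -scalemxAl; congr (_ - _ *: _); last first.
  by rewrite !mulmxA -trmx_mul -mulmxA !aut_unit.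
have Q'Q : Q' *m Q = 1%:M by apply: mulmx1C (gram_inv alb).
rewrite -[LHS]mul1mx -{1}Q'Q -!mulmxA (mulmxA Q) QgT.
by rewrite -!mulmxA (mulmxA Q) (gram_inv alb) mul1mx dg mulmx1.
Qed.

Lemma aut_gram_unit : g *m (Q *m e^T) = Q *m e^T.
Proof. by rewrite -{1}aut_unit trmx_mul !mulmxA aut_gram. Qed.

Lemma aut_contract A : contract L (g^T *m A *m g) = contract L A *m g.
Proof.
transitivity (\sum_k row k A *m g *m lcomb L (row k g)).
  rewrite /contract /lcomb.
  under [RHS]eq_bigr => k _ do rewrite mulmx_sumr.
  rewrite exchange_big; apply: eq_bigr => i _ /=.
  rewrite -(mulmxA g^T A g) row_mul [row i g^T *m _]mulmx_sum_row mulmx_suml; apply: eq_bigr => k _.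
  by rewrite !mxE row_mul -scalemxAl -scalemxAr.
rewrite /contract mulmx_suml; apply: eq_bigr => k _.
by rewrite -mulmxA gP.2 mulmxA.
Qed.

Lemma aut_constraints A : constraints A = 0 -> constraints (g^T *m A *m g) = 0.
Proof.
move=> /constraintsP[sA wA cA]; apply/constraintsP; split.
- by rewrite !trmx_mul trmxK sA mulmxA.
- by rewrite -mulmxA aut_gram_unit -mulmxA wA mulmx0.
- by rewrite aut_contract cA mul0mx.
Qed.

Lemma aut_lmulT x : g *m lcomb lmulT (x *m g) = lcomb lmulT x *m g.
Proof.
rewrite -!(lcomb_mulr L) mulmxA aut_lcomb -!mulmxA; congr (_ *m _).
rewrite /traceless_proj mulmxBl mulmxBr mul1mx mulmx1 -scalemxAl -scalemxAr.
by rewrite -!mulmxA aut_unit !mulmxA -(mulmxA g) aut_gram_unit.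
Qed.

Lemma starmxE A B : starmx A B = 2 *: \sum_i ((lmulT i)^T *m B *m lcomb lmulT (row i A)).
Proof.
congr (_ *: _); apply: eq_bigr => i _; rewrite /lcomb mulmx_sumr; apply: eq_bigr => j _.
by rewrite mxE scalemxAr.
Qed.

Lemma aut_starmx A B : starmx (g^T *m A *m g) (g^T *m B *m g) = g^T *m starmx A B *m g.
Proof.
rewrite !starmxE -scalemxAr -scalemxAl; congr (_ *: _).
(* Absorbing [g^T] into the outer sum turns it into a sum over k of multiplications by [row k g], to
   which [aut_lmulT] applies. *)
transitivity (\sum_k (lcomb lmulT (row k g))^T *m (g^T *m B *m g)
                *m lcomb lmulT (row k A *m g)).
  have trE k (X : 'M[R]_n) Y : (lcomb lmulT (row k g))^T *m X *m Y
      = \sum_i g k i *: ((lmulT i)^T *m X *m Y).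
    rewrite /lcomb [(\sum_i _)^T]raddf_sum !mulmx_suml; apply: eq_bigr => i _.
    by rewrite /= [(_ *: _)^T]linearZ /= -!scalemxAl mxE.
  under [RHS]eq_bigr => k _ do rewrite trE.
  rewrite exchange_big; apply: eq_bigr => i _ /=.
  rewrite -(mulmxA g^T A g) row_mul lcomb_mul mulmx_sumr; apply: eq_bigr => k _.
  by rewrite -scalemxAr !mxE row_mul.
rewrite mulmx_sumr mulmx_suml; apply: eq_bigr => k _.
have -> : (lcomb lmulT (row k g))^T *m (g^T *m B *m g)
    = (g *m lcomb lmulT (delta_mx 0 k *m g))^T *m B *m g.
  by rewrite -rowE trmx_mul !mulmxA.
by rewrite -(mulmxA _ g) !aut_lmulT lcomb_delta trmx_mul !mulmxA.
Qed.

Lemma aut_anticomm A B : anticomm (g^T *m A *m g) (g^T *m B *m g) = g^T *m anticomm A B *m g.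
Proof.
have aux X Y : g^T *m X *m g *m Q *m (g^T *m Y *m g) = g^T *m (X *m Q *m Y) *m g.
  by rewrite -{2}aut_gram !mulmxA.
by rewrite /anticomm !aux mulmxDr mulmxDl.
Qed.

Lemma aut_prodmx d A B : prodmx d (g^T *m A *m g) (g^T *m B *m g) = g^T *m prodmx d A B *m g.
Proof.
case: d => [[[d1 d2] d3] d4]; rewrite /prodmx aut_anticomm aut_starmx.
rewrite -{1}aut_idT aut_starmx !(mulmxDr, mulmxDl) -!(scalemxAr, scalemxAl) aut_idT.
congr (_ + (_ * _) *: _); first by rewrite /anticomm mulmxDr mulmxDl.
have -> X Y : g^T *m X *m g *m Q *m (g^T *m Y *m g) *m Q = g^T *m (X *m Q *m Y *m g *m Q).
  by rewrite -{3}aut_gram !mulmxA.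
by rewrite mxtrace_mulC -!mulmxA (mulmxA g) aut_gram.
Qed.

End Automorphism.
End Products.
End Coordinates.

(** * Base change, dual numbers and derivations *)

Section BaseChange.
Variables (R S : comNzRingType) (f : {rmorphism R -> S}) (n : nat).
Variables (L : 'I_n -> 'M[R]_n) (Q Q' : 'M[R]_n) (e : 'rV[R]_n) (c t : R).
Implicit Types A B : 'M[R]_n.

Local Notation "A ^f" := (map_mx f A).
Local Notation Lf := (fun i => (L i)^f).

Lemma map_mx_sum I (r : seq I) (P : pred I) m p (F : I -> 'M[R]_(m, p)) :
  (\sum_(i <- r | P i) F i)^f = \sum_(i <- r | P i) (F i)^f.
Proof. exact: (raddf_sum (map_mx f)). Qed.

Lemma map_lcomb (N : 'I_n -> 'M[R]_n) x :
  (lcomb N x)^f = lcomb (fun i => (N i)^f) x^f.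
Proof. by rewrite map_mx_sum; apply: eq_bigr => i _; rewrite map_mxZ mxE. Qed.

Lemma map_contract A : (contract L A)^f = contract Lf (map_mx f A).
Proof.
by rewrite map_mx_sum; apply: eq_bigr => i _; rewrite map_mxM map_row.
Qed.

Lemma map_traceless_proj : (traceless_proj Q e t)^f = traceless_proj Q^f e^f (f t).
Proof. by rewrite map_mxB map_mx1 map_mxZ !map_mxM -map_trmx. Qed.

Lemma map_lmulT i : (lmulT L Q e t i)^f = lmulT Lf Q^f e^f (f t) i.
Proof. by rewrite map_mxM map_traceless_proj. Qed.

Lemma map_idT : (idT Q' e t)^f = idT Q'^f e^f (f t).
Proof. by rewrite map_mxB map_mxZ !map_mxM -map_trmx. Qed.

Lemma map_starmx A B :
  (starmx L Q e t A B)^f = starmx Lf Q^f e^f (f t) (map_mx f A) B^f.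
Proof.
rewrite map_mxZ rmorph_nat map_mx_sum; congr (_ *: _); apply: eq_bigr => i _.
rewrite map_mx_sum; apply: eq_bigr => j _.
by rewrite map_mxZ (map_mxM _ _ (lmulT _ _ _ _ _)) map_mxM -map_trmx !map_lmulT mxE.
Qed.

Lemma map_anticomm A B : (anticomm Q A B)^f = anticomm Q^f (map_mx f A) B^f.
Proof. by rewrite map_mxD !map_mxM. Qed.

Lemma map_prodmx d1 d2 d3 d4 A B :
  (prodmx L Q Q' e t (d1, d2, d3, d4) A B)^f
  = prodmx Lf Q^f Q'^f e^f (f t) (f d1, f d2, f d3, f d4) (map_mx f A) B^f.
Proof.
rewrite /prodmx !map_mxD (map_mxZ f d1) (map_mxZ f d2) (map_mxZ f d3)
  (map_mxZ f (_ * _)) !map_starmx map_anticomm map_idT rmorphM.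
by rewrite -trace_map_mx !map_mxM.
Qed.

Lemma map_constraints A :
  (constraints L Q e A)^f = constraints Lf Q^f e^f (map_mx f A).
Proof.
rewrite map_block_mx map_mx0 map_mxB !map_mxM -!map_trmx; congr block_mx.
by apply/row_matrixP=> i; rewrite -map_row !rowK map_contract.
Qed.

Lemma map_albert_axioms :
  albert_axioms L Q Q' e c -> albert_axioms Lf Q^f Q'^f e^f (f c).
Proof.
case=> ul ur mc tr gi; split.
- by rewrite -map_lcomb ul map_mx1.
- by move=> i; rewrite -map_mxM ur map_delta_mx.
- by move=> i j; rewrite -!map_row mc.
- by move=> i j; rewrite mxE tr rmorphM -trace_map_mx map_lcomb map_row.
- by rewrite -map_mxM gi map_mx1.
Qed.

End BaseChange.

(** A separate name for the pairs, since the product type itself carries the componentwise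
    multiplication. *)
Definition dual (R : Type) : Type := (R * R)%type.

Section DualNumbers.
Variable R : comNzRingType.

HB.instance Definition _ := GRing.Zmodule.on (dual R).

Definition dual_one : dual R := (1, 0).
Definition dual_mul (x y : dual R) : dual R := (x.1 * y.1, x.1 * y.2 + x.2 * y.1).

Fact dual_mulA : associative dual_mul.
Proof.
move=> x y z; congr (_, _) => /=; first by rewrite mulrA.
by rewrite !mulrDl !mulrDr !mulrA addrA.
Qed.
Fact dual_mulC : commutative dual_mul.
Proof.
by move=> x y; rewrite /dual_mul (mulrC y.1) (mulrC y.1 x.2) (mulrC y.2) [x.1 * y.2 + _]addrC.
Qed.
Fact dual_mul1 : left_id dual_one dual_mul.
Proof. by move=> [x y]; congr (_, _); rewrite /= !mul1r ?mul0r ?addr0. Qed.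
Fact dual_mulDl : left_distributive dual_mul +%R.
Proof.
by move=> x y z; congr (_, _); rewrite /= !mulrDl // addrACA.
Qed.
Fact dual_one_neq0 : dual_one != 0.
Proof. by apply/eqP => -[/eqP]; rewrite oner_eq0. Qed.

HB.instance Definition _ := GRing.Zmodule_isComNzRing.Build (dual R)
  dual_mulA dual_mulC dual_mul1 dual_mulDl dual_one_neq0.

Definition dual_const (x : R) : dual R := (x, 0).
Definition dual_eps : dual R := (0, 1).

Fact dual_const_additive : {morph dual_const : x y / x - y}.
Proof. by move=> x y; congr (_, _); rewrite subr0. Qed.
HB.instance Definition _ := GRing.isZmodMorphism.Build R (dual R) dual_const
  dual_const_additive.
Fact dual_const_monoid : monoid_morphism dual_const.
Proof. by split=> // x y; congr (_, _); rewrite /= mulr0 mul0r addr0. Qed.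
HB.instance Definition _ := GRing.isMonoidMorphism.Build R (dual R) dual_const
  dual_const_monoid.

Lemma dual_eps2 : dual_eps * dual_eps = 0.
Proof. by congr (_, _); rewrite /= ?mulr0 ?mul0r ?addr0. Qed.

Lemma dual_coef_inj m p (A A' B B' : 'M[R]_(m, p)) :
  map_mx dual_const A + dual_eps *: map_mx dual_const A'
  = map_mx dual_const B + dual_eps *: map_mx dual_const B' ->
  A = B /\ A' = B'.
Proof.
move=> /matrixP AB; split; apply/matrixP=> i j; have := AB i j; rewrite !mxE.
  by case; rewrite ?mul0r ?addr0.
by case; rewrite ?mul0r ?mulr0 ?mul1r ?add0r.
Qed.

End DualNumbers.

Section Derivations.
Variables (R : comNzRingType) (n : nat) (L : 'I_n -> 'M[R]_n).
Implicit Types A B D : 'M[R]_n.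

Definition is_der D := forall i, D *m L i + lcomb L (row i D) = L i *m D.

Definition dact D A := D^T *m A + A *m D.

Local Notation "A ^d" := (map_mx (@dual_const R) A) (at level 1, format "A ^d").
Local Notation eps := (dual_eps R).

Lemma mulmx_eps m p q (A A' : 'M[R]_(m, p)) (B B' : 'M[R]_(p, q)) :
  (A^d + eps *: A'^d) *m (B^d + eps *: B'^d)
  = (A *m B)^d + eps *: (A *m B' + A' *m B)^d.
Proof.
rewrite mulmxDl !mulmxDr -!(scalemxAl, scalemxAr) scalerA dual_eps2 scale0r addr0.
by rewrite -addrA -scalerDr map_mxD !map_mxM.
Qed.

(* 1 + eps D is an automorphism over the dual numbers: a point of Aut(J) which turns the
   equivariance of a product into the Leibniz rule for D. *)
Definition exp_der D := 1%:M + eps *: D^d.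

Lemma exp_der_conj D A : (exp_der D)^T *m A^d *m exp_der D = A^d + eps *: (dact D A)^d.
Proof.
have := mulmx_eps 1%:M D^T A 0; rewrite map_mx0 scaler0 addr0 map_mx1 mulmx0 add0r.
have -> : (exp_der D)^T = 1%:M + eps *: (D^T)^d.
  by rewrite /exp_der [LHS]linearD /= trmx1 [(_ *: _)^T]linearZ /= map_trmx.
rewrite mul1mx => ->.
have := mulmx_eps A (D^T *m A) 1%:M D; rewrite map_mx1 mulmx1 => ->.
by rewrite mulmx1 addrC [A *m D + _]addrC addrC.
Qed.

Lemma exp_der_aut D : is_der D -> is_aut (fun i => (L i)^d) (exp_der D).
Proof.
move=> dD; split.
  exists (exp_der (- D)); rewrite /exp_der.
    have := mulmx_eps 1%:M D 1%:M (- D); rewrite map_mx1 => ->.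
    by rewrite !mul1mx mulmx1 addNr map_mx0 scaler0 addr0 map_mx1.
  have := mulmx_eps 1%:M (- D) 1%:M D; rewrite map_mx1 => ->.
  by rewrite !mul1mx mulmx1 subrr map_mx0 scaler0 addr0 map_mx1.
move=> i; have -> : row i (exp_der D) = delta_mx 0 i + eps *: (row i D)^d.
  by rewrite linearD linearZ /= row1 map_row.
rewrite linearD linearZ /= lcomb_delta -map_lcomb /exp_der.
have := mulmx_eps 1%:M D (L i) (lcomb L (row i D)); rewrite map_mx1 => ->.
have := mulmx_eps (L i) 0 1%:M D; rewrite map_mx1 map_mx0 scaler0 addr0 => ->.
by rewrite !mul1mx mulmx1 mul0mx addr0 [lcomb _ _ + _]addrC dD.
Qed.

(** The coefficient of eps in the equivariance at 1 + eps D is the Leibniz rule. The extension [W]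
    of [V] is left abstract because the lemma serves both the explicit family [prodmx] and the
    scalar extension of an arbitrary product. *)
Lemma der_of_aut (V : 'M[R]_n -> 'M[R]_n -> 'M[R]_n)
    (W : 'M[dual R]_n -> 'M[dual R]_n -> 'M[dual R]_n) D A B :
  (forall (a : dual R) X X' Y, W (a *: X + X') Y = a *: W X Y + W X' Y) ->
  (forall (a : dual R) X Y Y', W X (a *: Y + Y') = a *: W X Y + W X Y') ->
  (forall A B, W A^d B^d = (V A B)^d) ->
  W ((exp_der D)^T *m A^d *m exp_der D) ((exp_der D)^T *m B^d *m exp_der D)
    = (exp_der D)^T *m W A^d B^d *m exp_der D ->
  V (dact D A) B + V A (dact D B) = dact D (V A B).
Proof.
move=> Wl Wr WV; rewrite !exp_der_conj WV exp_der_conj.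
rewrite ![map_mx _ _ + _]addrC Wl !Wr !WV -[RHS]addrC.
rewrite scalerDr scalerA dual_eps2 scale0r add0r addrA -scalerDr -map_mxD addrC.
by case/dual_coef_inj.
Qed.

End Derivations.

Section DerivationAction.
Variables (R : comNzRingType) (n : nat) (L : 'I_n -> 'M[R]_n).
Variables (Q Q' : 'M[R]_n) (e : 'rV[R]_n) (c t : R).
Hypothesis alb : albert_axioms L Q Q' e c.
Implicit Types A B D : 'M[R]_n.

Lemma der_contract D A : is_der L D -> contract L (dact D A) = contract L A *m D.
Proof.
move=> /exp_der_aut dD; have := aut_contract dD (map_mx (@dual_const R) A).
rewrite exp_der_conj linearD linearZ /= -!map_contract.
have := mulmx_eps (contract L A) 0 1%:M D; rewrite map_mx1 map_mx0 scaler0 addr0 => ->.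
by rewrite mulmx1 mul0mx addr0 => /dual_coef_inj[].
Qed.

Lemma der_constraints D A : is_der L D ->
  constraints L Q e A = 0 -> constraints L Q e (dact D A) = 0.
Proof.
move=> /exp_der_aut dD cA.
have := aut_constraints (map_albert_axioms (@dual_const R) alb) dD.
move=> /(_ (map_mx (@dual_const R) A)); rewrite exp_der_conj linearD linearZ /= -!map_constraints.
rewrite cA map_mx0 add0r => /(_ erefl) h.
(* Since eps is a zero divisor it cannot be cancelled; coefficients are compared instead. *)
have : map_mx (@dual_const R) 0 + dual_eps R *: map_mx (@dual_const R) (constraints L Q e (dact D A))
  = map_mx (@dual_const R) 0 + dual_eps R *: map_mx (@dual_const R) 0.
  by rewrite map_mx0 add0r h scaler0 addr0.
by case/dual_coef_inj.
Qed.

Lemma der_prodmx D d A B : is_der L D ->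
  prodmx L Q Q' e t d (dact D A) B + prodmx L Q Q' e t d A (dact D B)
  = dact D (prodmx L Q Q' e t d A B).
Proof.
case: d => [[[d1 d2] d3] d4] /exp_der_aut dD.
pose h : {rmorphism R -> dual R} := @dual_const R.
pose W := prodmx (fun i => map_mx h (L i)) (map_mx h Q) (map_mx h Q') (map_mx h e) (h t)
  (h d1, h d2, h d3, h d4).
apply: (@der_of_aut _ _ _ W) => [a X X' Y|a X Y Y'|X Y|].
- exact: prodmxP.
- exact: prodmxPr.
- by rewrite map_prodmx.
- exact: (aut_prodmx _ (map_albert_axioms h alb) dD).
Qed.

End DerivationAction.

(** * Sparse vectors with integer coefficients *)

(* A list of pairs (key, integer) stands for a vector, namely [realize] of the list; an
   identity between such vectors holds in every lmodule once [vanishes] computes to true. *)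
Section SparseVectors.
Variable T : Type.
Variable eqT : T -> T -> bool.
Hypothesis eqT_eq : forall x y, eqT x y -> x = y.
Local Notation sparse := (seq (T * Z)).

Fixpoint add_term (k : T) (c : Z) (l : sparse) : sparse :=
  if l is (k', c') :: l' then
    if eqT k k' then (k', Z.add c c') :: l' else (k', c') :: add_term k c l'
  else [:: (k, c)].

Definition collect (l : sparse) : sparse :=
  foldr (fun x => add_term x.1 x.2) [::] l.

Definition vanishes (l : sparse) : bool :=
  all (fun x => Z.eqb x.2 Z0) (collect l).

Definition sscale (c : Z) (l : sparse) : sparse := [seq (x.1, Z.mul c x.2) | x <- l].

Variables (K : comNzRingType) (V : lmodType K) (B : T -> V).

(** The tables use binary integers so that the checks compute quickly. As this is the ring map to K,
    an identity checked over Z holds in every characteristic. *)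
Definition ofZ (z : Z) : K := (int_of_Z z)%:~R.

Lemma ofZD a b : ofZ (Z.add a b) = ofZ a + ofZ b.
Proof. by rewrite /ofZ (rmorphD int_of_Z a b) rmorphD. Qed.

Lemma ofZM a b : ofZ (Z.mul a b) = ofZ a * ofZ b.
Proof. by rewrite /ofZ (rmorphM int_of_Z a b) rmorphM. Qed.

Definition realize (l : sparse) : V := \sum_(x <- l) ofZ x.2 *: B x.1.

Lemma realize_nil : realize [::] = 0.
Proof. exact: big_nil. Qed.

Lemma realize_cons x l : realize (x :: l) = ofZ x.2 *: B x.1 + realize l.
Proof. exact: big_cons. Qed.

Lemma realize_cat l l' : realize (l ++ l') = realize l + realize l'.
Proof. exact: big_cat. Qed.

Lemma realize_scale c l : realize (sscale c l) = ofZ c *: realize l.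
Proof.
rewrite /realize big_map scaler_sumr; apply: eq_bigr => x _.
by rewrite ofZM scalerA.
Qed.

Lemma vanishesP l : vanishes l -> realize l = 0.
Proof.
have addE k c l' : realize (add_term k c l') = ofZ c *: B k + realize l'.
  elim: l' => [|[k' c'] l' IH] /=; first by rewrite realize_cons.
  case: ifP => [/eqT_eq->|_]; rewrite !realize_cons /=.
    by rewrite ofZD scalerDl addrA.
  by rewrite IH addrCA.
have <- : realize (collect l) = realize l.
  by elim: l => [|x l IH] //=; rewrite addE IH realize_cons.
rewrite /vanishes; elim: (collect l) => [|[k c] l' IH] /=; first by rewrite realize_nil.
by case/andP => /Z.eqb_eq-> /IH; rewrite realize_cons => ->; rewrite /ofZ /= scale0r add0r.
Qed.

End SparseVectors.

Definition sbind (T U : Type) (F : T -> seq (U * Z)) (l : seq (T * Z)) : seq (U * Z) :=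
  flatten [seq sscale x.2 (F x.1) | x <- l].

(** Replaces a linear map by a computation on lists as soon as its values on the basis are known;
    through it the boolean checks acquire their algebraic meaning. *)
Lemma realize_bind (K : comNzRingType) (V W : lmodType K) (T U : Type)
    (B : T -> V) (B' : U -> W) (F : T -> seq (U * Z)) (phi : V -> W) l :
  linear phi -> (forall k, phi (B k) = realize B' (F k)) ->
  phi (realize B l) = realize B' (sbind F l).
Proof.
move=> phi_lin phiB; have phi0 : phi 0 = 0.
  by have := phi_lin 1 0 0; rewrite !scale1r addr0 => /eqP;
     rewrite -subr_eq0 opprD addrA subrr sub0r oppr_eq0 => /eqP.
elim: l => [|x l IH]; first by rewrite !realize_nil.
by rewrite realize_cons phi_lin IH phiB realize_cat realize_scale.
Qed.

Definition eq_pair (x y : nat * nat) : bool := Nat.eqb x.1 y.1 && Nat.eqb x.2 y.2.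

Lemma eq_pairP x y : eq_pair x y -> x = y.
Proof.
by case: x y => [a b] [c d] /andP[/Nat.eqb_eq /= -> /Nat.eqb_eq /= ->].
Qed.

Lemma eqb_nat_eq x y : Nat.eqb x y -> x = y.
Proof. by move/Nat.eqb_eq. Qed.

(** * The structure constants of the split Albert algebra *)

Local Notation "k # c" := (k%N, (c : Z)%Z) (at level 36, c at level 35).

(* Six times the products of the basis vectors of H_3 (the factor clears denominators).  The
   vectors 0-7, 8-15, 16-23 are the matrix units of the octonions at the entries (0, 1),
   (1, 2), (2, 0); 24, 25, 26 are diag(1, -1, 0), diag(0, 1, -1) and the identity. *)
Definition mul_table : seq (seq (seq (nat * Z))) := [::
 [::
   [::]; [::]; [::]; [::24#1; 25#2; 26#2]; [::]; [::]; [::]; [::]; [::19#3]; [::17#-3]; [::];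
   [::]; [::20#-3]; [::]; [::22#-3]; [::]; [::11#3]; [::]; [::10#-3]; [::]; [::]; [::13#-3];
   [::]; [::15#-3]; [::]; [::0#3]; [::0#6]];
 [::
   [::]; [::]; [::24#-1; 25#-2; 26#-2]; [::]; [::]; [::]; [::]; [::]; [::]; [::]; [::19#3];
   [::17#-3]; [::21#-3]; [::]; [::23#-3]; [::]; [::9#-3]; [::]; [::8#3]; [::]; [::13#3]; [::];
   [::15#3]; [::]; [::]; [::1#3]; [::1#6]];
 [::
   [::]; [::24#-1; 25#-2; 26#-2]; [::]; [::]; [::]; [::]; [::]; [::]; [::18#-3]; [::16#3];
   [::]; [::]; [::]; [::20#-3]; [::]; [::22#-3]; [::]; [::11#3]; [::]; [::10#-3]; [::];
   [::12#3]; [::]; [::14#3]; [::]; [::2#3]; [::2#6]];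
 [::
   [::24#1; 25#2; 26#2]; [::]; [::]; [::]; [::]; [::]; [::]; [::]; [::]; [::]; [::18#-3];
   [::16#3]; [::]; [::21#-3]; [::]; [::23#-3]; [::]; [::9#-3]; [::]; [::8#3]; [::12#-3]; [::];
   [::14#-3]; [::]; [::]; [::3#3]; [::3#6]];
 [::
   [::]; [::]; [::]; [::]; [::]; [::]; [::]; [::24#-1; 25#-2; 26#-2]; [::]; [::21#3]; [::];
   [::20#-3]; [::]; [::]; [::18#3]; [::19#3]; [::12#-3]; [::13#-3]; [::]; [::]; [::]; [::];
   [::10#-3]; [::8#3]; [::]; [::4#3]; [::4#6]];
 [::
   [::]; [::]; [::]; [::]; [::]; [::]; [::24#1; 25#2; 26#2]; [::]; [::21#-3]; [::]; [::20#3];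
   [::]; [::]; [::]; [::16#-3]; [::17#-3]; [::]; [::]; [::12#-3]; [::13#-3]; [::]; [::];
   [::11#-3]; [::9#3]; [::]; [::5#3]; [::5#6]];
 [::
   [::]; [::]; [::]; [::]; [::]; [::24#1; 25#2; 26#2]; [::]; [::]; [::]; [::23#3]; [::];
   [::22#-3]; [::18#-3]; [::19#-3]; [::]; [::]; [::14#-3]; [::15#-3]; [::]; [::]; [::10#3];
   [::8#-3]; [::]; [::]; [::]; [::6#3]; [::6#6]];
 [::
   [::]; [::]; [::]; [::]; [::24#-1; 25#-2; 26#-2]; [::]; [::]; [::]; [::23#-3]; [::];
   [::22#3]; [::]; [::16#3]; [::17#3]; [::]; [::]; [::]; [::]; [::14#-3]; [::15#-3]; [::11#3];
   [::9#-3]; [::]; [::]; [::]; [::7#3]; [::7#6]];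
 [::
   [::19#3]; [::]; [::18#-3]; [::]; [::]; [::21#-3]; [::]; [::23#-3]; [::]; [::]; [::];
   [::24#-2; 25#-1; 26#2]; [::]; [::]; [::]; [::]; [::3#3]; [::1#-3]; [::]; [::]; [::4#-3];
   [::]; [::6#-3]; [::]; [::8#-3]; [::]; [::8#6]];
 [::
   [::17#-3]; [::]; [::16#3]; [::]; [::21#3]; [::]; [::23#3]; [::]; [::]; [::];
   [::24#2; 25#1; 26#-2]; [::]; [::]; [::]; [::]; [::]; [::]; [::]; [::3#3]; [::1#-3];
   [::5#-3]; [::]; [::7#-3]; [::]; [::9#-3]; [::]; [::9#6]];
 [::
   [::]; [::19#3]; [::]; [::18#-3]; [::]; [::20#3]; [::]; [::22#3]; [::];
   [::24#2; 25#1; 26#-2]; [::]; [::]; [::]; [::]; [::]; [::]; [::2#-3]; [::0#3]; [::]; [::];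
   [::]; [::4#-3]; [::]; [::6#-3]; [::10#-3]; [::]; [::10#6]];
 [::
   [::]; [::17#-3]; [::]; [::16#3]; [::20#-3]; [::]; [::22#-3]; [::]; [::24#-2; 25#-1; 26#2];
   [::]; [::]; [::]; [::]; [::]; [::]; [::]; [::]; [::]; [::2#-3]; [::0#3]; [::]; [::5#-3];
   [::]; [::7#-3]; [::11#-3]; [::]; [::11#6]];
 [::
   [::20#-3]; [::21#-3]; [::]; [::]; [::]; [::]; [::18#-3]; [::16#3]; [::]; [::]; [::]; [::];
   [::]; [::]; [::]; [::24#2; 25#1; 26#-2]; [::]; [::5#3]; [::]; [::4#-3]; [::]; [::]; [::2#3];
   [::3#3]; [::12#-3]; [::]; [::12#6]];
 [::
   [::]; [::]; [::20#-3]; [::21#-3]; [::]; [::]; [::19#-3]; [::17#3]; [::]; [::]; [::]; [::];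
   [::]; [::]; [::24#-2; 25#-1; 26#2]; [::]; [::5#-3]; [::]; [::4#3]; [::]; [::]; [::];
   [::0#-3]; [::1#-3]; [::13#-3]; [::]; [::13#6]];
 [::
   [::22#-3]; [::23#-3]; [::]; [::]; [::18#3]; [::16#-3]; [::]; [::]; [::]; [::]; [::]; [::];
   [::]; [::24#-2; 25#-1; 26#2]; [::]; [::]; [::]; [::7#3]; [::]; [::6#-3]; [::2#-3]; [::3#-3];
   [::]; [::]; [::14#-3]; [::]; [::14#6]];
 [::
   [::]; [::]; [::22#-3]; [::23#-3]; [::19#3]; [::17#-3]; [::]; [::]; [::]; [::]; [::]; [::];
   [::24#2; 25#1; 26#-2]; [::]; [::]; [::]; [::7#-3]; [::]; [::6#3]; [::]; [::0#3]; [::1#3];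
   [::]; [::]; [::15#-3]; [::]; [::15#6]];
 [::
   [::11#3]; [::9#-3]; [::]; [::]; [::12#-3]; [::]; [::14#-3]; [::]; [::3#3]; [::]; [::2#-3];
   [::]; [::]; [::5#-3]; [::]; [::7#-3]; [::]; [::]; [::]; [::24#1; 25#-1; 26#2]; [::]; [::];
   [::]; [::]; [::16#3]; [::16#-3]; [::16#6]];
 [::
   [::]; [::]; [::11#3]; [::9#-3]; [::13#-3]; [::]; [::15#-3]; [::]; [::1#-3]; [::]; [::0#3];
   [::]; [::5#3]; [::]; [::7#3]; [::]; [::]; [::]; [::24#-1; 25#1; 26#-2]; [::]; [::]; [::];
   [::]; [::]; [::17#3]; [::17#-3]; [::17#6]];
 [::
   [::10#-3]; [::8#3]; [::]; [::]; [::]; [::12#-3]; [::]; [::14#-3]; [::]; [::3#3]; [::];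
   [::2#-3]; [::]; [::4#3]; [::]; [::6#3]; [::]; [::24#-1; 25#1; 26#-2]; [::]; [::]; [::];
   [::]; [::]; [::]; [::18#3]; [::18#-3]; [::18#6]];
 [::
   [::]; [::]; [::10#-3]; [::8#3]; [::]; [::13#-3]; [::]; [::15#-3]; [::]; [::1#-3]; [::];
   [::0#3]; [::4#-3]; [::]; [::6#-3]; [::]; [::24#1; 25#-1; 26#2]; [::]; [::]; [::]; [::];
   [::]; [::]; [::]; [::19#3]; [::19#-3]; [::19#6]];
 [::
   [::]; [::13#3]; [::]; [::12#-3]; [::]; [::]; [::10#3]; [::11#3]; [::4#-3]; [::5#-3]; [::];
   [::]; [::]; [::]; [::2#-3]; [::0#3]; [::]; [::]; [::]; [::]; [::]; [::]; [::];
   [::24#-1; 25#1; 26#-2]; [::20#3]; [::20#-3]; [::20#6]];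
 [::
   [::13#-3]; [::]; [::12#3]; [::]; [::]; [::]; [::8#-3]; [::9#-3]; [::]; [::]; [::4#-3];
   [::5#-3]; [::]; [::]; [::3#-3]; [::1#3]; [::]; [::]; [::]; [::]; [::]; [::];
   [::24#1; 25#-1; 26#2]; [::]; [::21#3]; [::21#-3]; [::21#6]];
 [::
   [::]; [::15#3]; [::]; [::14#-3]; [::10#-3]; [::11#-3]; [::]; [::]; [::6#-3]; [::7#-3]; [::];
   [::]; [::2#3]; [::0#-3]; [::]; [::]; [::]; [::]; [::]; [::]; [::]; [::24#1; 25#-1; 26#2];
   [::]; [::]; [::22#3]; [::22#-3]; [::22#6]];
 [::
   [::15#-3]; [::]; [::14#3]; [::]; [::8#3]; [::9#3]; [::]; [::]; [::]; [::]; [::6#-3];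
   [::7#-3]; [::3#3]; [::1#-3]; [::]; [::]; [::]; [::]; [::]; [::]; [::24#-1; 25#1; 26#-2];
   [::]; [::]; [::]; [::23#3]; [::23#-3]; [::23#6]];
 [::
   [::]; [::]; [::]; [::]; [::]; [::]; [::]; [::]; [::8#-3]; [::9#-3]; [::10#-3]; [::11#-3];
   [::12#-3]; [::13#-3]; [::14#-3]; [::15#-3]; [::16#3]; [::17#3]; [::18#3]; [::19#3];
   [::20#3]; [::21#3]; [::22#3]; [::23#3]; [::24#2; 25#4; 26#4]; [::24#2; 25#-2; 26#-2];
   [::24#6]];
 [::
   [::0#3]; [::1#3]; [::2#3]; [::3#3]; [::4#3]; [::5#3]; [::6#3]; [::7#3]; [::]; [::]; [::];
   [::]; [::]; [::]; [::]; [::]; [::16#-3]; [::17#-3]; [::18#-3]; [::19#-3]; [::20#-3];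
   [::21#-3]; [::22#-3]; [::23#-3]; [::24#2; 25#-2; 26#-2]; [::24#-4; 25#-2; 26#4]; [::25#6]];
 [::
   [::0#6]; [::1#6]; [::2#6]; [::3#6]; [::4#6]; [::5#6]; [::6#6]; [::7#6]; [::8#6]; [::9#6];
   [::10#6]; [::11#6]; [::12#6]; [::13#6]; [::14#6]; [::15#6]; [::16#6]; [::17#6]; [::18#6];
   [::19#6]; [::20#6]; [::21#6]; [::22#6]; [::23#6]; [::24#6]; [::25#6]; [::26#6]]].

(* Derivations acting as the lowering operators of the four simple roots. *)
Definition lower_table : seq (seq (seq (nat * Z))) := [::
 [::
   [::]; [::7#-1]; [::]; [::]; [::2#1]; [::]; [::]; [::]; [::14#1]; [::]; [::]; [::]; [::];
   [::11#-1]; [::]; [::]; [::]; [::]; [::]; [::22#-1]; [::]; [::16#1]; [::]; [::]; [::]; [::];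
   [::]];
 [::
   [::1#1]; [::]; [::3#1]; [::]; [::]; [::]; [::]; [::]; [::]; [::]; [::8#-1]; [::9#-1]; [::];
   [::]; [::]; [::]; [::]; [::]; [::]; [::]; [::21#1]; [::]; [::23#1]; [::]; [::]; [::]; [::]];
 [::
   [::]; [::13#1]; [::]; [::12#-1]; [::]; [::]; [::10#1]; [::11#1]; [::4#1]; [::5#1]; [::];
   [::]; [::]; [::]; [::2#1]; [::0#-1]; [::]; [::]; [::]; [::]; [::]; [::]; [::];
   [::24#1; 25#1]; [::20#1]; [::20#1]; [::]];
 [::
   [::]; [::]; [::22#-1]; [::23#-1]; [::19#1]; [::17#-1]; [::]; [::]; [::]; [::]; [::]; [::];
   [::25#1]; [::]; [::]; [::]; [::7#1]; [::]; [::6#-1]; [::]; [::0#-1]; [::1#-1]; [::]; [::];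
   [::15#-1]; [::15#2]; [::]]].

Local Open Scope Z_scope.
(** Twice the 24 short roots of F_4 in orthonormal coordinates (doubled to be integral), and the
    weight 0 for the three diagonal vectors. The highest weight is that of 18, the lowest that of
    17. *)
Definition weight_table : seq (seq Z) := [::
   [::-1; 1; 1; -1]; [::-1; 1; -1; 1]; [::1; -1; 1; -1]; [::1; -1; -1; 1]; [::1; 1; -1; -1];
   [::-1; -1; -1; -1]; [::1; 1; 1; 1]; [::-1; -1; 1; 1]; [::1; 1; -1; 1]; [::-1; -1; -1; 1];
   [::1; 1; 1; -1]; [::-1; -1; 1; -1]; [::1; -1; -1; -1]; [::-1; 1; -1; -1]; [::1; -1; 1; 1];
   [::-1; 1; 1; 1]; [::0; -2; 0; 0]; [::-2; 0; 0; 0]; [::2; 0; 0; 0]; [::0; 2; 0; 0];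
   [::0; 0; 0; -2]; [::0; 0; -2; 0]; [::0; 0; 2; 0]; [::0; 0; 0; 2]; [::0; 0; 0; 0];
   [::0; 0; 0; 0]; [::0; 0; 0; 0]].
Local Close Scope Z_scope.

(* The heights of the weights, shifted to be nonnegative. *)
Definition height_table : seq nat := [::
   12; 10; 22; 20; 24; 2; 30; 8; 26; 4; 28; 6; 18; 8; 24; 14; 10; 0; 32; 22; 14; 12; 20; 18; 16; 16; 16].

(* Preimages of the basis vectors under the multiplication map from S^2 W onto J (up to a common
   factor): subtracting them from (b i)(b j) gives the elements [kernel_vec i j] of V'. *)
Definition section_table : seq (seq (nat * nat * Z)) := [::
   [::(10,17)#2]; [::(8,17)#-2]; [::(10,16)#-2]; [::(8,16)#2]; [::(8,20)#-2]; [::(9,20)#-2];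
   [::(8,22)#-2]; [::(9,22)#-2]; [::(1,18)#2]; [::(1,16)#-2]; [::(0,18)#-2]; [::(0,16)#2];
   [::(2,21)#2]; [::(0,21)#-2]; [::(2,23)#2]; [::(0,23)#-2]; [::(2,9)#2]; [::(0,9)#-2];
   [::(2,8)#-2]; [::(0,8)#2]; [::(0,12)#-2]; [::(1,12)#-2]; [::(0,14)#-2]; [::(1,14)#-2];
   [::(8,11)#-2; (16,19)#2]; [::(0,3)#2; (16,19)#-2]; [::(0,3)#1; (8,11)#1; (16,19)#1]].

(* The entry (N, l) at (i, j) with i <= j certifies that N [kernel_vec i j] is the sum over
   (o, i', j', c) in l of c times the lowering operator o applied to [kernel_vec i' j'], where
   (i', j') has greater height: hence V' is generated by the square of the vector 18. *)
Definition span_cert : seq (seq (nat * seq (nat * nat * nat * Z))) := [::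
 [::
   (1,[::(2,0,15)#-1]); (2,[::(1,0,0)#1]); (1,[::(0,0,4)#1]); (1,[::]); (2,[::(2,4,15)#-1]);
   (2,[::(2,5,15)#-1]); (2,[::(3,6,20)#-1]); (1,[::(0,0,1)#-1]); (1,[::]); (1,[::]);
   (1,[::(2,0,6)#1]); (1,[::(0,0,13)#-1]); (1,[::]); (1,[::(2,0,1)#1]); (1,[::]);
   (1,[::(3,0,24)#-1]); (1,[::]); (1,[::(2,15,17)#-1]); (1,[::]); (1,[::(2,15,19)#-1]);
   (1,[::(2,0,24)#1]); (1,[::]); (1,[::(0,0,19)#-1]); (1,[::]);
   (1,[::(2,6,17)#-1; (3,5,10)#-1]); (1,[::(3,5,10)#1])];
 [::
   (1,[::(1,0,1)#1]); (1,[::(1,0,2)#1]); (1,[::(1,5,6)#-1]); (1,[::(1,0,4)#1]);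
   (1,[::(1,0,5)#1]); (1,[::(1,0,6)#1]); (1,[::(1,0,7)#1]); (1,[::(1,19,24)#-1]);
   (1,[::(1,7,13)#1]); (1,[::(1,0,10)#1]); (1,[::(1,0,11)#1]); (1,[::]); (1,[::(1,0,13)#1]);
   (1,[::]); (1,[::(1,0,15)#1]); (1,[::]); (1,[::(1,0,17)#1]); (1,[::]); (1,[::(1,0,19)#1]);
   (1,[::(1,0,20)#1]); (1,[::(1,5,19)#-1]); (1,[::(1,0,22)#1]); (1,[::(1,6,17)#-1]);
   (1,[::(1,0,24)#1]); (1,[::(1,0,25)#1])];
 [::
   (1,[::(0,2,4)#1]); (1,[::(0,3,4)#1]); (2,[::(0,4,4)#1]); (1,[::(0,4,5)#1]);
   (1,[::(0,4,6)#1]); (1,[::(0,1,2)#-1]); (1,[::]); (1,[::]); (1,[::(0,4,10)#1]);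
   (1,[::(0,2,13)#-1]); (1,[::(0,4,12)#1]); (1,[::(2,1,2)#1]); (1,[::(0,3,10)#-1]);
   (1,[::(0,4,15)#1]); (1,[::(0,3,20)#1]); (1,[::(0,4,17)#1]); (1,[::(0,4,18)#1]);
   (1,[::(0,4,19)#1; (2,15,18)#1]); (1,[::(0,4,20)#1]); (1,[::]); (1,[::(0,2,19)#-1]);
   (1,[::]); (1,[::(0,4,24)#1]); (1,[::(0,4,25)#1; (0,10,21)#1])];
 [::
   (1,[::(1,2,3)#1]); (1,[::(1,2,4)#1]); (1,[::(1,2,5)#1]); (1,[::(1,2,6)#1]);
   (1,[::(0,1,3)#-1]); (1,[::(1,4,14)#1]); (1,[::(1,16,24)#-1]); (1,[::(1,2,10)#1]);
   (1,[::(1,2,11)#1]); (1,[::(1,2,12)#1]); (1,[::(1,2,13)#1]); (1,[::(0,3,8)#1]);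
   (1,[::(1,2,15)#1]); (1,[::(0,3,21)#1]); (1,[::(1,2,17)#1]); (1,[::(1,2,18)#1]);
   (1,[::(1,2,19)#1]); (1,[::(1,2,20)#1]); (1,[::(1,12,24)#1]); (1,[::(3,2,3)#-1]);
   (1,[::(1,7,18)#1]); (1,[::(1,2,24)#1]); (1,[::(1,2,25)#1])];
 [::
   (1,[::(2,4,8)#1]); (2,[::(2,3,13)#1; (2,4,9)#2]); (2,[::(1,10,10)#1; (2,6,8)#2]);
   (1,[::(0,1,4)#-1; (1,0,2)#1]); (1,[::(1,4,10)#-1]); (1,[::(1,4,11)#-1]); (1,[::(2,4,6)#1]);
   (1,[::(2,4,7)#1]); (1,[::(2,3,4)#-1]); (1,[::(2,1,4)#1]); (1,[::(0,4,8)#1]);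
   (1,[::(2,8,15)#1]); (1,[::(0,4,21)#1]); (1,[::(2,15,21)#1]); (1,[::(2,8,18)#1]);
   (1,[::(2,8,19)#1]); (1,[::(2,4,24)#1]); (1,[::(1,4,20)#1]); (1,[::(2,15,18)#1]);
   (1,[::(1,4,22)#1]); (1,[::(1,10,20)#1; (2,6,21)#-1; (2,8,24)#1]); (1,[::(2,8,25)#1])];
 [::
   (1,[::(2,5,9)#1]); (1,[::(0,8,13)#-1; (1,0,2)#-1; (1,10,11)#1; (2,6,9)#1]);
   (1,[::(0,1,5)#-1]); (1,[::(1,5,10)#-1]); (1,[::(1,5,11)#-1]); (1,[::(2,5,6)#1]);
   (1,[::(0,5,13)#-1]); (1,[::(2,3,5)#-1]); (1,[::(2,1,5)#1]); (1,[::(2,9,14)#1]);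
   (1,[::(2,9,15)#1]); (1,[::(0,5,21)#1]); (1,[::(2,9,17)#1]); (1,[::(0,4,21)#1; (2,9,18)#1]);
   (1,[::(2,9,19)#1; (2,15,21)#1]); (1,[::(2,5,24)#1]); (1,[::(1,5,20)#1]);
   (1,[::(0,5,19)#-1]); (1,[::(1,5,22)#1]); (1,[::(0,13,21)#1; (1,11,20)#1; (2,9,24)#1]);
   (1,[::(2,9,25)#1])];
 [::
   (1,[::(3,6,18)#-1]); (1,[::(0,1,6)#-1]); (1,[::(1,6,10)#-1]); (1,[::(1,6,11)#-1]);
   (1,[::(3,10,18)#-1]); (1,[::(0,6,13)#-1]); (1,[::(1,2,10)#1; (2,3,6)#-1]);
   (1,[::(3,13,18)#-1]); (1,[::(0,6,8)#1]); (1,[::(3,6,24)#-1]);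
   (1,[::(0,4,23)#1; (0,6,21)#1]); (1,[::(3,5,6)#-1]); (2,[::(3,18,18)#-1]); (1,[::(3,4,6)#1]);
   (1,[::(3,18,20)#-1]); (1,[::(1,6,20)#1]); (1,[::(0,6,19)#-1]); (1,[::(1,6,22)#1]);
   (1,[::(1,10,22)#-1; (2,6,23)#1; (3,6,12)#-1]); (1,[::(3,6,12)#1])];
 [::
   (1,[::(0,1,7)#-1]); (1,[::(0,1,8)#-1]); (1,[::(0,1,9)#-1]); (1,[::(0,1,10)#-1]);
   (1,[::(0,1,11)#-1]); (1,[::(0,4,9)#-1]); (1,[::(3,13,16)#1]); (1,[::(0,3,15)#1]);
   (1,[::(0,1,15)#-1]); (1,[::(0,3,17)#1]); (1,[::(0,1,17)#-1]); (1,[::(0,4,23)#1]);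
   (1,[::(3,4,7)#1]); (1,[::(0,1,20)#-1]); (1,[::(0,1,21)#-1]); (1,[::(0,1,22)#-1]);
   (1,[::(0,1,23)#-1]); (1,[::(0,1,24)#-1]); (1,[::(3,7,12)#1])];
 [::
   (1,[::(1,8,10)#-1]); (1,[::(1,13,14)#1]); (2,[::(1,10,10)#-1]); (1,[::]);
   (1,[::(1,10,12)#-1]); (1,[::(1,10,13)#-1]); (1,[::(1,10,14)#-1]); (1,[::(1,10,15)#-1]);
   (1,[::]); (1,[::]); (1,[::(1,10,18)#-1]); (1,[::(1,10,19)#-1]); (1,[::]);
   (1,[::(1,4,25)#1]); (1,[::]); (1,[::(1,6,25)#1]); (1,[::(1,10,24)#-1]); (1,[::(1,10,25)#-1])];
 [::
   (1,[::(1,9,11)#-1]); (1,[::(1,10,11)#-1]); (1,[::(0,9,13)#-1]); (1,[::(1,11,12)#-1]);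
   (1,[::(1,11,13)#-1]); (1,[::(0,8,9)#1]); (1,[::(1,11,15)#-1]); (1,[::(0,9,21)#1]);
   (1,[::(1,11,17)#-1]); (1,[::(1,11,18)#-1]); (1,[::(1,11,19)#-1]); (1,[::]);
   (1,[::(1,5,25)#1]); (1,[::]); (1,[::(1,7,25)#1]); (1,[::(1,11,24)#-1]); (1,[::(1,11,25)#-1])];
 [::
   (1,[::(2,6,10)#1]); (1,[::(0,10,13)#-1]); (2,[::(0,4,4)#-1; (2,3,10)#-2]);
   (2,[::(2,1,10)#2; (2,4,15)#-1]); (1,[::(0,8,10)#1]); (2,[::(3,10,25)#1]); (1,[::]);
   (1,[::]); (1,[::(2,6,18)#1]); (1,[::(2,6,19)#1]); (1,[::(2,6,20)#1]); (1,[::(1,10,20)#1]);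
   (1,[::(0,10,19)#-1]); (1,[::(1,10,22)#1]); (1,[::(3,18,20)#1; (2,6,24)#1]);
   (1,[::(3,10,12)#1])];
 [::
   (1,[::(0,11,13)#-1]); (1,[::(0,12,13)#-1]); (2,[::(0,13,13)#-1]); (1,[::(0,9,10)#1]);
   (1,[::(0,13,15)#-1]); (1,[::(0,11,21)#1]); (1,[::(0,13,17)#-1]);
   (1,[::(0,10,21)#-1; (0,13,18)#-1]); (1,[::(3,4,11)#1; (3,5,10)#1]); (1,[::(0,13,20)#-1]);
   (1,[::(1,11,20)#1]); (1,[::(0,11,19)#-1]); (1,[::(3,3,11)#-1]); (1,[::(0,13,24)#-1]);
   (1,[::(0,13,25)#-1])];
 [::
   (1,[::(2,3,12)#-1]); (2,[::(2,3,13)#-1]); (1,[::(0,8,12)#1]);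
   (1,[::(0,8,13)#-1; (1,0,2)#-1; (2,3,15)#-1]); (1,[::(0,12,21)#1]);
   (1,[::(3,5,12)#-1; (2,9,25)#1]); (1,[::(2,3,18)#-1]); (1,[::(2,8,25)#-1; (3,4,12)#1]);
   (1,[::(2,3,20)#-1]); (1,[::(1,12,20)#1]); (1,[::(0,10,21)#1; (0,12,19)#-1]);
   (1,[::(1,12,22)#1]); (1,[::(1,2,20)#1; (2,3,24)#-1]); (2,[::(3,12,12)#1])];
 [::
   (1,[::(2,1,13)#1]); (1,[::(0,8,13)#1]); (2,[::(3,13,25)#1]);
   (1,[::(0,13,21)#1; (1,11,20)#1]); (1,[::(2,1,17)#1]); (1,[::(1,10,20)#-1; (2,6,21)#1]);
   (1,[::(2,1,19)#1]); (1,[::(2,1,20)#1]); (1,[::(1,13,20)#1]); (1,[::(2,1,22)#1; (2,6,17)#1]);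
   (1,[::(1,13,22)#1]); (1,[::(1,0,20)#-1; (2,1,24)#1]); (1,[::(3,12,13)#1])];
 [::
   (1,[::(0,8,14)#1]); (1,[::(0,8,15)#1]); (1,[::(0,3,25)#-1]); (1,[::(0,9,19)#-1]);
   (1,[::(0,8,18)#1]); (1,[::(0,8,19)#1]); (1,[::(0,10,21)#-1]); (1,[::(0,8,21)#1]);
   (1,[::(0,6,25)#1]); (1,[::(0,8,23)#1]); (1,[::(0,4,23)#1; (0,8,24)#1]); (1,[::(0,8,25)#1])];
 [::
   (1,[::(3,15,24)#-1]); (1,[::(0,9,19)#1; (0,15,21)#1]); (1,[::(3,5,15)#-1]);
   (2,[::(3,6,12)#1; (3,18,25)#1]); (1,[::(3,4,15)#1]); (1,[::(2,15,25)#1; (3,5,10)#1]);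
   (1,[::(1,15,20)#1]); (1,[::(0,15,19)#-1]); (1,[::(1,15,22)#1]); (2,[::(3,24,24)#-1]);
   (1,[::(3,12,15)#1])];
 [::
   (1,[::(0,16,21)#1]); (1,[::(0,17,21)#1]); (1,[::(0,18,21)#1]); (1,[::]);
   (1,[::(0,20,21)#1]); (1,[::(1,16,20)#1]); (1,[::(0,17,18)#-1]); (1,[::(0,21,23)#1]);
   (1,[::(0,4,9)#-1; (0,21,24)#1]); (1,[::(0,4,9)#1; (0,21,25)#1])];
 [::
   (1,[::(3,5,17)#-1]); (1,[::(0,8,13)#1; (0,19,21)#1; (1,10,11)#-1; (2,6,9)#-1; (3,5,18)#-1]);
   (2,[::(1,0,0)#-1; (3,4,17)#2]); (2,[::(2,17,25)#2; (2,5,15)#-1]); (1,[::(1,17,20)#1]);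
   (1,[::(0,17,19)#-1]); (1,[::(1,17,22)#1]); (1,[::(2,9,15)#-1; (3,5,24)#-1]);
   (1,[::(3,12,17)#1])];
 [::
   (1,[::]); (2,[::(1,10,10)#1; (2,6,8)#2; (3,4,18)#2]); (2,[::(0,4,4)#-1; (2,18,24)#2]);
   (1,[::(1,18,20)#1]); (1,[::(0,18,19)#-1]); (1,[::(1,18,22)#1]);
   (1,[::(1,2,10)#-1; (2,3,6)#1; (2,18,23)#1; (3,12,18)#-1]);
   (1,[::(1,2,10)#1; (2,3,6)#-1; (3,12,18)#1])];
 [::
   (1,[::(3,4,19)#1]); (2,[::(2,4,15)#-1; (2,19,24)#2]); (1,[::(1,19,20)#1]);
   (2,[::(0,19,19)#-1]); (1,[::(1,19,22)#1]); (1,[::(2,8,15)#1; (3,4,24)#1]);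
   (1,[::(3,12,19)#1])];
 [::
   (1,[::(2,20,24)#1]); (2,[::(1,20,20)#1]); (1,[::(0,19,20)#-1]);
   (1,[::(0,19,21)#1; (1,20,22)#1]); (2,[::(2,24,24)#1]); (1,[::(3,12,20)#1])];
 [::
   (1,[::(1,20,21)#1]); (1,[::(0,19,21)#-1]); (1,[::(1,20,23)#1]); (1,[::(1,20,24)#1]);
   (1,[::(1,20,25)#1])];
 [::
   (1,[::(0,19,22)#-1]); (1,[::(0,19,23)#-1]); (1,[::(0,19,24)#-1]); (1,[::(0,19,25)#-1])];
 [::
   (1,[::(1,22,23)#1]); (1,[::(1,22,24)#1]); (1,[::(1,22,25)#1])];
 [::
   (1,[::(2,3,15)#2; (2,23,24)#1; (2,23,25)#-1; (3,12,25)#1]);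
   (1,[::(0,8,13)#-1; (0,19,21)#-1; (2,3,15)#-1; (3,12,24)#1])];
 [::
   (1,[::(2,3,15)#2; (3,12,25)#1; (0,8,13)#2; (1,0,2)#2])]].

Local Open Scope nat_scope.
Definition mulb s t := nth [::] (nth [::] mul_table s) t.
Definition lower o s := nth [::] (nth [::] lower_table o) s.
Definition weight k s := nth Z0 (nth [::] weight_table s) k.
Definition torus k s := [:: (s, weight k s)].
Definition height s := nth 0%N height_table s.
Definition section u := nth [::] section_table u.

(* An automorphism of the basis exchanging the highest weight vector 18 and the lowest weight
   vector 17. *)
Definition swap s :=
  if (s < 24)%N then (let r := s %% 8 in s - r + (if r < 4 then 3 - r else 11 - r))%N else s.

Definition act_sym (F : nat -> seq (nat * Z)) (p : nat * nat) : seq (nat * nat * Z) :=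
  [seq ((x.1, p.2), x.2) | x <- F p.1] ++ [seq ((p.1, x.1), x.2) | x <- F p.2].

Definition ordered (p : nat * nat) : nat * nat :=
  if (p.1 <= p.2)%N then p else (p.2, p.1).

Definition order_keys (l : seq (nat * nat * Z)) : seq (nat * nat * Z) :=
  [seq (ordered x.1, x.2) | x <- l].

(** The contraction of [sy (i, j)] is a third of [mulb i j], and [section u] contracts to twice the
    vector u; with the coefficient 6 the two contributions cancel. *)
Definition kernel_vec i j : seq (nat * nat * Z) :=
  ((i, j), (6 : Z)%Z) :: sscale (- 1 : Z)%Z (sbind section (mulb i j)).

Definition vanishes1 := vanishes Nat.eqb.
Definition vanishes2 l := vanishes eq_pair (order_keys l).

Definition r27 := iota 0 27.
Definition r26 := iota 0 26.

Definition mulC_check :=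
  all (fun s => all (fun t => vanishes1 (mulb s t ++ sscale (- 1 : Z)%Z (mulb t s))) r27) r27.

Definition swap_check :=
  all (fun s => all (fun t => vanishes1 (mulb (swap s) (swap t) ++
    sscale (- 1 : Z)%Z [seq (swap x.1, x.2) | x <- mulb s t])) r27) r27.

Definition der_check (F : nat -> seq (nat * Z)) :=
  all (fun s => all (fun t => vanishes1
    (sbind (mulb s) (F t) ++ sbind (mulb^~ t) (F s) ++
     sscale (- 1 : Z)%Z (sbind F (mulb s t)))) r27) r27.

(** Each row of the certificate starts on the diagonal, hence the index [j - i]. *)
Definition cert i j := nth (1, [::]) (nth [::] span_cert i) (j - i).

Definition cert_check :=
  all (fun i => all (fun j => (j < i)%N || ((i == 18) && (j == 18)) ||
    let: (N, l) := cert i j in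
    [&& (N == 1) || (N == 2),
     vanishes2 (sscale (- Z.of_nat N)%Z (kernel_vec i j) ++
       flatten [seq let: (o, i', j', c) := x in
         sscale c (sbind (act_sym (lower o)) (kernel_vec i' j')) | x <- l])
     & all (fun x => let: (o, i', j', c) := x in
         [&& (o < 4), (height i + height j < height i' + height j'), (i' <= j') & (j' < 26)])%N l])
   r26) r26.

Lemma mulC_swap_ok : mulC_check && swap_check.
Proof. by lazy. Qed.
Lemma lower_der_ok : all (fun o => der_check (lower o)) (iota 0 4).
Proof. by lazy. Qed.
Lemma torus_der_ok : all (fun o => der_check (torus o)) (iota 0 4).
Proof. by lazy. Qed.
Lemma cert_check_ok : cert_check.
Proof. by lazy. Qed.

Local Open Scope ring_scope.

Definition coef_at k (l : seq (nat * Z)) : Z :=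
  foldr (fun x acc => if Nat.eqb x.1 k then Z.add x.2 acc else acc) Z0 l.

(** Multiplication by the identity has trace 27, and the table carries a factor 6, which gives 162;
    multiplication by any other basis vector has trace 0. *)
Definition trace_check :=
  all (fun u => Z.eqb (foldr (fun s => Z.add (coef_at s (mulb u s))) Z0 r27)
    (if Nat.eqb u 26 then (162 : Z)%Z else Z0)) r27.


(** Six times id_W. Adding the term of the identity vector gives six times the inverse Gram matrix,
    because [sy (26, 26)] is twice e^T e, that is, 6 . 1/3 times it. *)
Definition idT_table : seq (nat * nat * Z) :=
  [:: (0,3)#6; (1,2)#-6; (4,7)#-6; (5,6)#6; (8,11)#6; (9,10)#-6; (12,15)#-6; (13,14)#6;
   (16,19)#6; (17,18)#-6; (20,23)#-6; (21,22)#6; (24,24)#2; (24,25)#2; (25,25)#2].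

Definition inv_gram_table : seq (nat * nat * Z) := (26,26)#1 :: idT_table.

Definition inv_gram_check :=
  all (fun s => vanishes1 (s#-12 :: sbind (fun p => [:: (p.2, coef_at 26 (mulb s p.1));
     (p.1, coef_at 26 (mulb s p.2))]) inv_gram_table)) r27.

Definition unit_check := all (fun s => vanishes1 (mulb 26 s ++ sscale (- 1 : Z)%Z [:: s#6])) r27.

Lemma trace_gram_unit_ok : [&& trace_check, inv_gram_check & unit_check].
Proof. by lazy. Qed.

(** * Bases in which an algebra has the structure constants of the table *)

Section Basis.
Variables (K : fieldType) (n : nat) (L : 'I_n -> 'M[K]_n) (Q : 'M[K]_n) (e : 'rV[K]_n).
Implicit Types (x y : 'rV[K]_n) (b : nat -> 'rV[K]_n).

Definition basis_mx b : 'M[K]_(27, n) := \matrix_(s < 27) b s.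

(** Indices are natural numbers, with value 0 from 27 on ([sb_out]), so that table entries can be
    used without bounds. In [sb_form], the trace is three times the coordinate along the identity,
    and [mulb] is six times the product; this leaves the factor 2. *)
Record standard_basis b : Prop := StandardBasis {
  sb_out : forall s, (27 <= s)%N -> b s = 0;
  sb_full : row_full (basis_mx b);
  sb_free : row_free (basis_mx b);
  sb_mul : forall s t, 6 *: (b t *m lcomb L (b s)) = realize b (mulb s t);
  sb_unit : b 26 = e;
  sb_form : forall s t, 2 *: (b s *m Q *m (b t)^T) = (ofZ K (coef_at 26 (mulb s t)))%:M
}.

Section Span.
Variable b : nat -> 'rV[K]_n.
Hypothesis bP : standard_basis b.
Hypothesis char6 : (6 : K) != 0.

Lemma sb_expand x : exists z : 'I_27 -> K, x = \sum_(s < 27) z s *: b s.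
Proof.
have /submxP[z ->] : (x <= basis_mx b)%MS by rewrite submx_full // sb_full.
by exists (z 0); rewrite mulmx_sum_row; apply: eq_bigr => s _; rewrite rowK.
Qed.

Lemma sb_ext m (X Y : 'M[K]_(n, m)) :
  (forall s, (s < 27)%N -> b s *m X = b s *m Y) -> X = Y.
Proof.
move=> XY; apply/row_matrixP => i; rewrite !rowE.
have [z ->] := sb_expand (delta_mx 0 i); rewrite !mulmx_suml.
by apply: eq_bigr => s _; rewrite -!scalemxAl XY.
Qed.

Lemma sb_ext2 (V : lmodType K) (f g : 'rV[K]_n -> 'rV[K]_n -> V) :
  (forall y, linear (f^~ y)) -> (forall x, linear (f x)) ->
  (forall y, linear (g^~ y)) -> (forall x, linear (g x)) ->
  (forall s t, (s < 27)%N -> (t < 27)%N -> f (b s) (b t) = g (b s) (b t)) ->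
  forall x y, f x y = g x y.
Proof.
have sumE (phi : 'rV[K]_n -> V) m (z : 'I_m -> K) (u : 'I_m -> 'rV[K]_n) :
    linear phi -> phi (\sum_s z s *: u s) = \sum_s z s *: phi (u s).
  move=> lin; pose h := GRing.isLinear.Build K _ V _ phi lin.
  pose psi : {linear 'rV[K]_n -> V} := HB.pack phi h.
  by rewrite -[phi]/(psi : _ -> _) linear_sum; apply: eq_bigr => s _; rewrite linearZ.
move=> f1 f2 g1 g2 fg x y; have [z ->] := sb_expand x; have [w ->] := sb_expand y.
rewrite (sumE _ _ _ _ (f1 _)) (sumE _ _ _ _ (g1 _)); apply: eq_bigr => s _.
by congr (_ *: _); rewrite !sumE //; apply: eq_bigr => t _; rewrite fg.
Qed.

Lemma checkP (P : nat -> nat -> bool) :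
  all (fun s => all (P s) r27) r27 -> forall s t, (s < 27)%N -> (t < 27)%N -> P s t.
Proof.
move=> /allP h s t s27 t27; have /allP : all (P s) r27 by apply: h; rewrite mem_iota.
by apply; rewrite mem_iota.
Qed.

Lemma scale6_inj (V : lmodType K) (u v : V) : 6 *: u = 6 *: v -> u = v.
Proof. exact: scalerI. Qed.

Lemma vanishes1P l : vanishes1 l -> realize b l = 0.
Proof. exact: (vanishesP eqb_nat_eq). Qed.

Lemma vanishes1_eq l l' : vanishes1 (l ++ sscale (-1) l') -> realize b l = realize b l'.
Proof.
move/vanishes1P => h; apply/eqP; rewrite -subr_eq0 -[X in _ - X]scale1r -scaleNr.
by rewrite -[-1]/(ofZ K (-1)) -realize_scale -realize_cat h.
Qed.

Lemma lcomb_sumZ m (z : 'I_m -> K) (x : 'I_m -> 'rV[K]_n) :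
  lcomb L (\sum_s z s *: x s) = \sum_s z s *: lcomb L (x s).
Proof. by rewrite (linear_sum (lcomb L)); apply: eq_bigr => s _; rewrite linearZ. Qed.

Lemma sb_mulC x y : y *m lcomb L x = x *m lcomb L y.
Proof.
have [z ->] := sb_expand x; have [w ->] := sb_expand y.
rewrite !lcomb_sumZ !mulmx_suml.
under eq_bigr => t _ do rewrite mulmx_sumr.
under [RHS]eq_bigr => t _ do rewrite mulmx_sumr.
rewrite exchange_big; apply: eq_bigr => s _; apply: eq_bigr => t _ /=.
rewrite -!(scalemxAl, scalemxAr) !scalerA mulrC; congr (_ *: _).
apply: scale6_inj; rewrite !(sb_mul bP).
apply/vanishes1_eq; move/andP: mulC_swap_ok => [h _].
exact: (@checkP (fun s t => vanishes1 (mulb s t ++ sscale (- 1) (mulb t s))) h _ _ (ltn_ord s) (ltn_ord t)).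
Qed.

Lemma mulC_of_basis i j : row j (L i) = row i (L j).
Proof. by rewrite -(lcomb_delta L i) -(lcomb_delta L j) !rowE sb_mulC. Qed.

Definition sy (p : nat * nat) : 'M[K]_n :=
  (b p.1)^T *m b p.2 + (b p.2)^T *m b p.1.

Lemma form_sb s t : 2 *: (b s *m Q *m (b t)^T) = (ofZ K (coef_at 26 (mulb s t)))%:M.
Proof. exact: sb_form. Qed.

Let free := sb_free bP.
Hypothesis char2 : (2 : K) != 0.
Hypothesis char3 : (3 : K) != 0.

Lemma gram_inv_table : Q *m realize sy inv_gram_table = 6%:M.
Proof.
apply: sb_ext => s s27; apply: (scalerI char2).
pose phi (X : 'M[K]_n) := 2 *: (b s *m Q) *m X.
pose F (p : nat * nat) :=
  [:: (p.2, coef_at 26 (mulb s p.1)); (p.1, coef_at 26 (mulb s p.2))].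
have phi_lin : linear phi by move=> a X Y; rewrite /phi mulmxDr -scalemxAr.
have phiF p : phi (sy p) = realize b (F p).
  case: p => i j; rewrite /phi /sy /= mulmxDr !mulmxA -!scalemxAl.
  by rewrite ![2 *: (_ *m _^T *m _)]scalemxAl !form_sb !mul_scalar_mx !realize_cons realize_nil addr0.
rewrite mulmxA scalemxAl -/(phi _) (realize_bind _ phi_lin phiF).
have /vanishes1P : vanishes1 (((s, (- (12 : Z))%Z) : nat * Z) :: sbind F inv_gram_table).
  by have /and3P[_ /allP + _] := trace_gram_unit_ok; apply; rewrite mem_iota.
rewrite realize_cons => /eqP; rewrite addrC addr_eq0 => /eqP->.
by rewrite -scaleNr mul_mx_scalar scalerA -natrM; congr (_ *: _); rewrite /= opprK.
Qed.

Lemma gram_unit : Q \in unitmx.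
Proof.
suff: Q *m (6^-1 *: realize sy inv_gram_table) = 1%:M by case/mulmx1_unit.
by rewrite -scalemxAr gram_inv_table scale_scalar_mx mulVf.
Qed.

Let Bi := pinvmx (basis_mx b).

Lemma coef_basis u (s : 'I_27) : (b u *m Bi) 0 s = (u == s)%:R.
Proof.
have [u27|u27] := ltnP u 27; last first.
  rewrite (sb_out bP) // mul0mx mxE; case: eqP => // us.
  by move: (ltn_ord s); rewrite -us ltnNge u27.
have : row (Ordinal u27) (basis_mx b) *m Bi = row (Ordinal u27) (1%:M).
  by rewrite -(mulmxVp free) row_mul.
by rewrite rowK => ->; rewrite !mxE; congr (_%:R); congr nat_of_bool.
Qed.

Lemma coef_realize l (s : 'I_27) : (realize b l *m Bi) 0 s = ofZ K (coef_at s l).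
Proof.
elim: l => [|[k c] l IH]; first by rewrite realize_nil mul0mx mxE.
rewrite realize_cons mulmxDl mxE IH -scalemxAl mxE coef_basis /=.
case: (Nat.eqb_spec k s) => [->|/eqP/negPf ->]; first by rewrite eqxx mulr1 ofZD.
by rewrite mulr0 add0r.
Qed.

Lemma trace_basis u : (u < 27)%N -> \tr (lcomb L (b u)) = 27 * (u == 26)%:R.
Proof.
move=> u27; apply: (mulfI char6).
have Bi1 : Bi *m basis_mx b = 1%:M by apply: mulVpmx; exact: sb_full.
(* Conjugation by the basis matrix turns the trace into the sum of the diagonal coordinates, which
   the table gives. *)
rewrite -[lcomb L _]mulmx1 -Bi1 mulmxA mxtrace_mulC mulmxA /mxtrace mulr_sumr.
transitivity (\sum_(s < 27) ofZ K (coef_at s (mulb u s))).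
  apply: eq_bigr => s _; rewrite -coef_realize -(sb_mul bP) -scalemxAl [RHS]mxE; congr (_ * _).
  have -> : b s = row s (basis_mx b) by rewrite rowK.
  by rewrite -!row_mul [RHS]mxE.
have /and3P[/allP h _ _] := trace_gram_unit_ok; have /h/Z.eqb_eq sumE : u \in r27 by rewrite mem_iota.
transitivity (ofZ K (foldr (fun s => Z.add (coef_at s (mulb u s))) Z0 r27)).
  rewrite -(big_mkord xpredT (fun s => ofZ K (coef_at s (mulb u s)))) /index_iota subn0.
  rewrite /r27; elim: (iota 0 27) => [|s r IH]; first by rewrite big_nil.
  by rewrite big_cons IH ofZD.
rewrite sumE; case: (Nat.eqb_spec u 26) => [->|/eqP/negPf ->]; last by rewrite !mulr0.
by rewrite eqxx mulr1 /ofZ /= -[_%:~R]/(162%:R) (natrM _ 6 27).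
Qed.

(** Multiplication by the identity has trace 27 while the identity matrix has trace 3, and both
    traces vanish on the other basis vectors: hence the 9, and the constant [9^-1] of the axioms. *)
Lemma trace_form x y : 9 *: (x *m Q *m y^T) = (\tr (lcomb L (y *m lcomb L x)))%:M.
Proof.
rewrite -trace_colE; move: x y; apply: sb_ext2.
- by move=> y a x x'; rewrite !mulmxDl -!scalemxAl scalerDr !scalerA mulrC.
- by move=> x a y y'; rewrite linearP mulmxDr -scalemxAr scalerDr !scalerA mulrC.
- by move=> y a x x'; rewrite linearP mulmxDr mulmxDl -scalemxAr -scalemxAl.
- by move=> x a y y'; rewrite !mulmxDl -!scalemxAl.
(* The factor 12 clears the 2 of [sb_form] and the 6 of [sb_mul]. *)
move=> s t _ _; have n12 : (12 : K) != 0 by rewrite (natrM _ 2 6) mulf_neq0.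
apply: (scalerI n12); rewrite scalerA.
have [-> e12] : (12 * 9 = 54 * 2 :> K) /\ (12 = 2 * 6 :> K) by split; ring.
rewrite -scalerA form_sb e12 -scalerA [6 *: _]scalemxAl sb_mul //.
have realE l : realize b l *m trace_col L = (27 * ofZ K (coef_at 26 l))%:M.
  elim: l => [|[k c] l IH]; first by rewrite realize_nil mul0mx mulr0 raddf0.
  rewrite realize_cons mulmxDl IH -scalemxAl trace_colE /=.
  have [k27|k27] := ltnP k 27.
    rewrite trace_basis //; case: (Nat.eqb_spec k 26) => [->|/eqP/negPf ->].
      by rewrite mulr1 ofZD mulrDr [RHS]raddfD /= scale_scalar_mx mulrC.
    by rewrite mulr0 scale_scalar_mx mulr0 raddf0 add0r.
  rewrite (sb_out bP) // linear0 mxtrace0 raddf0 scaler0 add0r.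
  by case: Nat.eqb_spec k27 => // ->.
by rewrite realE !scale_scalar_mx mulrA -natrM.
Qed.

Lemma sb_albert_axioms : albert_axioms L Q (invmx Q) e 9^-1.
Proof.
have Le : lcomb L e = 1%:M.
  apply: sb_ext => s s27; rewrite -(sb_unit bP) mulmx1; apply: scale6_inj.
  rewrite (sb_mul bP) (@vanishes1_eq _ [:: (s, 6 : Z)]).
    by rewrite realize_cons realize_nil addr0.
  by have /and3P[_ _ /allP] := trace_gram_unit_ok; apply; rewrite mem_iota.
have n9 : (9 : K) != 0 by rewrite (natrM _ 3 3) mulf_neq0.
split=> //.
- by move=> i; rewrite -(lcomb_delta L i) sb_mulC Le mulmx1.
- exact: mulC_of_basis.
- move=> i j; have /matrixP/(_ 0 0) := trace_form (delta_mx 0 i) (delta_mx 0 j).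
  rewrite lcomb_delta -!rowE trmx_delta -colE !mxE eqxx mulr1n => <-.
  by rewrite mulrA mulVf // mul1r.
- exact: mulmxV gram_unit.
Qed.

End Span.
End Basis.

(** * Derivations and generation of V' *)

Definition form_check :=
  all (fun s => Z.eqb (coef_at 26 (mulb s 26)) (if Nat.eqb s 26 then (6 : Z)%Z else Z0)
    && all (fun t => Z.eqb (coef_at 26 (mulb (swap s) (swap t))) (coef_at 26 (mulb s t))) r27) r27.

Definition height_check := all (leq^~ 32) height_table.

Lemma form_height_ok : form_check && height_check.
Proof. by lazy. Qed.

Section Model.
Variables (K : fieldType) (n : nat) (L : 'I_n -> 'M[K]_n) (Q : 'M[K]_n) (e : 'rV[K]_n).
Hypothesis char2 : (2 : K) != 0.
Hypothesis char3 : (3 : K) != 0.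
Implicit Types (x y : 'rV[K]_n) (b : nat -> 'rV[K]_n).

Let char6 : (6 : K) != 0.
Proof. by rewrite (natrM _ 2 3) mulf_neq0. Qed.

Local Notation standard_basis := (standard_basis L Q e).

Lemma swapK s : (s < 27)%N -> swap (swap s) = s.
Proof.
move=> s27; apply/eqP; have: all (fun s => swap (swap s) == s) r27 by [].
by move/allP; apply; rewrite mem_iota.
Qed.

Lemma swap_lt s : (s < 27)%N -> (swap s < 27)%N.
Proof.
move=> s27; have: all (fun s => swap s < 27)%N r27 by [].
by move/allP; apply; rewrite mem_iota.
Qed.

Lemma mulb_out s t : ((27 <= s) || (27 <= t))%N -> mulb s t = [::].
Proof.
have sz: all (fun r => size r <= 27)%N mul_table by [].
case/orP => h; rewrite /mulb; first by rewrite (nth_default _ (n := s)) ?nth_nil.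
have [s27|s27] := ltnP s 27; last by rewrite (nth_default _ (n := s)) ?nth_nil.
by rewrite nth_default //; apply: leq_trans h; apply: (allP sz); exact: mem_nth.
Qed.

Lemma realize_comp b (h : nat -> nat) l :
  realize (fun s => b (h s)) l = realize b [seq (h p.1, p.2) | p <- l].
Proof. by rewrite /realize big_map. Qed.

(** Negating all weights is a symmetry of the table. The lowering operators of the swapped basis are
    raising operators for the original one, so every statement about lowering yields its
    counterpart. *)
Lemma swap_basis b : standard_basis b -> standard_basis (fun s => b (swap s)).
Proof.
move=> bP; have swap_out s : (27 <= s)%N -> swap s = s.
  by move=> s27; rewrite /swap ifF // ltnNge (leq_trans _ s27).
have eqm : (basis_mx (fun s => b (swap s)) :=: basis_mx b)%MS.
  apply/eqmxP/andP; split; apply/row_subP => s; rewrite rowK.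
    by have := row_sub (Ordinal (swap_lt (ltn_ord s))) (basis_mx b); rewrite rowK.
  have := row_sub (Ordinal (swap_lt (ltn_ord s))) (basis_mx (fun s => b (swap s))).
  by rewrite rowK /= swapK.
split.
- by move=> s s27; rewrite swap_out // (sb_out bP).
- by rewrite /row_full eqm; exact: sb_full bP.
- by rewrite /row_free eqm; exact: sb_free bP.
- move=> s t; have [st|] := boolP ((s < 27) && (t < 27))%N; last first.
    rewrite negb_and -!leqNgt => out; rewrite mulb_out // realize_nil.
    case/orP: out => h; rewrite (swap_out _ h) (sb_out bP h).
      by rewrite (linear0 (lcomb L)) mulmx0 scaler0.
    by rewrite mul0mx scaler0.
  rewrite (sb_mul bP) (realize_comp b swap); apply: vanishes1_eq.
  have /andP[_ h] := mulC_swap_ok; case/andP: st => s27 t27.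
  exact: (@checkP (fun s t => vanishes1 (mulb (swap s) (swap t) ++
    sscale (- 1 : Z)%Z [seq (swap p.1, p.2) | p <- mulb s t])) h _ _ s27 t27).
- exact: sb_unit bP.
- move=> s t; rewrite (sb_form bP).
  have [st|] := boolP ((s < 27) && (t < 27))%N; last first.
    rewrite negb_and -!leqNgt => out; rewrite !mulb_out //.
    by case/orP: out => h; rewrite (swap_out _ h) h ?orbT.
  case/andP: st => s27 t27; have /andP[/allP h _] := form_height_ok.
  have /h/andP[_ /allP/(_ t)] : s \in r27 by rewrite mem_iota.
  by rewrite mem_iota => /(_ t27)/Z.eqb_eq ->.
Qed.

Variable b : nat -> 'rV[K]_n.
Hypothesis bP : standard_basis b.
Let Bi := pinvmx (basis_mx b).

Lemma pinvmxB : Bi *m basis_mx b = 1%:M.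
Proof. by apply: mulVpmx; exact: sb_full bP. Qed.

Definition table_mx (F : nat -> seq (nat * Z)) : 'M[K]_n :=
  Bi *m \matrix_(s < 27) realize b (F s).

Lemma sb_table_mx F s : (forall s, (27 <= s)%N -> realize b (F s) = 0) ->
  b s *m table_mx F = realize b (F s).
Proof.
move=> Fout; have [s27|s27] := ltnP s 27; last by rewrite (sb_out bP) ?mul0mx ?Fout.
have -> : b s = row (Ordinal s27) (basis_mx b) by rewrite rowK.
by rewrite -row_mul mulmxA (mulmxVp (sb_free bP)) mul1mx rowK.
Qed.

Lemma table_mx_der F : (forall s, (27 <= s)%N -> realize b (F s) = 0) ->
  der_check F -> is_der L (table_mx F).
Proof.
set D := table_mx F => Fout Fder.
pose f x y := y *m D *m lcomb L x + y *m lcomb L (x *m D).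
pose g x y := y *m lcomb L x *m D.
suff fg x y : f x y = g x y.
  move=> i; apply/row_matrixP => j; have := fg (delta_mx 0 i) (delta_mx 0 j).
  by rewrite /f /g lcomb_delta -!rowE linearD /= !row_mul.
move: x y; apply: (sb_ext2 bP).
- move=> y a x x'; rewrite /f mulmxDl -scalemxAl !lcomb_is_linear !mulmxDr -!scalemxAr scalerDr.
  by rewrite addrACA.
- by move=> x a y y'; rewrite /f !mulmxDl -!scalemxAl scalerDr addrACA.
- by move=> y a x x'; rewrite /g lcomb_is_linear mulmxDr -scalemxAr mulmxDl -scalemxAl.
- by move=> x a y y'; rewrite /g !mulmxDl -!scalemxAl.
move=> s t s27 t27; apply: (scale6_inj char6); rewrite /f /g scalerDr.
rewrite sb_table_mx // sb_table_mx // [in RHS]scalemxAl (sb_mul bP).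
have -> : 6 *: (realize b (F t) *m lcomb L (b s)) = realize b (sbind (mulb s) (F t)).
  apply: (realize_bind (phi := fun u => 6 *: (u *m lcomb L (b s)))).
    by move=> a u v; rewrite mulmxDl -scalemxAl scalerDr !scalerA mulrC.
  by move=> k; rewrite (sb_mul bP).
have -> : 6 *: (b t *m lcomb L (realize b (F s))) = realize b (sbind (mulb^~ t) (F s)).
  apply: (realize_bind (phi := fun u => 6 *: (b t *m lcomb L u))).
    by move=> a u v; rewrite lcomb_is_linear mulmxDr -scalemxAr scalerDr !scalerA mulrC.
  by move=> k; rewrite (sb_mul bP).
have -> : realize b (mulb s t) *m D = realize b (sbind F (mulb s t)).
  apply: (realize_bind (phi := fun u => u *m D)); last by move=> k; rewrite sb_table_mx.
  by move=> a u v; rewrite mulmxDl -scalemxAl.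
rewrite -realize_cat; apply: vanishes1_eq; rewrite -catA.
exact: (@checkP (fun s t => vanishes1
    (sbind (mulb s) (F t) ++ sbind (mulb^~ t) (F s) ++
     sscale (- 1 : Z)%Z (sbind F (mulb s t)))) Fder _ _ s27 t27).
Qed.

Local Notation sy := (sy b).

Lemma syC i j : sy (i, j) = sy (j, i).
Proof. by rewrite /sy addrC. Qed.

Lemma vanishes2P l : vanishes2 l -> realize sy l = 0.
Proof.
move=> /(vanishesP eq_pairP sy) <-; rewrite /order_keys /realize big_map.
by apply: eq_bigr => -[[i j] c] _; rewrite /ordered /=; case: ifP => //; rewrite syC.
Qed.

Lemma realize_outer l j (swp : bool) :
  realize sy [seq (if swp then (j, p.1) else (p.1, j), p.2) | p <- l]
  = (realize b l)^T *m b j + (b j)^T *m realize b l.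
Proof.
elim: l => [|[k c] l IH]; first by rewrite !realize_nil trmx0 mul0mx mulmx0 addr0.
rewrite map_cons !realize_cons IH /= [(_ + _)^T]linearD /= [(_ *: _)^T]linearZ /=.
rewrite mulmxDl mulmxDr -scalemxAl -scalemxAr.
by rewrite addrACA -scalerDr; congr (_ *: _ + _); case: swp {IH} => //; rewrite syC.
Qed.

Lemma dact_realize F l : (forall s, (27 <= s)%N -> realize b (F s) = 0) ->
  dact (table_mx F) (realize sy l) = realize sy (sbind (act_sym F) l).
Proof.
move=> Fout; apply: realize_bind => [a X Y|[i j]].
  by rewrite /dact mulmxDr mulmxDl -scalemxAr -scalemxAl scalerDr addrACA.
rewrite realize_cat (realize_outer _ _ false) (realize_outer _ _ true) /=.
rewrite /dact mulmxDr mulmxDl !(mulmxA (table_mx F)^T) -!trmx_mul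
  -!(mulmxA _ _ (table_mx F)) !sb_table_mx //.
by rewrite [X in _ + X]addrC addrACA.
Qed.

End Model.

Section Generation.
Variables (K : fieldType) (n : nat) (L : 'I_n -> 'M[K]_n) (Q Q' : 'M[K]_n) (e : 'rV[K]_n).
Variable c : K.
Hypothesis char2 : (2 : K) != 0.
Hypothesis char3 : (3 : K) != 0.
Hypothesis alb : albert_axioms L Q Q' e c.

Let char6 : (6 : K) != 0.
Proof. by rewrite (natrM _ 2 3) mulf_neq0. Qed.

Local Notation standard_basis := (standard_basis L Q e).
Local Notation P := (traceless_proj Q e 3^-1).
Local Notation inV A := (constraints L Q e A = 0).

Section Lowering.
Variable b : nat -> 'rV[K]_n.
Hypothesis bP : standard_basis b.
Local Notation sy := (sy b).
Let Bi := pinvmx (basis_mx b).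

Lemma lower_out o s : (27 <= s)%N -> realize b (lower o s) = 0.
Proof.
move=> s27; have sz: all (fun r => size r <= 27)%N lower_table by [].
rewrite /lower nth_default ?realize_nil //; apply: leq_trans s27.
have [o4|o4] := ltnP o (size lower_table); last by rewrite nth_default.
by apply: (allP sz); exact: mem_nth.
Qed.

Lemma torus_out k s : (27 <= s)%N -> realize b (torus k s) = 0.
Proof. by move=> s27; rewrite realize_cons realize_nil addr0 (sb_out bP) ?scaler0. Qed.

Lemma lower_der o : (o < 4)%N -> is_der L (table_mx b (lower o)).
Proof.
move=> o4; apply: (table_mx_der char2 char3 bP (@lower_out o)).
by apply: (allP lower_der_ok); rewrite mem_iota.
Qed.

Lemma torus_der k : (k < 4)%N -> is_der L (table_mx b (torus k)).
Proof.
move=> k4; apply: (table_mx_der char2 char3 bP (@torus_out k)).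
by apply: (allP torus_der_ok); rewrite mem_iota.
Qed.

Lemma unit_proj : e *m P = 0.
Proof.
have eQe : 2 *: (e *m Q *m e^T) = 6%:M by rewrite -(sb_unit bP) (sb_form bP).
have -> : e *m P = e - 6^-1 *: (2 *: (e *m Q *m e^T)) *m e.
  rewrite /traceless_proj mulmxBr mulmx1 -scalemxAr !mulmxA scalerA scalemxAl.
  by congr (_ - _ *: _ *m _); field; rewrite char3 char6.
by rewrite eQe scale_scalar_mx mulVf // mul1mx subrr.
Qed.

Lemma sb_orth s : (s < 26)%N -> b s *m (Q *m e^T) = 0.
Proof.
move=> s26; apply: (scalerI char2); rewrite mulmxA -(sb_unit bP) (sb_form bP) scaler0.
have /andP[/allP h _] := form_height_ok; have /h/andP[/Z.eqb_eq -> _] : s \in r27.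
  by rewrite mem_iota /= add0n (ltn_trans s26).
case: Nat.eqb_spec s26 => [->|_ _] //; exact: raddf0.
Qed.

Lemma sb_proj s : (s < 26)%N -> b s *m P = b s.
Proof.
move=> s26; rewrite /traceless_proj mulmxBr mulmx1 -scalemxAr (mulmxA (b s)) sb_orth //.
by rewrite mul0mx scaler0 subr0.
Qed.

Lemma inV_proj A : A^T = A -> A *m (Q *m e^T) = 0 -> P^T *m A *m P = A.
Proof.
move=> sA wA; have AP : A *m P = A.
  by rewrite /traceless_proj mulmxBr mulmx1 -scalemxAr (mulmxA A) wA mul0mx scaler0 subr0.
by rewrite -mulmxA AP -{1}sA -trmx_mul AP.
Qed.

Definition section_lin (x : 'rV[K]_n) : 'M[K]_n :=
  \sum_(s < 27) (x *m Bi) 0 s *: realize sy (section s).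

Lemma section_lin_linear : linear section_lin.
Proof.
move=> a x y; rewrite /section_lin scaler_sumr -big_split; apply: eq_bigr => s _.
by rewrite mulmxDl -scalemxAl !mxE scalerDl scalerA.
Qed.

Lemma kernel_vecE i j :
  realize sy (kernel_vec i j) = 6 *: sy (i, j) - section_lin (6 *: (b j *m lcomb L (b i))).
Proof.
rewrite realize_cons realize_scale scaleN1r; congr (_ - _); rewrite (sb_mul bP).
rewrite (realize_bind _ section_lin_linear (F := section) (B' := sy)) // => k.
rewrite /section_lin; have [k27|k27] := ltnP k 27.
  rewrite (bigD1 (Ordinal k27)) //= big1 => [|s ne]; rewrite (coef_basis bP) /=.
    by rewrite eqxx scale1r addr0.
  rewrite [k == s]eq_sym (_ : (_ == _) = false) ?scale0r //.
  by apply: contraNF ne => /eqP sk; apply/eqP/val_inj.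
rewrite (sb_out bP) // big1 => [|s _]; last by rewrite mul0mx mxE scale0r.
rewrite /section nth_default ?realize_nil //.
Qed.

Section Closed.
Variable U : 'M[K]_n -> Prop.
Hypothesis U0 : U 0.
Hypothesis Ulin : forall a A B, U A -> U B -> U (a *: A + B).
Hypothesis Ulower : forall o A, (o < 4)%N -> U A -> U (dact (table_mx b (lower o)) A).
Hypothesis Utop : U (sy (18, 18)).

Lemma U_scale a A : U A -> U (a *: A).
Proof. by move=> UA; rewrite -[_ *: _]addr0; apply: Ulin. Qed.

Lemma height_le s : (height s <= 32)%N.
Proof.
have /andP[_ h] := form_height_ok; rewrite /height.
have [s27|s27] := ltnP s (size height_table); last by rewrite nth_default.
by apply: (allP h); exact: mem_nth.
Qed.

Lemma U_kernel_vec i j : (i <= j < 26)%N -> U (realize sy (kernel_vec i j)).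
Proof.
(* Heights are at most 32, so 64 bounds the sum of two of them. The certificate expresses a vector
   by vectors of greater total height, and this measure decreases. *)
have [m] := ubnP (64 - (height i + height j)); elim: m i j => // m IH i j hm /andP[ij j26].
have /allP/(_ i) := cert_check_ok; rewrite mem_iota add0n => /(_ (leq_ltn_trans ij j26)).
move=> /allP/(_ j); rewrite mem_iota add0n j26 => /(_ isT); rewrite ltnNge ij [~~ true]/= orFb.
case/orP => [/andP[/eqP-> /eqP->]|].
  by rewrite realize_cons realize_nil addr0; apply: U_scale.
case: (cert i j) => N l /and3P[N12 van src].
have N0 : ofZ K (Z.of_nat N) != 0 by case/orP: N12 => /eqP -> //; exact: oner_neq0.
have := vanishes2P b van; rewrite realize_cat realize_scale.
have -> : ofZ K (- Z.of_nat N) = - ofZ K (Z.of_nat N) by rewrite /ofZ (rmorphN int_of_Z) rmorphN.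
rewrite scaleNr => /eqP; rewrite addrC subr_eq0 => /eqP e1.
rewrite -[realize _ _]scale1r -(mulVf N0) -scalerA -e1; apply: U_scale => {e1 N0 N12 van}.
elim: l src => [|[[[o i'] j'] a] l IHl] /=; first by rewrite realize_nil.
case/andP => /and4P[o4 hh ij' j26'] /IHl Ul.
rewrite realize_cat realize_scale; apply: Ulin => //.
rewrite -(dact_realize bP) //; last exact: lower_out.
apply: Ulower => //; apply: IH; last by rewrite ij'.
by have := height_le i'; have := height_le j'; lia.
Qed.

(** Written in the traceless parts [pb i] of the basis vectors, 12 A becomes a combination of the
    elements [W i j], which are the certified vectors [kernel_vec]: the corrections by [section_lin]
    add up to the section of the contraction of A, which is 0. The 12 is 6 times the 2 of
    symmetrization. *)
Lemma sb_generate A : inV A -> U A.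
Proof.
move=> /constraintsP[sA wA tA].
pose z := Bi^T *m A *m Bi; pose pb s := b s *m P.
pose W i j := 6 *: ((pb i)^T *m pb j + (pb j)^T *m pb i) - section_lin (6 *: (pb j *m lcomb L (pb i))).
have AE : A = \sum_(i < 27) \sum_(j < 27) z i j *: ((pb i)^T *m pb j).
  have rowPB (i : 'I_27) : pb i = row i (basis_mx b *m P) by rewrite row_mul rowK.
  under eq_bigr => i _ do under eq_bigr => j _ do rewrite !rowPB.
  rewrite -mulmx_quadratic.
  have -> : (basis_mx b *m P)^T *m z *m (basis_mx b *m P)
      = P^T *m ((Bi *m basis_mx b)^T *m A *m (Bi *m basis_mx b)) *m P.
    by rewrite /z !trmx_mul !mulmxA.
  by rewrite (pinvmxB bP) trmx1 mul1mx mulmx1 inV_proj.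
have zT : z^T = z by rewrite /z trmx_mul [(_ *m A)^T]trmx_mul trmxK sA mulmxA.
clearbody z; have zC i j : z i j = z j i by rewrite -[in LHS]zT mxE.
have WE : 12 *: A = \sum_(i < 27) \sum_(j < 27) z i j *: W i j.
  have e1 : \sum_(i < 27) \sum_(j < 27) z i j *: ((pb j)^T *m pb i) = A.
    rewrite AE exchange_big; apply: eq_bigr => i _; apply: eq_bigr => j _.
    by rewrite zC.
  (* The corrections depend linearly on the tensor, so their total depends only on the contraction
     of A. *)
  have e2 : \sum_(i < 27) \sum_(j < 27) z i j *: section_lin (6 *: (pb j *m lcomb L (pb i))) = 0.
    pose phi (X : 'M[K]_n) := section_lin (6 *: contract L X).
    have phi_lin : linear phi.
      move=> a X Y; rewrite /phi contract_is_linear scalerDr scalerA mulrC -scalerA.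
      exact: section_lin_linear.
    pose psi : {linear 'M[K]_n -> 'M[K]_n} := HB.pack phi (GRing.isLinear.Build K _ _ _ phi phi_lin).
    transitivity (psi A); last first.
      by rewrite /= /phi tA scaler0 /section_lin big1 // => s _; rewrite mul0mx mxE scale0r.
    rewrite AE linear_sum; apply: eq_bigr => i _; rewrite linear_sum; apply: eq_bigr => j _.
    by rewrite linearZ /= /phi contract_outer.
  transitivity (6 *: (\sum_(i < 27) \sum_(j < 27) z i j *: ((pb i)^T *m pb j)
      + \sum_(i < 27) \sum_(j < 27) z i j *: ((pb j)^T *m pb i)) - 0).
    by rewrite -AE e1 subr0 -mulr2n -scaler_nat scalerA -natrM.
  rewrite -[X in _ - X]e2 -big_split scaler_sumr -sumrB; apply: eq_bigr => i _.
  rewrite -big_split scaler_sumr -sumrB; apply: eq_bigr => j _.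
  by rewrite /W /= scalerBr -scalerDr [in LHS]scalerA [in RHS]scalerA mulrC.
have n12 : (12 : K) != 0 by rewrite (natrM _ 2 6) mulf_neq0.
rewrite -[A]scale1r -(mulVf n12) -scalerA; apply: U_scale; rewrite WE.
have Usum (F : 'I_27 -> 'M[K]_n) : (forall i, U (F i)) -> U (\sum_i F i).
  move=> UF; elim/big_rec: _ => // i X _ UX; rewrite -[F i]scale1r; exact: Ulin.
apply: (Usum (fun i => _)) => i; apply: (Usum (fun j => _)) => j; apply: U_scale.
(* The identity has no traceless part, so only indices below 26, those covered by the certificate,
   contribute. *)
have pb26 : pb 26 = 0 by rewrite /pb (sb_unit bP) unit_proj.
have S0 : section_lin 0 = 0.
  by rewrite /section_lin big1 // => s _; rewrite mul0mx mxE scale0r.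
have W0 k l : (k == 26) || (l == 26) -> W k l = 0.
  rewrite /W => /orP[]/eqP->; rewrite pb26 trmx0 !mul0mx !mulmx0 addr0 scaler0.
    by rewrite (linear0 (lcomb L)) mulmx0 scaler0 S0 subrr.
  by rewrite scaler0 S0 subrr.
have WC k l : W k l = W l k.
  by rewrite /W [X in _ *: X - _]addrC (sb_mulC bP).
have main k l : (k <= l < 27)%N -> U (W k l).
  move=> /andP[kl l27]; have [l26|l26] := ltnP l 26; last first.
    by rewrite W0 // (_ : l = 26) ?orbT //; lia.
  have k26 := leq_ltn_trans kl l26.
  by rewrite /W /pb !sb_proj // -kernel_vecE; apply: U_kernel_vec; rewrite kl.
by case: (leqP i j) => ij; [|rewrite WC]; apply: main; rewrite ?ij ?(ltnW ij) ltn_ord.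
Qed.

End Closed.
End Lowering.
End Generation.

(** * Equivariant maps on V' over the algebraic closure *)

Section Uniqueness.
Variables (K : fieldType) (n : nat) (L : 'I_n -> 'M[K]_n) (Q Q' : 'M[K]_n) (e : 'rV[K]_n).
Variable c : K.
Hypothesis char2 : (2 : K) != 0.
Hypothesis char3 : (3 : K) != 0.
Hypothesis alb : albert_axioms L Q Q' e c.
Variable b : nat -> 'rV[K]_n.
Hypothesis bP : standard_basis L Q e b.

Let char6 : (6 : K) != 0.
Proof. by rewrite (natrM _ 2 3) mulf_neq0. Qed.

Local Notation inV A := (constraints L Q e A = 0).
Local Notation sy := (sy b).
Local Notation lowering o := (table_mx b (lower o)).

Lemma contract_sy i j : 3 *: contract L (sy (i, j)) = realize b (mulb i j).
Proof.
rewrite /sy linearD /= !contract_outer (sb_mulC bP char6 (b j)) -mulr2n -scaler_nat.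
by rewrite scalerA -natrM (sb_mul bP).
Qed.

Lemma sy_inV i j : (i < 26)%N -> (j < 26)%N -> mulb i j = [::] -> inV (sy (i, j)).
Proof.
move=> i26 j26 ij0; apply/constraintsP; split.
- by rewrite /sy linearD /= !trmx_mul !trmxK addrC.
- by rewrite /sy mulmxDl -!mulmxA !(sb_orth char2 bP) // !mulmx0 addr0.
- by apply: (scalerI char3); rewrite contract_sy ij0 realize_nil scaler0.
Qed.

Lemma lowering_sy17 o : (o < 4)%N -> dact (lowering o) (sy (17, 17)) = 0.
Proof.
move=> o4; have -> : sy (17, 17) = realize sy [:: ((17, 17), 1 : Z)]%N.
  by rewrite realize_cons realize_nil addr0 scale1r.
rewrite (dact_realize bP); last exact: lower_out.
by case: o o4 => [|[|[|[|]]]] // _; rewrite realize_nil.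
Qed.

Lemma inV0 : inV (0 : 'M[K]_n).
Proof. by rewrite linear0. Qed.

Lemma inVP a A B : inV A -> inV B -> inV (a *: A + B).
Proof. by move=> Ai Bi; rewrite linearP /= Ai Bi scaler0 addr0. Qed.

Section ZeroCriterion.
Variables (W : lmodType K) (act : 'M[K]_n -> W -> W) (Phi : 'M[K]_n -> 'M[K]_n -> W).
Hypothesis act0 : forall D, act D 0 = 0.
Hypothesis Phi_l : forall a A A' B, inV A -> inV A' -> inV B ->
  Phi (a *: A + A') B = a *: Phi A B + Phi A' B.
Hypothesis Phi_r : forall a A B B', inV A -> inV B -> inV B' ->
  Phi A (a *: B + B') = a *: Phi A B + Phi A B'.
Hypothesis Phi_der : forall D A B, is_der L D -> inV A -> inV B ->
  Phi (dact D A) B + Phi A (dact D B) = act D (Phi A B).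
Hypothesis Phi_top : Phi (sy (18, 18)) (sy (17, 17)) = 0.

(* Moving the lowering operators across Phi shows that Phi(V', w^2) = 0, and then, with the
   raising operators obtained by swapping v and w, that Phi(V', V') = 0. *)
Lemma zero_criterion A B : inV A -> inV B -> Phi A B = 0.
Proof.
have Phi0l X : inV X -> Phi 0 X = 0.
  by move=> VX; rewrite -[0](addNr 0) -scaleN1r Phi_l ?inV0 // scaleN1r addNr.
have Phi0r X : inV X -> Phi X 0 = 0.
  by move=> VX; rewrite -[0](addNr 0) -scaleN1r Phi_r ?inV0 // scaleN1r addNr.
have V17 : inV (sy (17, 17)) by apply: sy_inV.
have V18 : inV (sy (18, 18)) by apply: sy_inV.
have low X : inV X -> Phi X (sy (17, 17)) = 0.
  (* Membership in V' is carried along in the predicate because the Leibniz rule is available only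
     on V'. *)
  move=> VX; suff [] : inV X /\ Phi X (sy (17, 17)) = 0 by [].
  move: X VX; apply: (@sb_generate _ _ _ _ _ char2 char3 _ bP
    (fun X => inV X /\ Phi X (sy (17, 17)) = 0)) => [|a X Y [VX X0] [VY Y0]|o X o4 [VX X0]|].
  - by split; [exact: inV0|exact: Phi0l].
  - by split; [exact: inVP|rewrite Phi_l // X0 Y0 scaler0 addr0].
  - have dD := lower_der char2 char3 bP o4; split; first exact: (der_constraints alb dD).
    by have := Phi_der dD VX V17; rewrite X0 act0 lowering_sy17 // Phi0r // addr0.
  - by split.
move=> VA VB; suff [_ ->] : inV B /\ forall A, inV A -> Phi A B = 0 by [].
move: B VB {A VA}; refine (@sb_generate _ _ _ _ _ char2 char3 _ (swap_basis bP)
    (fun X => inV X /\ forall A, inV A -> Phi A X = 0) _ _ _ _) => [|a X Y [VX X0] [VY Y0]|o X o4 [VX X0]|].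
- by split; [exact: inV0|move=> A; exact: Phi0r].
- by split; [exact: inVP|move=> A VA; rewrite Phi_r // X0 // Y0 // scaler0 addr0].
- have dD := lower_der char2 char3 (swap_basis bP) o4.
  split; first exact: (der_constraints alb dD).
  move=> A VA; have := Phi_der dD VA VX; rewrite !X0 ?act0 ?add0r //.
  exact: (der_constraints alb dD).
- by split.
Qed.

End ZeroCriterion.
End Uniqueness.

(** * Elements of V' of weight 0 killed by the lowering operators that kill v^2 *)

Definition column (F : nat -> seq (nat * Z)) (j : nat) : seq (nat * Z) :=
  [seq x <- [seq (u, coef_at j (F u)) | u <- r27] | ~~ Z.eqb x.2 Z0].

Definition contract_rel (k : nat) : seq (nat * nat * Z) :=
  [seq x <- [seq ((i, j), coef_at k (mulb i j)) | i <- r26, j <- r26] | ~~ Z.eqb x.2 Z0].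

(** The code [o] is a lowering operator if below 3, a single coordinate if 3, and otherwise
    coordinate [i] of the contraction, with [j] a dummy. Operators act on coordinates by their
    transposed table, hence [column]. *)
Definition invariant_rel (o i j : nat) : seq (nat * nat * Z) :=
  if (o < 3)%N then act_sym (column (lower o)) (i, j)
  else if Nat.eqb o 3 then [:: (i, j)#1] else contract_rel i.

(* An invariant A is pinned down by the coordinates (0, 3) and (16, 19): an entry (i, j, N, l)
   writes N times its coordinate (i, j) as a combination of the relations [invariant_rel],
   which are the vanishing of the lowering operators 0, 1, 2 (the simple roots that kill 18),
   of these two coordinates, and of the contraction of A. *)
Definition invariant_cert : seq (nat * nat * nat * seq (nat * nat * nat * Z)) :=
  [:: (0,3,1,[:: (3,0,3)#1]); (16,19,1,[:: (3,16,19)#1]);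
   (1,2,1,[::(3,0,3)#-1; (1,1,3)#1]);
   (4,7,1,[::(3,0,3)#-1; (0,2,7)#1; (1,1,3)#1]);
   (5,6,1,[::(3,0,3)#1; (0,11,14)#1; (1,1,3)#-1; (1,8,9)#1; (2,2,13)#1; (2,5,10)#1]);
   (8,11,1,[::(3,0,3)#1; (0,11,14)#1; (1,1,3)#-1; (2,2,13)#1]);
   (9,10,1,[::(3,0,3)#-1; (0,11,14)#-1; (1,1,3)#1; (1,8,9)#-1; (2,2,13)#-1]);
   (12,15,1,[::(3,0,3)#-1; (2,0,12)#-1]);
   (13,14,1,[::(3,0,3)#1; (1,1,3)#-1; (2,2,13)#1]);
   (17,18,24,[::(3,0,3)#48; (3,16,19)#84; (2,0,12)#12; (4,26,0)#-3; (1,8,9)#12; (0,11,14)#24;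
     (0,16,22)#60; (2,20,25)#12; (2,2,13)#36; (4,24,0)#-2; (4,25,0)#4; (1,1,3)#-36;
     (1,21,23)#-36]);
   (20,23,1,[::(3,16,19)#-1; (0,16,22)#-1; (1,21,23)#1]);
   (21,22,1,[::(3,16,19)#1; (0,16,22)#1]);
   (24,24,24,[::(3,0,3)#-48; (3,16,19)#12; (4,25,0)#2; (1,1,3)#36; (4,26,0)#1; (2,5,10)#-12;
     (2,4,11)#-12; (0,16,22)#12; (1,8,9)#-12; (2,20,24)#12; (1,21,23)#-12; (0,2,7)#24]);
   (24,25,24,[::(3,0,3)#48; (3,16,19)#12; (0,11,14)#24; (0,16,22)#12; (1,1,3)#-36; (1,8,9)#12;
     (1,21,23)#-12; (2,0,12)#12; (2,2,13)#36; (2,20,25)#12; (4,24,0)#2; (4,26,0)#-1]);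
   (25,25,24,[::(3,0,3)#-48; (3,16,19)#12; (0,11,14)#-24; (0,16,22)#12; (1,1,3)#36;
     (1,8,9)#-12; (1,21,23)#-12; (2,0,12)#-12; (2,2,13)#-36; (2,20,25)#12; (4,24,0)#-2;
     (4,26,0)#1])].

Definition pivot o i j := [|| (o < 3)%N, ((o == 3) && ((i, j) \in [:: (0, 3); (16, 19)]))%N
  | (o == 4)%N].

(** A coordinate is settled either by a nonzero weight, of absolute value at most 4, or by a
    certificate with multiplier 1 or 24. All these integers are invertible once 2 and 3 are. *)
Definition invariant_check :=
  all (fun i => all (fun j => [|| (j < i)%N,
     has (fun k => Z.abs_nat (weight k i + weight k j) \in [:: 1; 2; 3; 4]%N) (iota 0 4)
   | has (fun x => let: (i', j', N, l) := x in
       [&& Nat.eqb i i', Nat.eqb j j', (N \in [:: 1; 24])%N,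
         all (fun y => let: (o, i'', j'', _) := y in
              [&& (i'' < 27), (j'' < 27) & pivot o i'' j'']%N) l
       & vanishes eq_pair (order_keys ((i, j, (- Z.of_nat N)%Z) ::
         flatten [seq let: (o, i'', j'', c) := y in
           sscale c (invariant_rel o i'' j'') | y <- l]))]) invariant_cert]) r26) r26.

Lemma invariant_check_ok : invariant_check.
Proof. by lazy. Qed.

Section Invariants.
Variables (K : fieldType) (n : nat) (L : 'I_n -> 'M[K]_n) (Q Q' : 'M[K]_n) (e : 'rV[K]_n).
Variable c : K.
Hypothesis char2 : (2 : K) != 0.
Hypothesis char3 : (3 : K) != 0.
Hypothesis alb : albert_axioms L Q Q' e c.
Variable b : nat -> 'rV[K]_n.
Hypothesis bP : standard_basis L Q e b.

Let char6 : (6 : K) != 0.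
Proof. by rewrite (natrM _ 2 3) mulf_neq0. Qed.

Local Notation inV A := (constraints L Q e A = 0).
Local Notation sy := (sy b).
Local Notation Bi := (pinvmx (basis_mx b)).

(** The functional reading off coordinate i in the basis b; [inord] sends larger indices to 0,
    whence the bounds [< 27] below. *)
Definition dualv (i : nat) : 'cV[K]_n := col (inord i) Bi.

(** The values lie in [K^o], the field as a module over itself, so that [realize] applies to
    relations between coordinates. *)
Definition zc (A : 'M[K]_n) (p : nat * nat) : K^o :=
  ((dualv p.1)^T *m A *m dualv p.2) 0 0.

Lemma mulmx_col m p q (A : 'M[K]_(m, p)) (B : 'M[K]_(p, q)) j :
  A *m col j B = col j (A *m B).
Proof. by rewrite !colE mulmxA. Qed.

Lemma dualvE s j : (j < 27)%N -> b s *m dualv j = (s == j)%:R%:M.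
Proof.
move=> j27; rewrite /dualv mulmx_col; apply/matrixP => i k; rewrite !ord1 mxE.
by rewrite (coef_basis bP) inordK // !mxE eqxx mulr1n.
Qed.

Lemma dualv_realize l j : (j < 27)%N -> realize b l *m dualv j = (ofZ K (coef_at j l))%:M.
Proof.
move=> j27; rewrite /dualv mulmx_col; apply/matrixP => i k; rewrite !ord1 mxE.
by rewrite (coef_realize bP) inordK // !mxE eqxx mulr1n.
Qed.

Lemma realize_filter (V : lmodType K) (T : Type) (B : T -> V) (l : seq (T * Z)) :
  realize B [seq x <- l | ~~ Z.eqb x.2 Z0] = realize B l.
Proof.
elim: l => [|[k a] l IH] //=; case: Z.eqb_spec => [->|_] /=; rewrite !realize_cons IH //.
by rewrite /ofZ /= scale0r add0r.
Qed.

Lemma table_mx_dualv F j : (j < 27)%N ->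
  table_mx b F *m dualv j = realize dualv (column F j).
Proof.
move=> j27; rewrite realize_filter /table_mx -mulmxA.
have -> : (\matrix_(s < 27) realize b (F s)) *m dualv j
    = \col_(s < 27) ofZ K (coef_at j (F s)).
  apply/row_matrixP => s; rewrite row_mul rowK dualv_realize //.
  by apply/rowP => k; rewrite !ord1 !mxE eqxx mulr1n.
have -> : realize dualv [seq (u, coef_at j (F u)) | u <- r27]
    = \sum_(u < 27) ofZ K (coef_at j (F u)) *: dualv u.
  by rewrite /realize big_map -(big_mkord xpredT (fun u => ofZ K (coef_at j (F u)) *: dualv u)).
apply/colP => k; rewrite mxE summxE; apply: eq_bigr => u _.
by rewrite !mxE inord_val mulrC.
Qed.

Lemma zcP a A B p : zc (a *: A + B) p = a *: zc A p + zc B p.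
Proof. by rewrite /zc mulmxDr mulmxDl -scalemxAr -scalemxAl !mxE. Qed.

Lemma zcZ a A p : zc (a *: A) p = a *: zc A p.
Proof. by rewrite /zc -scalemxAr -scalemxAl mxE. Qed.

Lemma zc_dact F A i j : (i < 27)%N -> (j < 27)%N ->
  zc (dact (table_mx b F) A) (i, j) = realize (zc A) (act_sym (column F) (i, j)).
Proof.
move=> i27 j27; rewrite /zc /dact /= mulmxDr mulmxDl (mulmxA _ _ A) -trmx_mul.
rewrite table_mx_dualv // -(mulmxA _ (A *m _)) -(mulmxA A) table_mx_dualv // (mulmxA _ A).
rewrite mxE realize_cat; congr (_ + _).
  elim: (column F i) => [|[k a] l IH] /=; first by rewrite !realize_nil trmx0 !mul0mx mxE.
  rewrite !realize_cons -IH [(_ + _)^T]linearD /= [(_ *: _)^T]linearZ /= !mulmxDl.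
  by rewrite -!scalemxAl mxE [X in X + _]mxE.
elim: (column F j) => [|[k a] l IH] /=; first by rewrite !realize_nil mulmx0 mxE.
by rewrite !realize_cons -IH mulmxDr -scalemxAr mxE [X in X + _]mxE.
Qed.

Lemma zc_torus k A i j : (i < 27)%N -> (j < 27)%N ->
  zc (dact (table_mx b (torus k)) A) (i, j) = ofZ K (weight k i + weight k j) * zc A (i, j).
Proof.
have dv m : (m < 27)%N -> table_mx b (torus k) *m dualv m = ofZ K (weight k m) *: dualv m.
  move=> m27; apply: (sb_ext bP) => s s27; rewrite mulmxA (sb_table_mx bP); last first.
    exact: torus_out bP k.
  rewrite realize_cons realize_nil addr0 -scalemxAl -scalemxAr dualvE //=.
  by case: eqP => [->|_] //; rewrite raddf0 !scaler0.
move=> i27 j27; rewrite /zc /dact /= mulmxDr mulmxDl (mulmxA _ _ A) -trmx_mul.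
rewrite dv // -(mulmxA _ (A *m _)) -(mulmxA A) dv //.
rewrite [(_ *: _)^T]linearZ /= -!(scalemxAl, scalemxAr) (mulmxA _ A) ofZD mulrDl mxE.
by congr (_ + _); rewrite mxE.
Qed.

Lemma ofZ_eq0 w : (ofZ K w == 0) = ((Z.abs_nat w)%:R == 0 :> K).
Proof.
case: w => [|p|p] //; rewrite /ofZ /= NegzE rmorphN oppr_eq0 prednK //.
by apply/ltP; exact: Pos2Nat.is_pos.
Qed.

Lemma zcC A p : A^T = A -> zc A p = zc A (p.2, p.1).
Proof.
move=> sA; rewrite /zc /= -[LHS]/((fun M : 'M[K]_1 => M 0 0) _) -[_ *m dualv p.2]trmxK mxE.
by rewrite trmx_mul trmx_mul trmxK sA mulmxA.
Qed.

Lemma dualv26_proj : traceless_proj Q e 3^-1 *m dualv 26 = 0.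
Proof.
apply: (sb_ext bP) => s s27; rewrite mulmxA mulmx0.
have [s26|s26] := ltnP s 26.
  by rewrite (sb_proj char2 bP) // dualvE // (ltn_eqF s26) raddf0.
have -> : s = 26 by lia.
by rewrite (sb_unit bP) (unit_proj char2 char3 bP) mul0mx.
Qed.

Lemma zc26 A i : inV A -> zc A (i, 26) = 0.
Proof.
move=> /constraintsP[sA wA _]; rewrite /zc -(inV_proj sA wA) /= -!mulmxA dualv26_proj.
by rewrite !mulmx0 mxE.
Qed.

Lemma zc0 A : (forall i j, (i < 27)%N -> (j < 27)%N -> zc A (i, j) = 0) -> A = 0.
Proof.
move=> z0; have z : Bi^T *m A *m Bi = 0.
  apply/matrixP => i j; rewrite [RHS]mxE -(z0 i j) // /zc /dualv !inord_val.
  rewrite -[RHS]/(_ 0 0) -mulmxA mulmx_col tr_col -row_mul mulmxA.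
  by rewrite !mxE; apply: eq_bigr => k _; rewrite !mxE.
have h := pinvmxB bP.
rewrite -[A]mulmx1 -h -[A]mul1mx -{1}trmx1 -h trmx_mul -(mulmxA _ _ A).
by rewrite -mulmxA (mulmxA _ Bi) z mul0mx mulmx0.
Qed.

Lemma zc_expand A : A = \sum_(i < 27) \sum_(j < 27) zc A (val i, val j) *: ((b i)^T *m b j).
Proof.
have h := pinvmxB bP.
have {1}-> : A = (basis_mx b)^T *m (Bi^T *m A *m Bi) *m basis_mx b.
  have -> : (basis_mx b)^T *m (Bi^T *m A *m Bi) *m basis_mx b
      = (Bi *m basis_mx b)^T *m A *m (Bi *m basis_mx b).
    by rewrite [(Bi *m _)^T]trmx_mul !mulmxA.
  by rewrite h trmx1 mul1mx mulmx1.
rewrite mulmx_quadratic; apply: eq_bigr => i _; apply: eq_bigr => j _.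
rewrite !rowK; congr (_ *: _); rewrite /zc /dualv !inord_val /=.
by rewrite mulmx_col tr_col -!row_mul [RHS]mxE [RHS]mxE.
Qed.

Lemma zc_contract A k : inV A -> (k < 27)%N -> realize (zc A) (contract_rel k) = 0.
Proof.
move=> VA k27; have [sA _ tA] := (constraintsP _ _ _ _).1 VA.
rewrite realize_filter /realize big_allpairs_dep.
pose F i j := ofZ K (coef_at k (mulb i j)) *: (zc A (i, j) : K^o).
(* Elements of V' have no coordinate along the identity, so index 26 may be added to both sums. *)
have e26 : \sum_(i <- r26) \sum_(j <- r26) F i j = \sum_(i < 27) \sum_(j < 27) F i j.
  have z26 i : zc A (26, i) = 0 by rewrite zcC //= zc26.
  rewrite -(big_mkord xpredT (fun i => \sum_(j < 27) F i j)) big_nat_recr //=.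
  rewrite [X in _ + X]big1 ?addr0 => [|j _]; last by rewrite /F z26 scaler0.
  apply: eq_bigr => i _; rewrite -(big_mkord xpredT (F i)) big_nat_recr //=.
  by rewrite {3}/F zc26 // scaler0 addr0.
transitivity (\sum_(i <- r26) \sum_(j <- r26) F i j); first by [].
rewrite e26; transitivity (((6 *: contract L A) *m dualv k) 0 0 : K^o); last first.
  by rewrite tA scaler0 mul0mx mxE.
pose phi (X : 'M[K]_n) : K^o := ((6 *: contract L X) *m dualv k) 0 0.
have phi_lin : linear phi.
  move=> a X Y; rewrite /phi contract_is_linear scalerDr scalerA mulrC -scalerA.
  by rewrite mulmxDl -scalemxAl !mxE.
pose psi : {linear 'M[K]_n -> K^o} := HB.pack phi (GRing.isLinear.Build K _ _ _ phi phi_lin).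
rewrite -[RHS]/(psi A) [in RHS](zc_expand A) linear_sum; apply: eq_bigr => i _.
rewrite linear_sum; apply: eq_bigr => j _; rewrite linearZ /= /phi contract_outer.
by rewrite (sb_mul bP) dualv_realize // mxE eqxx mulr1n /F /= [LHS]mulrC.
Qed.

Lemma invariant_relP A o i j : (i < 27)%N -> (j < 27)%N -> pivot o i j -> inV A ->
  (forall o, (o < 3)%N -> dact (table_mx b (lower o)) A = 0) ->
  zc A (0, 3) = 0 -> zc A (16, 19) = 0 ->
  realize (zc A) (invariant_rel o i j) = 0.
Proof.
move=> i27 j27 piv VA low z1 z2; rewrite /invariant_rel.
case: ifP piv => [o3 _|o3]; last rewrite /pivot o3 /=.
  by rewrite -zc_dact // low // /zc mulmx0 mul0mx mxE.
case: (Nat.eqb_spec o 3) => [->|/eqP/negPf o3'] /=.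
  rewrite orbF !inE => /orP[]/eqP-> ; by rewrite realize_cons realize_nil addr0 ?z1 ?z2 scaler0.
by move=> _; exact: zc_contract.
Qed.

Lemma zc_sum_ordered A l : A^T = A -> realize (zc A) (order_keys l) = realize (zc A) l.
Proof.
move=> sA; rewrite /realize big_map; apply: eq_bigr => -[[i j] a] _.
by rewrite /ordered /=; case: ifP => // _; rewrite zcC.
Qed.

(** This is the bound by 2. The torus kills coordinates of nonzero weight, tracelessness those with
    index 26, and the certificate writes the remaining ones through the lowering relations, the
    contraction and the two pivots (0, 3) and (16, 19). *)
Lemma invariant_unique A : inV A ->
  (forall o, (o < 3)%N -> dact (table_mx b (lower o)) A = 0) ->
  (forall k, (k < 4)%N -> dact (table_mx b (torus k)) A = 0) ->
  zc A (0, 3) = 0 -> zc A (16, 19) = 0 -> A = 0.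
Proof.
move=> VA low tor z1 z2; have [sA _ _] := (constraintsP _ _ _ _).1 VA.
have le26 i j : (i <= j < 26)%N -> zc A (i, j) = 0.
  move=> /andP[ij j26]; have i26 := leq_ltn_trans ij j26.
  have /allP/(_ i) := invariant_check_ok; rewrite mem_iota add0n i26 => /(_ isT).
  move=> /allP/(_ j); rewrite mem_iota add0n j26 => /(_ isT); rewrite ltnNge ij [~~ true]/= orFb.
  case/orP => [/hasP[k] | /hasP[[[[i' j'] N] l] _]].
    rewrite mem_iota add0n => k4 wN.
    have := congr1 (fun M => zc M (i, j)) (tor k k4).
    rewrite zc_torus ?(ltn_trans i26) ?(ltn_trans j26) //.
    rewrite {2}/zc mulmx0 mul0mx mxE => /eqP; rewrite mulf_eq0 => /orP[|/eqP//].
    rewrite ofZ_eq0; move: wN; rewrite !inE => /or4P[]/eqP-> /=; last first.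
    - by rewrite (natrM _ 2 2) mulf_eq0 (negPf char2).
    - by rewrite (negPf char3).
    - by rewrite (negPf char2).
    - by rewrite oner_eq0.
  case/and5P => _ _ N0 piv van.
  have := vanishesP eq_pairP (zc A) van; rewrite zc_sum_ordered // realize_cons /=.
  have -> : realize (zc A) (flatten [seq let: (o, i'', j'', a) := y in
       sscale a (invariant_rel o i'' j'') | y <- l]) = 0.
    elim: l piv {van} => [|[[[o i1] j1] a] l IH] /=; first by rewrite realize_nil.
    move=> /andP[/and3P[i27 j27 piv] /IH e1].
    by rewrite realize_cat realize_scale invariant_relP // e1 scaler0 addr0.
  rewrite addr0 => /eqP; rewrite scaler_eq0 => /orP[|/eqP->//].
  have -> : ofZ K (- Z.of_nat N) = - ofZ K (Z.of_nat N).
    by rewrite /ofZ (rmorphN int_of_Z) rmorphN.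
  rewrite oppr_eq0; move: N0; rewrite !inE => /orP[/eqP->|/eqP->]; first by rewrite [_ == _]oner_eq0.
  rewrite -[ofZ _ _]/(24%:R : K) (natrM _ 4 6) mulf_eq0 (negPf char6).
  by rewrite (natrM _ 2 2) mulf_eq0 (negPf char2).
apply: zc0 => i j i27 j27.
have main k l : (k <= l < 27)%N -> zc A (k, l) = 0.
  move=> /andP[kl l27]; have [l26|l26] := ltnP l 26; first by rewrite le26 // kl.
  by rewrite (_ : l = 26) ?zc26 //; lia.
by case: (leqP i j) => ij; [|rewrite zcC //=]; apply: main; rewrite ?ij ?(ltnW ij).
Qed.

End Invariants.

(** * Values of the two products at (v^2, w^2) *)

Definition traceless_mulb s t := [seq x <- mulb s t | ~~ Nat.eqb x.1 26].

Definition outer (l l' : seq (nat * Z)) : seq (nat * nat * Z) :=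
  [seq ((x.1, y.1), Z.mul x.2 y.2) | x <- l, y <- l'].

(** 36 times the product of [sy p] and [sy q]: each of the two factors multiplied in W brings a 6.
    The 2 remains because [sy] is twice the symmetric product, in both arguments and in the
    result. *)
Definition star_pair (p q : nat * nat) : seq (nat * nat * Z) :=
  sscale (2 : Z)%Z (outer (traceless_mulb p.1 q.1) (traceless_mulb p.2 q.2) ++
             outer (traceless_mulb p.1 q.2) (traceless_mulb p.2 q.1)).

(* 234 and 702 times the values of the two products at (v^2, w^2), where v = 18 and w = 17. *)
Definition value1 : seq (nat * nat * Z) :=
  (17,18)#-312 :: sscale (13 : Z)%Z (star_pair (18, 18)%N (17, 17)%N)
  ++ sscale (-8 : Z)%Z idT_table.

Definition value2 : seq (nat * nat * Z) :=
  (17,18)#-5616 :: sscale (-13 : Z)%Z (sbind (star_pair (17, 18)%N) idT_table)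
  ++ sscale (-240 : Z)%Z idT_table.

Definition pair_coef (p : nat * nat) (l : seq (nat * nat * Z)) : Z :=
  foldr (fun x acc => if eq_pair (ordered x.1) p then Z.add x.2 acc else acc) Z0 l.

(** The vanishing contractions are what closure of V' requires. The four coordinates show the
    independence of the two values: their determinant is 48 . (1440 - 36). *)
Lemma value_checks :
  [&& vanishes1 (sbind (fun p => mulb p.1 p.2) value1),
      vanishes1 (sbind (fun p => mulb p.1 p.2) value2),
      Z.eqb (pair_coef (0, 3)%N value1) (-48 : Z)%Z, Z.eqb (pair_coef (16, 19)%N value1) (-48 : Z)%Z,
      Z.eqb (pair_coef (0, 3)%N value2) (-36 : Z)%Z & Z.eqb (pair_coef (16, 19)%N value2) (-1440 : Z)%Z].
Proof. by lazy. Qed.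

Section Values.
Variables (K : fieldType) (n : nat) (L : 'I_n -> 'M[K]_n) (Q Q' : 'M[K]_n) (e : 'rV[K]_n).
Variable c : K.
Hypothesis char2 : (2 : K) != 0.
Hypothesis char3 : (3 : K) != 0.
Hypothesis char13 : (13 : K) != 0.
Hypothesis alb : albert_axioms L Q Q' e c.
Variable b : nat -> 'rV[K]_n.
Hypothesis bP : standard_basis L Q e b.

Let char6 : (6 : K) != 0.
Proof. by rewrite (natrM _ 2 3) mulf_neq0. Qed.

Let char36 : (36 : K) != 0.
Proof. by rewrite (natrM _ 6 6) mulf_neq0. Qed.
Let char54 : (54 : K) != 0.
Proof. by rewrite (natrM _ 6 9) (natrM _ 3 3) !mulf_neq0. Qed.
Let char78 : (78 : K) != 0.
Proof. by rewrite (natrM _ 6 13) mulf_neq0. Qed.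

Local Notation inV A := (constraints L Q e A = 0).
Local Notation sy := (sy b).
Local Notation t := (3^-1 : K).
Local Notation star := (starmx L Q e t).
Local Notation prodmx := (prodmx L Q Q' e t).
Local Notation lmul := (lmulT L Q e t).

(* The two products of the theorem, where 4 / 78 = 2 * 2 / (3 * 26) and 40 / 78 = 2 * 20 / (3 * 26). *)
Definition coefs1 : K * K * K * K := (3^-1, 2, 0, - (4 / 78)).
Definition coefs2 : K * K * K * K := (2, 0, 1, - (40 / 78)).

Lemma starmx_outer (x y u w : 'rV[K]_n) :
  star (x^T *m y) (u^T *m w) = 2 *: ((u *m lcomb lmul x)^T *m (w *m lcomb lmul y)).
Proof.
rewrite starmxE; congr (_ *: _); rewrite trmx_mul.
rewrite {2}/lcomb [(\sum_i _)^T]linear_sum /= !mulmx_suml; apply: eq_bigr => i _.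
have -> : row i (x^T *m y) = x 0 i *: y by apply/rowP => j; rewrite !mxE big_ord1 !mxE.
by rewrite linearZ /= [(_ *: _)^T]linearZ /= -!scalemxAl -scalemxAr !mulmxA.
Qed.

Lemma realize_traceless l :
  realize b l *m traceless_proj Q e t = realize b [seq x <- l | ~~ Nat.eqb x.1 26].
Proof.
elim: l => [|[k a] l IH]; first by rewrite !realize_nil mul0mx.
rewrite realize_cons mulmxDl -scalemxAl IH /=; case: Nat.eqb_spec => [->|k26] /=.
  by rewrite (sb_unit bP) (unit_proj char2 char3 bP) scaler0 add0r.
rewrite realize_cons; congr (_ *: _ + _) => /=.
have [k27|k27] := ltnP k 26; first exact: (sb_proj char2 bP).
by rewrite (sb_out bP) ?mul0mx //; lia.
Qed.

Lemma traceless_mulbE i k : 6 *: (b k *m lcomb lmul (b i)) = realize b (traceless_mulb i k).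
Proof.
by rewrite -realize_traceless -(sb_mul bP) -scalemxAl -mulmxA lcomb_mulr.
Qed.

Lemma realize_outer_pair l l' : realize sy (outer l l')
  = (realize b l)^T *m realize b l' + (realize b l')^T *m realize b l.
Proof.
elim: l => [|[k a] l IH]; first by rewrite !realize_nil trmx0 mul0mx mulmx0 addr0.
rewrite /outer allpairs_cons realize_cat -/(outer l l') IH realize_cons /=.
have -> : realize sy [seq ((k, y.1), Z.mul a y.2) | y <- l']
    = ofZ K a *: ((b k)^T *m realize b l' + (realize b l')^T *m b k).
  elim: l' {IH} => [|[j a'] l' IH]; first by rewrite !realize_nil trmx0 mul0mx mulmx0 addr0 scaler0.
  rewrite /= !realize_cons IH /= ofZM -scalerA -scalerDr; congr (_ *: _).
  rewrite [(_ + _)^T]linearD /= [(_ *: _)^T]linearZ /= mulmxDr mulmxDl -scalemxAr -scalemxAl.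
  by rewrite addrACA -scalerDr.
rewrite [(_ + _)^T]linearD /= [(_ *: _)^T]linearZ /= mulmxDr mulmxDl -scalemxAr -scalemxAl.
by rewrite addrACA -scalerDr.
Qed.

Lemma star_pairE p q : 36 *: star (sy p) (sy q) = realize sy (star_pair p q).
Proof.
rewrite realize_scale realize_cat !realize_outer_pair -!traceless_mulbE.
have sD A B C : star (A + B) C = star A C + star B C.
  by rewrite -[A]scale1r starmxP !scale1r.
have sDr A B C : star A (B + C) = star A B + star A C.
  by rewrite -[B]scale1r starmxPr !scale1r.
have t6 (x : 'rV[K]_n) : (6 *: x)^T = 6 *: x^T by rewrite linearZ.
rewrite /sy !(sD, sDr) !starmx_outer !t6 -!(scalemxAl, scalemxAr) !scalerA -natrM.
rewrite -!scalerDr !scalerA [36 * 2]mulrC; congr (_ *: _).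
by rewrite [X in _ + _ + X]addrC addrACA.
Qed.

Lemma idT_tableE : 6 *: idT Q' e t = realize sy idT_table.
Proof.
have Q'Q : Q' *m Q = 1%:M by apply: mulmx1C (gram_inv alb).
have := gram_inv_table bP char2.
move=> /(congr1 (mulmx Q')); rewrite mulmxA Q'Q mul1mx mul_mx_scalar realize_cons /=.
rewrite -[ofZ _ _]/(1 : K) scale1r => h; apply: (addrI (sy (26, 26))); rewrite h.
rewrite /idT scalerBr scalerA /sy /= (sb_unit bP) -mulr2n -scaler_nat.
rewrite (_ : 6 * t = 2); first by rewrite addrC subrK.
by field.
Qed.

Let v := b 18.
Let w := b 17.

Lemma form_top : (v *m Q *m w^T = - 1%:M) /\ (w *m Q *m v^T = - 1%:M).
Proof.
split; apply: (scalerI char2); rewrite (sb_form bP) scalerN scale_scalar_mx mulr1.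
  by rewrite -raddfN; congr (_%:M).
by rewrite -raddfN; congr (_%:M).
Qed.

Lemma top_mul : sy (18, 18) *m Q *m sy (17, 17) = (- 4) *: (v^T *m w)
  /\ sy (17, 17) *m Q *m sy (18, 18) = (- 4) *: (w^T *m v).
Proof.
have [vw wv] := form_top.
have dbl x : (b x)^T *m b x + (b x)^T *m b x = 2 *: ((b x)^T *m b x).
  by rewrite scaler_nat mulr2n.
rewrite /sy /= !dbl -!(scalemxAl, scalemxAr) !scalerA -natrM.
split.
  rewrite -!mulmxA (mulmxA v) (mulmxA (v *m Q)) vw mulNmx mul1mx mulmxN scalerN scaleNr //.
by rewrite -!mulmxA (mulmxA w) (mulmxA (w *m Q)) wv mulNmx mul1mx mulmxN scalerN scaleNr.
Qed.

(** All constants come from [<v, w>] = -1, from [sy (18, 18)] = 2 v^T v and its analogue for w, from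
    the factor 36 of [star_pair] and from the factor 6 of [idT_table]; for instance 54 is 36 . 6 /
    4. *)
Lemma prodmx_top d1 d2 d3 d4 :
  prodmx (d1, d2, d3, d4) (sy (18, 18)) (sy (17, 17))
  = (- 4 * d1) *: sy (17, 18) + (d2 / 36) *: realize sy (star_pair (18, 18) (17, 17))
    + (- d3 / 54) *: realize sy (sbind (star_pair (17, 18)) idT_table)
    + (d4 * 2 / 3) *: realize sy idT_table.
Proof.
have [vw wv] := top_mul; have [_ gwv] := form_top.
have ac : anticomm Q (sy (18, 18)) (sy (17, 17)) = (- 4) *: sy (17, 18).
  by rewrite /anticomm vw wv -scalerDr addrC.
rewrite /prodmx ac vw; congr (_ + _ + _ + _).
- by rewrite scalerA mulrC.
- by rewrite -star_pairE [RHS]scalerA divfK.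
- have <- : 36 *: star (sy (17, 18)) (realize sy idT_table)
      = realize sy (sbind (star_pair (17, 18)) idT_table).
    apply: (realize_bind (phi := fun X => 36 *: star (sy (17, 18)) X)) => [a X Y|q].
      by rewrite starmxPr scalerDr [in LHS]scalerA [in RHS]scalerA mulrC.
    exact: star_pairE.
  rewrite -idT_tableE.
  rewrite starmxZl starmxZr [LHS]scalerA 2![in RHS]scalerA; congr (_ *: _).
  by field; exact: char54.
rewrite -idT_tableE scalerA; congr (_ *: _).
rewrite -scalemxAl mxtraceZ -mulmxA mxtrace_mulC gwv raddfN /= mxtrace1.
by field.
Qed.

Lemma value1E : 234 *: prodmx coefs1 (sy (18, 18)) (sy (17, 17)) = realize sy value1.
Proof.
rewrite prodmx_top /value1; move: idT_table (star_pair _ _) (sbind _ _) => l1 l2 l3.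
rewrite realize_cons realize_cat !realize_scale /=; move: (sy _) => s.
rewrite !scalerDr !scalerA oppr0 !mul0r !mulr0 scale0r addr0 addrA.
congr (_ *: _ + _ *: _ + _ *: _).
- rewrite -[ofZ _ _]/(- 312%:R : K); by field.
- rewrite -[ofZ _ _]/(13%:R : K); by field; rewrite ?char36 ?char54 ?char78 ?char3 ?char2.
- rewrite -[ofZ _ _]/(- 8%:R : K); by field; rewrite ?char36 ?char54 ?char78 ?char3 ?char2.
Qed.

Lemma value2E : 702 *: prodmx coefs2 (sy (18, 18)) (sy (17, 17)) = realize sy value2.
Proof.
rewrite prodmx_top /value2; move: idT_table (star_pair _ _) (sbind _ _) => l1 l2 l3.
rewrite realize_cons realize_cat !realize_scale /=; move: (sy _) => s.
rewrite !scalerDr !scalerA !mul0r !mulr0 scale0r addr0 addrA.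
congr (_ *: _ + _ *: _ + _ *: _).
- rewrite -[ofZ _ _]/(- 5616%:R : K); by field.
- rewrite -[ofZ _ _]/(- 13%:R : K); by field; rewrite ?char36 ?char54 ?char78 ?char3 ?char2.
- rewrite -[ofZ _ _]/(- 240%:R : K); by field; rewrite ?char36 ?char54 ?char78 ?char3 ?char2.
Qed.

(** The strict inequality matters: on the diagonal [sy] has coordinate 2, not 1. *)
Lemma zc_pair_coef l i j : (i < j < 27)%N ->
  zc b (realize sy l) (i, j) = ofZ K (pair_coef (i, j) l).
Proof.
move=> /andP[ij j27]; have i27 := ltn_trans ij j27.
elim: l => [|[[k m] a] l IH]; first by rewrite realize_nil /zc mulmx0 mul0mx mxE.
rewrite realize_cons zcP IH /=.
have -> : zc b (sy (k, m)) (i, j) = (eq_pair (ordered (k, m)) (i, j))%:R.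
  have dT x y (p q : nat) : (p < 27)%N -> (q < 27)%N ->
      (dualv b p)^T *m ((b x)^T *m b y) *m dualv b q = (x == p)%:R%:M *m (y == q)%:R%:M.
    by move=> p27 q27; rewrite mulmxA -trmx_mul -mulmxA !(dualvE bP) // tr_scalar_mx.
  rewrite /zc /sy /= mulmxDr mulmxDl !dT // -!scalar_mxM -raddfD mxE eqxx mulr1n.
  rewrite -!natrM -natrD; congr (_%:R).
  rewrite /eq_pair /ordered /=.
  have nb x y : Nat.eqb x y = (x == y) by apply/idP/eqP => /Nat.eqb_spec.
  by case: leqP => km /=; rewrite !nb; do ! (case: eqP => ? //=); lia.
case: ifP => _; first by rewrite ofZD [_ *: _]mulr1.
by rewrite scaler0 add0r.
Qed.

End Values.

(** * Products satisfying the Leibniz rule over K, and stability of V' under the two given ones *)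

Section Classification.
Variables (K : fieldType) (n : nat) (L : 'I_n -> 'M[K]_n) (Q Q' : 'M[K]_n) (e : 'rV[K]_n).
Variable c : K.
Hypothesis char2 : (2 : K) != 0.
Hypothesis char3 : (3 : K) != 0.
Hypothesis char13 : (13 : K) != 0.
Hypothesis alb : albert_axioms L Q Q' e c.
Variable b : nat -> 'rV[K]_n.
Hypothesis bP : standard_basis L Q e b.

Let char6 : (6 : K) != 0.
Proof. by rewrite (natrM _ 2 3) mulf_neq0. Qed.
Let char234 : (234 : K) != 0.
Proof. by rewrite (natrM _ 18 13) (natrM _ 6 3) !mulf_neq0. Qed.
Let char702 : (702 : K) != 0.
Proof. by rewrite (natrM _ 234 3) !mulf_neq0. Qed.

Local Notation inV A := (constraints L Q e A = 0).
Local Notation sy := (sy b).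
Local Notation t := (3^-1 : K).
Local Notation prodmx := (prodmx L Q Q' e t).
Local Notation cf1 := (coefs1 K).
Local Notation cf2 := (coefs2 K).
Local Notation top Phi := (Phi (sy (18, 18)) (sy (17, 17))).

Lemma top_inV : inV (sy (18, 18)) /\ inV (sy (17, 17)).
Proof. by split; apply: (sy_inV char2 char3 bP). Qed.

Section Invariance.
Variable Phi : 'M[K]_n -> 'M[K]_n -> 'M[K]_n.
Hypothesis Phi_l : forall a A A' B, inV A -> inV A' -> inV B ->
  Phi (a *: A + A') B = a *: Phi A B + Phi A' B.
Hypothesis Phi_r : forall a A B B', inV A -> inV B -> inV B' ->
  Phi A (a *: B + B') = a *: Phi A B + Phi A B'.
Hypothesis Phi_der : forall D A B, is_der L D -> inV A -> inV B ->
  Phi (dact D A) B + Phi A (dact D B) = dact D (Phi A B).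

(** In the Leibniz rule at (v^2, w^2) the eigenvalues a and -a cancel. Torus elements use it with
    the weight of v^2, and the lowering operators 0, 1, 2 with a = 0. *)
Lemma Phi_scaleD D a : is_der L D ->
  dact D (sy (18, 18)) = a *: sy (18, 18) -> dact D (sy (17, 17)) = - a *: sy (17, 17) ->
  dact D (top Phi) = 0.
Proof.
have [V18 V17] := top_inV; move=> dD e18 e17; rewrite -Phi_der // e18 e17.
have V0 : inV (0 : 'M[K]_n) by rewrite linear0.
have Phi0l : Phi 0 (sy (17, 17)) = 0.
  by have := Phi_l (-1) V0 V0 V17; rewrite scaler0 addr0 scaleN1r addNr.
have Phi0r : Phi (sy (18, 18)) 0 = 0.
  by have := Phi_r (-1) V18 V0 V0; rewrite scaler0 addr0 scaleN1r addNr.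
rewrite -[a *: _]addr0 -[- a *: _]addr0 Phi_l // Phi_r // Phi0l Phi0r !addr0.
by rewrite scaleNr subrr.
Qed.

Lemma top_lower o : (o < 3)%N -> dact (table_mx b (lower o)) (top Phi) = 0.
Proof.
move=> o3; have o4 : (o < 4)%N by apply: leq_trans o3 _.
apply: (@Phi_scaleD _ 0); first exact: (lower_der char2 char3 bP).
  rewrite scale0r; have -> : sy (18, 18) = realize sy [:: ((18, 18), 1 : Z)]%N.
    by rewrite realize_cons realize_nil addr0 scale1r.
  rewrite (dact_realize bP); last exact: lower_out.
  by case: o o3 {o4} => [|[|[|]]] // _; rewrite realize_nil.
by rewrite oppr0 scale0r (lowering_sy17 bP).
Qed.

Lemma top_torus k : (k < 4)%N -> dact (table_mx b (torus k)) (top Phi) = 0.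
Proof.
move=> k4; have tor s : dact (table_mx b (torus k)) (sy (s, s))
    = ofZ K (Z.add (weight k s) (weight k s)) *: sy (s, s).
  have -> : sy (s, s) = realize sy [:: ((s, s), 1 : Z)]%N.
    by rewrite realize_cons realize_nil addr0 scale1r.
  rewrite (dact_realize bP); last exact: (torus_out bP k).
  rewrite /act_sym /torus /= !realize_cons !realize_nil !addr0 scale1r -scalerDl -ofZD.
  by rewrite !Z.mul_1_l.
apply: (@Phi_scaleD _ (ofZ K (Z.add (weight k 18) (weight k 18)))); rewrite ?tor //.
  exact: (torus_der char2 char3 bP).
congr (_ *: _); rewrite -[RHS]mulN1r -[-1]/(ofZ K (-1)) -ofZM.
by case: k k4 {tor} => [|[|[|[|]]]].
Qed.

End Invariance.

Section Closure.
Variable d : K * K * K * K.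
Hypothesis d_top : contract L (top (prodmx d)) = 0.

Lemma unit_norm : e *m (Q *m e^T) = 3%:M.
Proof.
by apply: (scalerI char2); rewrite mulmxA -(sb_unit bP) (sb_form bP) scale_scalar_mx -natrM.
Qed.

Lemma proj_unit : traceless_proj Q e t *m (Q *m e^T) = 0.
Proof.
rewrite /traceless_proj mulmxBl mul1mx -scalemxAl -!mulmxA unit_norm mul_mx_scalar.
by rewrite -scalemxAr scalerA mulVf // scale1r subrr.
Qed.

Lemma star_unit A B : starmx L Q e t A B *m (Q *m e^T) = 0.
Proof.
rewrite /starmx -scalemxAl mulmx_suml big1 ?scaler0 // => i _.
rewrite mulmx_suml big1 // => j _.
by rewrite -scalemxAl -(mulmxA _ (lmulT _ _ _ _ _)) -(mulmxA (L j)) proj_unit !mulmx0 scaler0.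
Qed.

Lemma idT_unit : idT Q' e t *m (Q *m e^T) = 0.
Proof.
have Q'Q : Q' *m Q = 1%:M by apply: mulmx1C (gram_inv alb).
rewrite /idT mulmxBl -scalemxAl -mulmxA unit_norm mul_mx_scalar scalerA mulVf // scale1r.
by rewrite mulmxA Q'Q mul1mx subrr.
Qed.

Lemma trmx_star A B : (starmx L Q e t A B)^T = starmx L Q e t A^T B^T.
Proof.
rewrite /starmx [LHS]linearZ /=; congr (_ *: _); rewrite raddf_sum exchange_big /=.
apply: eq_bigr => i _; rewrite raddf_sum /=; apply: eq_bigr => j _.
by rewrite [LHS]linearZ /= mxE; congr (_ *: _); rewrite trmx_mul [(_ *m B)^T]trmx_mul trmxK mulmxA.
Qed.

Lemma trmx_idT : (idT Q' e t)^T = idT Q' e t.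
Proof.
have Q'Q : Q' *m Q = 1%:M by apply: mulmx1C (gram_inv alb).
have sQ' : Q'^T = Q'.
  rewrite -[LHS]mul1mx -Q'Q -mulmxA -{1}(gram_sym alb) -trmx_mul Q'Q trmx1 mulmx1 //.
by rewrite /idT linearB /= [(_ *: _)^T]linearZ /= trmx_mul trmxK sQ'.
Qed.

Lemma trmx_prodmx A B : A^T = A -> B^T = B -> (prodmx d A B)^T = prodmx d A B.
Proof.
move=> sA sB; case: (d) => [[[d1 d2] d3] d4]; rewrite /prodmx.
have sAB : (anticomm Q A B)^T = anticomm Q A B.
  by rewrite /anticomm linearD /= !trmx_mul sA sB (gram_sym alb) !mulmxA addrC.
have trD (X Y : 'M[K]_n) : (X + Y)^T = X^T + Y^T by rewrite linearD.
have trZ a (X : 'M[K]_n) : (a *: X)^T = a *: X^T by rewrite linearZ.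
by rewrite !trD (trZ d1) (trZ d2) (trZ d3) (trZ (_ * _)) !trmx_star trmx_idT sA sB sAB.
Qed.

(** Symmetry and orthogonality to e hold for each of the four terms separately. Only the vanishing
    of the contraction depends on the coefficients, and one value, [d_top], decides it. *)
Lemma prodmx_closed A B : inV A -> inV B -> inV (prodmx d A B).
Proof.
move=> VA VB; apply/constraintsP; split.
- by case/constraintsP: VA => sA _ _; case/constraintsP: VB => sB _ _; exact: trmx_prodmx.
- case/constraintsP: VA => sA wA _; case/constraintsP: VB => sB wB _.
  case: (d) => [[[d1 d2] d3] d4].
  rewrite /prodmx 3!mulmxDl -(scalemxAl d1) -(scalemxAl d2) -(scalemxAl d3).
  rewrite -(scalemxAl (d4 * _)) !star_unit idT_unit.
  by rewrite /anticomm mulmxDl -!mulmxA wA wB !mulmx0 addr0 !scaler0 !addr0.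
(* Here the target is J with D acting on vectors; the other use of the criterion has symmetric
   matrices as target. *)
apply: (@zero_criterion _ _ _ _ _ _ _ char2 char3 alb _ bP _ (fun D x => x *m D)
    (fun A B => contract L (prodmx d A B))) => //.
- by move=> D; rewrite mul0mx.
- by move=> a X X' Y _ _ _; rewrite prodmxP contract_is_linear.
- by move=> a X Y Y' _ _ _; rewrite prodmxPr contract_is_linear.
- move=> D X Y dD VX VY; rewrite -(der_contract _ dD) -(der_prodmx t alb d _ _ dD).
  by rewrite linearD.
Qed.

End Closure.

Lemma contract_realize l :
  3 *: contract L (realize sy l) = realize b (sbind (fun p => mulb p.1 p.2) l).
Proof.
apply: (realize_bind (phi := fun X => 3 *: contract L X)) => [a X Y|[i j]].
  by rewrite contract_is_linear scalerDr !scalerA mulrC.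
exact: (contract_sy char2 char3 bP).
Qed.

Lemma contract_top1 : contract L (top (prodmx cf1)) = 0.
Proof.
apply: (scalerI char234); rewrite scaler0 -linearZ /= (value1E char2 char3 char13 alb bP).
apply: (scalerI char3); rewrite contract_realize scaler0; apply: vanishes1P.
by have /andP[] := value_checks.
Qed.

Lemma contract_top2 : contract L (top (prodmx cf2)) = 0.
Proof.
apply: (scalerI char702); rewrite scaler0 -linearZ /= (value2E char2 char3 char13 alb bP).
apply: (scalerI char3); rewrite contract_realize scaler0; apply: vanishes1P.
by have /andP[_ /andP[]] := value_checks.
Qed.

Lemma prodmx1_closed A B : inV A -> inV B -> inV (prodmx cf1 A B).
Proof. exact: prodmx_closed contract_top1 A B. Qed.

Lemma prodmx2_closed A B : inV A -> inV B -> inV (prodmx cf2 A B).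
Proof. exact: prodmx_closed contract_top2 A B. Qed.

Lemma equivariant_products (Phi : 'M[K]_n -> 'M[K]_n -> 'M[K]_n) :
  (forall A B, inV A -> inV B -> inV (Phi A B)) ->
  (forall a A A' B, inV A -> inV A' -> inV B ->
     Phi (a *: A + A') B = a *: Phi A B + Phi A' B) ->
  (forall a A B B', inV A -> inV B -> inV B' ->
     Phi A (a *: B + B') = a *: Phi A B + Phi A B') ->
  (forall D A B, is_der L D -> inV A -> inV B ->
     Phi (dact D A) B + Phi A (dact D B) = dact D (Phi A B)) ->
  exists alpha beta, forall A B, inV A -> inV B ->
    Phi A B = alpha *: prodmx cf1 A B + beta *: prodmx cf2 A B.
Proof.
move=> PhiV Phi_l Phi_r Phi_der; have [V18 V17] := top_inV.
pose z1 := zc b (top Phi) (0, 3); pose z2 := zc b (top Phi) (16, 19).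
(* The solution of z1 = -48 x - 36 y and z2 = -48 x - 1440 y, the pivot coordinates recorded in
   [value_checks]; the factors 234 and 702 then undo the scaling of [value1] and [value2]. *)
pose y : K := (z1 - z2) / 1404; pose x : K := - (z1 + 36 * y) / 48.
have n1404 : (1404 : K) != 0 by rewrite (natrM _ 702 2) mulf_neq0.
have n48 : (48 : K) != 0 by rewrite (natrM _ 6 8) (natrM _ 2 4) (natrM _ 2 2) !mulf_neq0.
exists (x * 234), (y * 702).
pose Psi A B := - (x * 234) *: prodmx cf1 A B + (- (y * 702) *: prodmx cf2 A B + Phi A B).
have dactP D a A B : dact D (a *: A + B) = a *: dact D A + dact D B.
  by rewrite /dact mulmxDr mulmxDl -scalemxAr -scalemxAl scalerDr addrACA.
have PsiV A B : inV A -> inV B -> inV (Psi A B).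
  move=> VA VB; apply: inVP; first exact: prodmx1_closed.
  by apply: inVP; [exact: prodmx2_closed|exact: PhiV].
have lin3 (s r a : K) (X X' Y Y' Z Z' : 'M[K]_n) :
    s *: (a *: X + X') + (r *: (a *: Y + Y') + (a *: Z + Z'))
    = a *: (s *: X + (r *: Y + Z)) + (s *: X' + (r *: Y' + Z')).
  rewrite !scalerDr !scalerA [s * a]mulrC [r * a]mulrC.
  by rewrite [X in _ + X = _]addrACA [LHS]addrACA.
have add3 (s r : K) (X X' Y Y' Z Z' : 'M[K]_n) :
    s *: X + (r *: Y + Z) + (s *: X' + (r *: Y' + Z'))
    = s *: (X + X') + (r *: (Y + Y') + (Z + Z')).
  by rewrite !scalerDr [LHS]addrACA; congr (_ + _); rewrite addrACA.
have Psi_l a A A' B : inV A -> inV A' -> inV B -> Psi (a *: A + A') B = a *: Psi A B + Psi A' B.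
  move=> VA VA' VB; rewrite /Psi !prodmxP Phi_l //; exact: lin3.
have Psi_r a A B B' : inV A -> inV B -> inV B' -> Psi A (a *: B + B') = a *: Psi A B + Psi A B'.
  move=> VA VB VB'; rewrite /Psi !prodmxPr Phi_r //; exact: lin3.
have Psi_der D A B : is_der L D -> inV A -> inV B ->
    Psi (dact D A) B + Psi A (dact D B) = dact D (Psi A B).
  move=> dD VA VB; rewrite /Psi !dactP -(der_prodmx t alb cf1 _ _ dD).
  rewrite -(der_prodmx t alb cf2 _ _ dD) -Phi_der //; exact: add3.
have [/Z.eqb_eq v1 /Z.eqb_eq v2 /Z.eqb_eq v3 /Z.eqb_eq v4] :=
  and4P (andP (andP value_checks).2).2.
have zc1 i j : (i < j < 27)%N ->
    234 * zc b (top (prodmx cf1)) (i, j) = ofZ K (pair_coef (i, j) value1).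
  move=> ij; rewrite -(zc_pair_coef char2 char3 char13 bP) // -(value1E char2 char3 char13 alb bP).
  by rewrite zcZ.
have zc2 i j : (i < j < 27)%N ->
    702 * zc b (top (prodmx cf2)) (i, j) = ofZ K (pair_coef (i, j) value2).
  move=> ij; rewrite -(zc_pair_coef char2 char3 char13 bP) // -(value2E char2 char3 char13 alb bP).
  by rewrite zcZ.
have zcPsi i j : (i < j < 27)%N -> zc b (top Psi) (i, j) = - x * ofZ K (pair_coef (i, j) value1)
    - y * ofZ K (pair_coef (i, j) value2) + zc b (top Phi) (i, j).
  move=> ij; rewrite 2!zcP -zc1 // -zc2 //.
  move: (zc b (top _) _) (zc b (top _) _) (zc b (top _) _) => u1 u2 u3.
  have scE (a u : K) : a *: (u : K^o) = a * u by [].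
  by rewrite !scE; ring.
have Psi0 : top Psi = 0.
  apply: (invariant_unique char2 char3 bP) => [|o o3|k k4||]; first exact: PsiV.
  - exact: top_lower Psi_l Psi_r Psi_der o o3.
  - exact: top_torus Psi_l Psi_r Psi_der k k4.
  - rewrite zcPsi // v1 v3 -[ofZ K (-48)]/(- 48%:R : K) -[ofZ K (-36)]/(- 36%:R : K) -/z1 /x.
    by field; exact: n48.
  - rewrite zcPsi // v2 v4 -[ofZ K (-48)]/(- 48%:R : K) -[ofZ K (-1440)]/(- 1440%:R : K) -/z2.
    by rewrite /x /y; field; rewrite n48 n1404.
move=> A B VA VB.
have : Psi A B = 0.
  apply: (@zero_criterion _ _ _ _ _ _ _ char2 char3 alb _ bP _ (fun D X => dact D X) Psi) => //.
  by move=> D; rewrite /dact mulmx0 mul0mx addr0.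
rewrite /Psi addrA => /eqP; rewrite addrC addr_eq0 => /eqP ->.
by rewrite opprD !scaleNr !opprK.
Qed.

End Classification.

(** * From Hermitian octonion matrices to the standard basis *)

Definition mul_rel (u : nat) : seq (nat * nat * Z) :=
  [seq x <- [seq ((i, j), coef_at u (mulb i j)) | i <- r27, j <- r27] | ~~ Z.eqb x.2 Z0].

Section HermitianModel.
Variable K : fieldType.
Hypothesis char2 : (2 : K) != 0.
Hypothesis char3 : (3 : K) != 0.

(** With matrices given by their four entries, octonion identities become scalar identities within
    reach of [ring] and [field]. *)
Definition mx2 (a b c d : K) : 'M[K]_2 :=
  \matrix_(i, j) (if i == 0 then if j == 0 then a else b else if j == 0 then c else d).

Definition oct a b c d a' b' c' d' : octonion K := (mx2 a b c d, mx2 a' b' c' d').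

Lemma mx2E (M : 'M[K]_2) : M = mx2 (M 0 0) (M 0 1) (M 1 0) (M 1 1).
Proof.
apply/matrixP => -[[|[|i]] p] // -[[|[|j]] q] //; rewrite mxE /=; congr (M _ _);
  exact: val_inj.
Qed.

Lemma mul_mx2 a b c d a' b' c' d' : mx2 a b c d *m mx2 a' b' c' d' =
  mx2 (a * a' + b * c') (a * b' + b * d') (c * a' + d * c') (c * b' + d * d').
Proof. by rewrite [LHS]mx2E; congr mx2; rewrite !mxE !big_ord_recl big_ord0 !mxE /= addr0. Qed.

Lemma adj_mx2 a b c d : \adj (mx2 a b c d) = mx2 d (- b) (- c) a.
Proof.
rewrite [LHS]mx2E; congr mx2; rewrite !mxE /cofactor det_mx11 !mxE /=.
all: by rewrite /= ?expr0 ?expr1 ?mul1r ?mulN1r // -signr_odd /= ?expr0 ?expr1 ?mul1r ?mulN1r.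
Qed.

Lemma add_mx2 a b c d a' b' c' d' : mx2 a b c d + mx2 a' b' c' d' =
  mx2 (a + a') (b + b') (c + c') (d + d').
Proof. by rewrite [LHS]mx2E; congr mx2; rewrite !mxE. Qed.

Lemma scale_mx2 x a b c d : x *: mx2 a b c d = mx2 (x * a) (x * b) (x * c) (x * d).
Proof. by rewrite [LHS]mx2E; congr mx2; rewrite !mxE. Qed.

Lemma opp_mx2 a b c d : - mx2 a b c d = mx2 (- a) (- b) (- c) (- d).
Proof. by rewrite [LHS]mx2E; congr mx2; rewrite !mxE. Qed.

Lemma add_oct a b c d a' b' c' d' s t u v s' t' u' v' :
  oct a b c d a' b' c' d' + oct s t u v s' t' u' v'
  = oct (a + s) (b + t) (c + u) (d + v) (a' + s') (b' + t') (c' + u') (d' + v').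
Proof. by congr (_, _); exact: add_mx2. Qed.

Lemma scale_oct x a b c d a' b' c' d' : x *: oct a b c d a' b' c' d'
  = oct (x * a) (x * b) (x * c) (x * d) (x * a') (x * b') (x * c') (x * d').
Proof. by congr (_, _); exact: scale_mx2. Qed.

Lemma omul_oct a b c d a' b' c' d' s t u v s' t' u' v' :
  omul (oct a b c d a' b' c' d') (oct s t u v s' t' u' v')
  = oct (a * s + b * u + (v' * a' - t' * c')) (a * t + b * v + (v' * b' - t' * d'))
        (c * s + d * u + (- u' * a' + s' * c')) (c * t + d * v + (- u' * b' + s' * d'))
        (s' * a + t' * c + (a' * v - b' * u)) (s' * b + t' * d + (- a' * t + b' * s))
        (u' * a + v' * c + (c' * v - d' * u)) (u' * b + v' * d + (- c' * t + d' * s)).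
Proof.
rewrite /omul /oct /= !adj_mx2 !mul_mx2 !add_mx2.
by congr (mx2 _ _ _ _, mx2 _ _ _ _); ring.
Qed.

(** The hermitian matrix with coordinates x in the order of [mul_table]. The entries (0, 1), (1, 2),
    (2, 0) are stored and the opposite ones are their conjugates, so that the last case is that of
    (0, 2). *)
Definition entry (x : nat -> K) (i j : nat) : octonion K :=
  let off k := oct (x k) (x k.+1) (x k.+2) (x k.+3)
                   (x k.+4) (x k.+4.+1) (x k.+4.+2) (x k.+4.+3) in
  let conj k := oct (x k.+3) (- x k.+1) (- x k.+2) (x k)
                   (- x k.+4) (- x k.+4.+1) (- x k.+4.+2) (- x k.+4.+3) in
  let diag c := oct c 0 0 c 0 0 0 0 in
  match i, j with
  | 0%N, 0%N => diag (x 24%N + x 26%N)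
  | 1%N, 1%N => diag (- x 24%N + x 25%N + x 26%N)
  | 2%N, 2%N => diag (- x 25%N + x 26%N)
  | 0%N, 1%N => off 0%N | 1%N, 0%N => conj 0%N
  | 1%N, 2%N => off 8%N | 2%N, 1%N => conj 8%N
  | 2%N, 0%N => off 16%N | _, _ => conj 16%N
  end.

Definition herm (x : nat -> K) : 'M[octonion K]_3 := \matrix_(i, j) entry x i j.

Definition eval_rel (x y : nat -> K) (l : seq (nat * nat * Z)) : K :=
  foldr (fun p acc => ofZ K p.2 * (x p.1.1 * y p.1.2) + acc) 0 l.

Definition mul27 (x y : nat -> K) (u : nat) : K := 6^-1 * eval_rel x y (mul_rel u).

Lemma ofZ_small : ((ofZ K 1 = 1) * (ofZ K 2 = 2) * (ofZ K 3 = 3) * (ofZ K 4 = 4) *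
  (ofZ K 6 = 6) * (ofZ K (-1) = -1) * (ofZ K (-2) = -2) * (ofZ K (-3) = -3) *
  (ofZ K (-4) = -4) * (ofZ K (-6) = -6))%type.
Proof. by []. Qed.

Ltac expand_mul27 :=
  repeat match goal with |- context [mul27 ?x ?y ?u] =>
    let l := eval vm_compute in (mul_rel u) in
    have -> : mul27 x y u = 6^-1 * eval_rel x y l by []
  end; rewrite /eval_rel /= ?ofZ_small.

(** Ties [mul_table] to the octonionic definition of the product, entry by entry, as polynomial
    identities in the 54 coordinates of x and y. *)
Lemma herm_mul x y : h3mul (herm x) (herm y) = herm (mul27 x y).
Proof.
have char6 : (6 : K) != 0 by rewrite (natrM _ 2 3) mulf_neq0.
apply/matrixP => i j; rewrite !mxE !big_ord_recl !big_ord0 !mxE !addr0.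
case: i => [[|[|[|]]]] // p; case: j => [[|[|[|]]]] // q;
  rewrite /entry /= !omul_oct !add_oct scale_oct.
all: congr oct; expand_mul27; by field; rewrite ?char2 ?char6 ?char3.
Qed.

End HermitianModel.

Section HermitianCoordinates.
Variable K : fieldType.
Hypothesis char2 : (2 : K) != 0.
Hypothesis char3 : (3 : K) != 0.
Implicit Types x y : nat -> K.

Lemma oct_inj a b c d a' b' c' d' s t u v s' t' u' v' :
  oct a b c d a' b' c' d' = oct s t u v s' t' u' v' :> octonion K ->
  [/\ a = s, b = t, c = u & d = v] /\ [/\ a' = s', b' = t', c' = u' & d' = v'].
Proof.
case=> /matrixP h /matrixP h'; split; split.
- by have := h 0 0; rewrite !mxE.
- by have := h 0 1; rewrite !mxE.
- by have := h 1 0; rewrite !mxE.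
- by have := h 1 1; rewrite !mxE.
- by have := h' 0 0; rewrite !mxE.
- by have := h' 0 1; rewrite !mxE.
- by have := h' 1 0; rewrite !mxE.
- by have := h' 1 1; rewrite !mxE.
Qed.

Lemma octE (o : octonion K) : o = oct (o.1 0 0) (o.1 0 1) (o.1 1 0) (o.1 1 1)
                                      (o.2 0 0) (o.2 0 1) (o.2 1 0) (o.2 1 1).
Proof. by case: o => p q; congr (_, _); exact: mx2E. Qed.

Lemma oconj_oct a b c d a' b' c' d' : oconj (oct a b c d a' b' c' d') =
  oct d (- b) (- c) a (- a') (- b') (- c') (- d') :> octonion K.
Proof. by rewrite /oconj /= adj_mx2 opp_mx2. Qed.

Lemma herm_hermitian x : hermitian (herm x).
Proof.
move=> i j; rewrite !mxE; case: i => [[|[|[|]]]] // p; case: j => [[|[|[|]]]] // q;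
  by rewrite /entry oconj_oct ?opprK ?oppr0.
Qed.

Lemma entry_linear a x y i j :
  entry (fun u => a * x u + y u) i j = a *: entry x i j + entry y i j.
Proof.
case: i => [|[|[|i]]]; case: j => [|[|[|j]]]; rewrite /entry scale_oct add_oct;
  by congr oct; ring.
Qed.

Lemma entry_ext x y i j : (forall u, (u < 27)%N -> x u = y u) -> entry x i j = entry y i j.
Proof.
move=> xy; case: i => [|[|[|i]]]; case: j => [|[|[|j]]]; by rewrite /entry !xy.
Qed.

Lemma entry_sum I (r : seq I) (c : I -> K) (X : I -> nat -> K) i j :
  entry (fun u => \sum_(s <- r) c s * X s u) i j = \sum_(s <- r) c s *: entry (X s) i j.
Proof.
elim: r => [|s r IH].
  rewrite big_nil; have := entry_linear (-1) (fun=> 0) (fun=> 0) i j.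
  rewrite scaleN1r addNr => <-; apply: entry_ext => u _; by rewrite big_nil mulr0 addr0.
rewrite big_cons -IH -entry_linear; apply: entry_ext => u _; by rewrite big_cons.
Qed.

Lemma herm_inj x y u : herm x = herm y -> (u < 27)%N -> x u = y u.
Proof.
move=> /matrixP h u27.
have e01 := h 0 1; have e12 := h 1 2%:R; have e20 := h 2%:R 0.
have e00 := h 0 0; have e11 := h 1 1; have e22 := h 2%:R 2%:R.
move: e01 e12 e20 e00 e11 e22; rewrite !mxE /=.
move=> /oct_inj[[? ? ? ?] [? ? ? ?]] /oct_inj[[? ? ? ?] [? ? ? ?]] /oct_inj[[? ? ? ?] [? ? ? ?]].
move=> /oct_inj[[e0 _ _ _] _] /oct_inj[[e1 _ _ _] _] /oct_inj[[e2 _ _ _] _].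
(* The diagonal entries add up to three times the coordinate of the identity. *)
have e26 : x 26%N = y 26%N.
  apply: (mulfI char3).
  have -> : 3 * x 26%N = (x 24%N + x 26%N) + (- x 24%N + x 25%N + x 26%N) + (- x 25%N + x 26%N) by ring.
  by rewrite e0 e1 e2; ring.
have e24 : x 24%N = y 24%N by move: e0; rewrite e26 => /addIr.
have e25 : x 25%N = y 25%N by move: e2; rewrite e26 => /addIr/oppr_inj.
by do 27 (case: u u27 => [|u] u27 //).
Qed.

Lemma herm_surj X : hermitian X -> exists x, X = herm x.
Proof.
move=> hX.
pose c (i : 'I_3) := (X i i).1 0 0.
(* A third of the trace is the coordinate of the identity; coordinates 24 and 25 are then read off
   from the first and the last diagonal entry. *)
pose e := (c 0 + c 1 + c 2%:R) / 3.
pose off (i j : 'I_3) : seq K := [:: (X i j).1 0 0; (X i j).1 0 1; (X i j).1 1 0; (X i j).1 1 1;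
  (X i j).2 0 0; (X i j).2 0 1; (X i j).2 1 0; (X i j).2 1 1].
pose s := off 0 1 ++ off 1 2%:R ++ off 2%:R 0 ++ [:: c 0 - e; e - c 2%:R; e].
have Xd i : X i i = oct (c i) 0 0 (c i) 0 0 0 0.
  have := hX i i; rewrite [in RHS](octE (X i i)) oconj_oct {1}(octE (X i i)).
  have z (a : K) : a = - a -> a = 0.
    move=> /eqP; rewrite -subr_eq0 opprK -mulr2n -mulr_natl mulf_eq0 (negPf char2) => /eqP //.
  case/oct_inj=> -[e1 /z e2 /z e3 _] [/z e4 /z e5 /z e6 /z e7].
  by rewrite (octE (X i i)) e2 e3 e4 e5 e6 e7 -e1.
exists (nth 0 s); apply/matrixP => i j; rewrite mxE.
have e0 : (c 0 - e) + e = c 0 by rewrite subrK.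
have e1 : - (c 0 - e) + (e - c 2%:R) + e = c 1.
  by rewrite /e; field.
have e2 : - (e - c 2%:R) + e = c 2%:R by rewrite opprB subrK.
have i0 (p : (0 < 3)%N) : Ordinal p = 0 by apply: val_inj.
have i1 (p : (1 < 3)%N) : Ordinal p = 1 by apply: val_inj.
have i2 (p : (2 < 3)%N) : Ordinal p = 2%:R by apply: val_inj.
have opp k l : X l k = oct ((X k l).1 1 1) (- (X k l).1 0 1) (- (X k l).1 1 0) ((X k l).1 0 0)
    (- (X k l).2 0 0) (- (X k l).2 0 1) (- (X k l).2 1 0) (- (X k l).2 1 1).
  by rewrite hX [in LHS](octE (X k l)) oconj_oct.
case: i => [[|[|[|]]]] // p; case: j => [[|[|[|]]]] // q; rewrite ?i0 ?i1 ?i2 /entry /=.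
- by rewrite e0 Xd.
- exact: octE.
- exact: opp.
- exact: opp.
- by rewrite e1 Xd.
- exact: octE.
- exact: octE.
- exact: opp.
- by rewrite e2 Xd.
Qed.

Lemma h3tr_herm x : h3tr (herm x) = 3 * x 26%N.
Proof.
rewrite /h3tr !big_ord_recl big_ord0 !mxE /= /mxtrace !big_ord_recl !big_ord0 !mxE /=.
by field.
Qed.

Lemma eval_relE x y u : eval_rel x y (mul_rel u)
  = \sum_(i < 27) \sum_(j < 27) ofZ K (coef_at u (mulb i j)) * (x i * y j).
Proof.
have evE l : eval_rel x y l = \sum_(p <- l) ofZ K p.2 * (x p.1.1 * y p.1.2).
  by elim: l => [|p l IH]; rewrite ?big_nil // big_cons -IH.
rewrite evE big_filter big_mkcond big_allpairs_dep.
rewrite -(big_mkord xpredT (fun i => \sum_(j < 27) ofZ K (coef_at u (mulb i j)) * (x i * y j))).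
apply: eq_bigr => i _.
rewrite -(big_mkord xpredT (fun j => ofZ K (coef_at u (mulb i j)) * (x i * y j))).
apply: eq_bigr => j _ /=; case: Z.eqb_spec => //= ->.
by rewrite /ofZ /= mul0r.
Qed.

End HermitianCoordinates.

Section BasisOfIsomorphism.
Variables (K : fieldType) (n : nat) (L : 'I_n -> 'M[K]_n) (Q : 'M[K]_n) (e : 'rV[K]_n).
Variable phi : 'rV[K]_n -> 'M[octonion K]_3.
Hypothesis char2 : (2 : K) != 0.
Hypothesis char3 : (3 : K) != 0.
Hypothesis phi_lin : forall c (x y : 'rV[K]_n) i j, phi (c *: x + y) i j = c *: phi x i j + phi y i j.
Hypothesis phi_inj : injective phi.
Hypothesis phi_herm : forall X, hermitian X <-> exists x, phi x = X.
Hypothesis phi_mul : forall x y : 'rV[K]_n, phi (y *m lcomb L x) = h3mul (phi x) (phi y).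
Hypothesis phi_form : forall x y : 'rV[K]_n, (x *m Q *m y^T) 0 0 = h3form (phi x) (phi y).
Hypothesis unit_r : forall x, e *m lcomb L x = x.

Let char6 : (6 : K) != 0.
Proof. by rewrite (natrM _ 2 3) mulf_neq0. Qed.

Definition unitv (s u : nat) : K := (u == s)%:R.

Lemma phi0 i j : phi 0 i j = 0.
Proof. by have := phi_lin (-1) 0 0 i j; rewrite scaler0 addr0 scaleN1r addNr. Qed.

Lemma phi_sum I (r : seq I) (c : I -> K) (X : I -> 'rV[K]_n) i j :
  phi (\sum_(s <- r) c s *: X s) i j = \sum_(s <- r) c s *: phi (X s) i j.
Proof.
by elim: r => [|s r IH]; rewrite ?big_nil ?phi0 // !big_cons phi_lin IH.
Qed.

Lemma entry0 i j : entry (fun=> 0 : K) i j = 0.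
Proof.
have := entry_linear (-1) (fun=> 0 : K) (fun=> 0) i j.
by rewrite scaleN1r addNr => <-; apply: entry_ext => u _; rewrite mulr0 addr0.
Qed.

Lemma isomorphism_basis : exists b, standard_basis L Q e b.
Proof.
(* The basis consists of the preimages of the coordinate matrices of H_3. *)
have [bb bbP] : exists bb : 'I_27 -> 'rV[K]_n, forall s, phi (bb s) = herm (unitv s).
  apply: (fin_all_exists (P := fun (s : 'I_27) x => phi x = herm (unitv s))) => s.
  by apply/phi_herm; exact: herm_hermitian.
pose b s := oapp bb 0 (insub s).
have bE (s : 'I_27) : b s = bb s by rewrite /b valK.
have bout s : (27 <= s)%N -> b s = 0 by move=> s27; rewrite /b insubF // ltnNge s27.
have phib s : (s < 27)%N -> phi (b s) = herm (unitv s).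
  by move=> s27; rewrite (bE (Ordinal s27)) bbP.
have phiz (z : nat -> K) : phi (\sum_(s < 27) z s *: b s) = herm z.
  apply/matrixP => i j; rewrite phi_sum mxE.
  under eq_bigr => s _ do rewrite phib // mxE.
  rewrite -entry_sum; apply: entry_ext => u u27.
  rewrite (bigD1 (Ordinal u27)) //= /unitv eqxx mulr1 big1 ?addr0 // => s ne.
  by rewrite (_ : (u == s) = false) ?mulr0 //; apply: contraNF ne => /eqP us; apply/eqP/val_inj.
have span x : exists z : nat -> K, x = \sum_(s < 27) z s *: b s.
  have : hermitian (phi x) by apply/phi_herm; exists x.
  by case/(herm_surj char2 char3) => z h; exists z; apply: phi_inj; rewrite phiz.
have phir l : phi (realize b l) = herm (fun u => ofZ K (coef_at u l)).
  apply/matrixP => i j; rewrite phi_sum mxE; elim: l => [|[k a] l IH].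
    by rewrite big_nil entry0.
  rewrite big_cons IH /=.
  have [k27|k27] := ltnP k 27.
    rewrite phib // mxE -entry_linear; apply: entry_ext => u u27.
    rewrite /unitv eq_sym; case: (Nat.eqb_spec k u) => [->|/eqP/negPf ->].
      by rewrite eqxx mulr1 ofZD.
    by rewrite mulr0 add0r.
  rewrite bout // phi0 scaler0 add0r; apply: entry_ext => u u27.
  by case: Nat.eqb_spec => // ku; move: k27; rewrite ku leqNgt u27.
have sbmul s t : 6 *: (b t *m lcomb L (b s)) = realize b (mulb s t).
  have [/andP[s27 t27]|] := boolP ((s < 27) && (t < 27))%N; last first.
    rewrite negb_and -!leqNgt => out; rewrite mulb_out // realize_nil.
    case/orP: out => h; rewrite (bout _ h) ?mul0mx ?scaler0 //.
    by rewrite (linear0 (lcomb L)) mulmx0 scaler0.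
  apply: phi_inj; rewrite phir; apply/matrixP => i j.
  rewrite -[6 *: _]addr0 phi_lin phi0 addr0 phi_mul !phib // (herm_mul char2 char3) !mxE.
  have := entry_linear 6 (mul27 (unitv s) (unitv t)) (fun=> 0) i j.
  rewrite entry0 addr0 => <-; apply: entry_ext => u u27.
  rewrite addr0 /mul27 mulrA mulfV // mul1r eval_relE.
  rewrite (bigD1 (Ordinal s27)) //= (bigD1 (Ordinal t27)) //= /unitv !eqxx !mulr1.
  rewrite big1 => [|k ne]; last first.
    rewrite (_ : (val k == t) = false) ?mulr0 //.
    by apply: contraNF ne => /eqP kt; apply/eqP/val_inj.
  rewrite big1 ?addr0 // => k ne; apply: big1 => m _.
  rewrite (_ : (val k == s) = false) ?mul0r ?mulr0 //.
  by apply: contraNF ne => /eqP kt; apply/eqP/val_inj.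
exists b; split => //.
- rewrite -sub1mx; apply/row_subP => i; have [z ->] := span (row i 1%:M).
  apply/submxP; exists (\row_s z s); rewrite mulmx_sum_row; apply: eq_bigr => s _.
  by rewrite mxE rowK.
- apply: inj_row_free => v vB; apply/rowP => s; rewrite mxE.
  pose z (u : nat) := oapp (v 0) 0 (insub u).
  have zE (u : 'I_27) : z u = v 0 u by rewrite /z valK.
  rewrite -zE; apply: (herm_inj char3 (y := fun=> 0)) (ltn_ord s).
  rewrite -!phiz; congr phi; rewrite [RHS]big1 => [|u _]; last by rewrite scale0r.
  transitivity (v *m basis_mx b); last by [].
  by rewrite mulmx_sum_row; apply: eq_bigr => u _; rewrite rowK zE.
(* Nothing is assumed about the image of [e]; [b 26] is an identity for the product, as is [e], so
   the two coincide. *)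
- have Lb (x : 'rV[K]_n) : x *m lcomb L (b 26) = x.
    have [z ->] := span x; rewrite mulmx_suml; apply: eq_bigr => s _.
    rewrite -scalemxAl; congr (_ *: _); apply: (scalerI char6); rewrite sbmul.
    transitivity (realize b [:: (val s, 6 : Z)]); last first.
      by rewrite realize_cons realize_nil addr0.
    apply: vanishes1_eq.
    by have /and3P[_ _ /allP] := trace_gram_unit_ok; apply; rewrite mem_iota add0n ltn_ord.
  by rewrite -[b 26]unit_r Lb.
- move=> s t; have [/andP[s27 t27]|] := boolP ((s < 27) && (t < 27))%N; last first.
    rewrite negb_and -!leqNgt => out; rewrite mulb_out // [RHS]raddf0.
    by case/orP: out => h; rewrite (bout _ h) ?trmx0 ?mulmx0 ?mul0mx scaler0.
  apply/matrixP => i j; rewrite !ord1 mxE phi_form /h3form -phi_mul.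
  have -> : b t *m lcomb L (b s) = 6^-1 *: realize b (mulb s t).
    by rewrite -sbmul scalerA mulVf // scale1r.
  have -> : phi (6^-1 *: realize b (mulb s t))
      = herm (fun u => 6^-1 * ofZ K (coef_at u (mulb s t)) + 0).
    apply/matrixP => k l; rewrite -[_ *: _]addr0 phi_lin phi0 phir !mxE.
    have := entry_linear 6^-1 (fun u => ofZ K (coef_at u (mulb s t))) (fun=> 0) k l.
    by rewrite entry0.
  rewrite (h3tr_herm char2) mxE eqxx mulr1n addr0.
  by field; rewrite ?char6.
Qed.

End BasisOfIsomorphism.

(** * Coordinates of J *)

Section Coordinates.
Variables (k : fieldType) (J : vectType k).
Variables (mul : {bilinear J -> J -> J}) (form : {biscalar J}) (e : J).

Local Notation n := (\dim {:J}).
Local Notation E i := ((vbasis {:J})`_i).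

Definition Lk (i : 'I_n) : 'M[k]_n := \matrix_(j < n) coords (mul (E i) (E j)).
Definition Qk : 'M[k]_n := \matrix_(i, j) form (E i) (E j).
Definition ek : 'rV[k]_n := coords e.

Lemma coords_is_linear : linear (@coords k J).
Proof. by move=> a x y; apply/rowP => i; rewrite !mxE linearP. Qed.
HB.instance Definition _ := GRing.isLinear.Build k J 'rV[k]_n _ (@coords k J) coords_is_linear.

Lemma coords_sum I (r : seq I) (F : I -> J) :
  coords (\sum_(i <- r) F i) = \sum_(i <- r) coords (F i).
Proof. exact: linear_sum. Qed.

Lemma coordsZ a (x : J) : coords (a *: x) = a *: coords x.
Proof. exact: linearZ. Qed.

Lemma coordsE (x : J) : x = \sum_i coords x 0 i *: E i.
Proof.
rewrite {1}(coord_vbasis (memvf x)); apply: eq_bigr => i _; by rewrite mxE.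
Qed.

Lemma coords_basis (i : 'I_n) : coords (E i) = delta_mx 0 i.
Proof.
apply/rowP => j; rewrite !mxE eqxx /= coord_free ?(basis_free (vbasisP _)) //.
by rewrite eq_sym.
Qed.

Lemma coords_inj : injective (@coords k J).
Proof. by move=> x y xy; rewrite [x]coordsE [y]coordsE xy. Qed.

Lemma ext_mulE (R : comNzRingType) (f : {rmorphism k -> R}) x y :
  ext_mul f mul x y = y *m lcomb (fun i => map_mx f (Lk i)) x.
Proof.
rewrite /lcomb mulmx_sumr; apply: eq_bigr => i _.
rewrite -scalemxAr mulmx_sum_row scaler_sumr; apply: eq_bigr => j _.
by rewrite scalerA -map_row rowK.
Qed.

Lemma ext_formE (R : comNzRingType) (f : {rmorphism k -> R}) x y :
  ext_form f form x y = (x *m map_mx f Qk *m y^T) 0 0.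
Proof.
rewrite /ext_form mxE exchange_big; apply: eq_bigr => j _ /=; rewrite !mxE mulr_suml.
by apply: eq_bigr => i _; rewrite !mxE mulrAC.
Qed.

Lemma coords_mul x y : coords (mul x y) = coords y *m lcomb Lk (coords x).
Proof.
rewrite {1}(coordsE x) linear_sumlz linear_sum /lcomb mulmx_sumr; apply: eq_bigr => i _.
rewrite linearZl_LR linearZ /= -scalemxAr; congr (_ *: _).
rewrite {1}(coordsE y) !linear_sum mulmx_sum_row; apply: eq_bigr => j _.
by rewrite linearZ linearZ /= rowK.
Qed.

Lemma formE x y : form x y = (coords x *m Qk *m (coords y)^T) 0 0.
Proof.
rewrite mxE {1}(coordsE y) linear_sum; apply: eq_bigr => j _.
rewrite linearZ /= !mxE mulrC; congr (_ * _).
rewrite {1}(coordsE x) linear_sumlz; apply: eq_bigr => i _.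
by rewrite linearZl_LR /= !mxE.
Qed.

Lemma aut_pointsP (R : comNzRingType) (f : {rmorphism k -> R}) g :
  aut_points f mul g <-> is_aut (fun i => map_mx f (Lk i)) g.
Proof.
split=> -[inv h]; split=> //.
  move=> i; apply/row_matrixP => j; have := h (delta_mx 0 i) (delta_mx 0 j).
  by rewrite !ext_mulE lcomb_delta -!rowE !row_mul => ->.
by move=> x y; rewrite !ext_mulE -!mulmxA (aut_lcomb (conj inv h)).
Qed.

End Coordinates.

Section ProductFormulas.
Variables (k : fieldType) (J : vectType k).
Variables (mul : {bilinear J -> J -> J}) (form : {biscalar J}) (e : J).

Local Notation n := (\dim {:J}).
Local Notation E i := ((vbasis {:J})`_i).
Local Notation L := (Lk mul).
Local Notation Q := (Qk form).
Local Notation Q' := (invmx Q).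
Local Notation u := (ek e).
Local Notation t := (3^-1 : k).
Local Notation P := (traceless_proj Q u t).

Variable c : k.
Hypothesis alb : albert_axioms L Q Q' u c.
Hypothesis char2 : (2 : k) != 0.
Hypothesis char3 : (3 : k) != 0.
Hypothesis unit_form : u *m (Q *m u^T) = 3%:M.

Lemma sympE (a b : J) :
  symp a b = 2^-1 *: ((coords a)^T *m coords b + ((coords a)^T *m coords b)^T).
Proof. by rewrite trmx_mul trmxK. Qed.

Lemma coords_projW x : coords (projW form e x) = coords x *m P.
Proof.
rewrite /projW linearB linearZ /= formE /traceless_proj mulmxBr mulmx1.
congr (_ - _); rewrite -scalemxAr !mulmxA -scalerA; congr (_ *: _).
by rewrite [X in _ = X *m _](mx11_scalar _) mul_scalar_mx.
Qed.

Lemma coords_mulW (i j : 'I_n) :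
  coords (mulW mul form e (E i) (E j)) = row j (lmulT L Q u t i).
Proof.
by rewrite coords_projW coords_mul !coords_basis lcomb_delta -rowE -row_mul.
Qed.

Lemma inW_coords x : inW form e x <-> coords x *m (Q *m u^T) = 0.
Proof.
rewrite /inW formE -mulmxA; split=> [h|->]; last by rewrite mxE.
by rewrite [LHS]mx11_scalar h raddf0.
Qed.

Lemma proj_orth (x : 'rV[k]_n) : x *m P *m (Q *m u^T) = 0.
Proof.
rewrite -mulmxA /traceless_proj mulmxBl mul1mx -scalemxAl -!mulmxA unit_form.
by rewrite mul_mx_scalar -scalemxAr scalerA mulVf // scale1r subrr mulmx0.
Qed.

Lemma lcombC (x y : 'rV[k]_n) : y *m lcomb L x = x *m lcomb L y.
Proof.
rewrite /lcomb !mulmx_sumr.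
under eq_bigr => i _ do rewrite -scalemxAr mulmx_sum_row scaler_sumr.
under [RHS]eq_bigr => i _ do rewrite -scalemxAr mulmx_sum_row scaler_sumr.
rewrite exchange_big; apply: eq_bigr => j _; apply: eq_bigr => i _ /=.
by rewrite (mulC alb) !scalerA mulrC.
Qed.

(** Conversely, a matrix satisfying the constraints is unchanged by projecting both of its tensor
    factors, so it is a sum of products of traceless vectors with the entries of A as
    coefficients. *)
Lemma inV'P A : inV' mul form e A <-> constraints L Q u A = 0.
Proof.
split.
  case=> m [X] [Y] [XYW [sum0 ->]]; apply/constraintsP.
  have sy X0 Y0 : (symp X0 Y0)^T = symp X0 Y0 :> 'M[k]_n.
    by rewrite sympE [LHS]linearZ /= linearD /= trmxK addrC.
  split.
  - by rewrite raddf_sum; apply: eq_bigr => i _; exact: sy.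
  - rewrite mulmx_suml big1 // => i _; have [/inW_coords hX /inW_coords hY] := XYW i.
    by rewrite sympE trmx_mul trmxK -scalemxAl mulmxDl -!mulmxA hX hY !mulmx0 addr0 scaler0.
  - rewrite linear_sum /= -[RHS](linear0 (@coords k J)) -sum0 linear_sum.
    apply: eq_bigr => i _; rewrite sympE trmx_mul trmxK linearZ /= linearD /= !contract_outer.
    by rewrite (lcombC (coords (Y i))) -coords_mul -mulr2n -scaler_nat scalerA mulVf // scale1r.
case/constraintsP => sA wA tA.
(* The traceless part of the basis vector [E i]. *)
pose W i := \sum_j P i j *: E j.
have cW i : coords (W i) = row i P.
  rewrite linear_sum [RHS]row_sum_delta; apply: eq_bigr => j _.
  by rewrite linearZ /= coords_basis [in RHS]mxE.
have AE : A = \sum_i \sum_j A i j *: ((coords (W i))^T *m coords (W j)).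
  rewrite -{1}(inV_proj (Q := Q) (e := u) sA wA) mulmx_quadratic.
  by apply: eq_bigr => i _; apply: eq_bigr => j _; rewrite !cW.
(* [inV'] asks for a family indexed by an ordinal, so pairs of indices are enumerated. *)
pose I : finType := ('I_n * 'I_n)%type.
exists #|I|, (fun s => A (enum_val s).1 (enum_val s).2 *: W (enum_val s).1),
  (fun s => W (enum_val s).2); split => [s|].
  have WW i : inW form e (W i) by apply/inW_coords; rewrite cW rowE proj_orth.
  split=> //; move/inW_coords: (WW (enum_val s).1) => h; apply/inW_coords.
  by rewrite linearZ /= -scalemxAl h scaler0.
have sumI (V : nmodType) (F : 'I_n -> 'I_n -> V) :
    \sum_(s < #|I|) F (enum_val s).1 (enum_val s).2 = \sum_i \sum_j F i j.
  by rewrite pair_big /= [RHS](reindex (@enum_val I I)) //; apply: onW_bij; exact: enum_val_bij.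
split.
  apply: coords_inj; rewrite linear0 linear_sum /=.
  transitivity (contract L A); last by []; rewrite {2}AE.
  rewrite (sumI _ (fun i j => coords (mul (A i j *: W i) (W j)))) linear_sum.
  apply: eq_bigr => i _; rewrite linear_sum; apply: eq_bigr => j _.
  by rewrite linearZl_LR !linearZ /= contract_outer coords_mul.
rewrite (sumI _ (fun i j => symp (A i j *: W i) (W j))).
have AT : A^T = \sum_i \sum_j A i j *: ((coords (W i))^T *m coords (W j))^T.
  rewrite {1}AE raddf_sum; apply: eq_bigr => i _; rewrite raddf_sum; apply: eq_bigr => j _.
  by rewrite /= linearZ.
transitivity (2^-1 *: (A + A^T)).
  by rewrite sA -mulr2n -scaler_nat scalerA mulVf // scale1r.
rewrite AT {1}AE -big_split scaler_sumr; apply: eq_bigr => i _ /=.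
rewrite -big_split scaler_sumr; apply: eq_bigr => j _ /=.
have h : (coords (A i j *: W i))^T *m coords (W j)
    = A i j *: ((coords (W i))^T *m coords (W j)).
  by rewrite linearZ /= [(_ *: coords _)^T]linearZ /= -scalemxAl.
by rewrite [RHS]sympE h [(A i j *: _)^T]linearZ.
Qed.

Lemma lfun_id_of (aT rT : vectType k) (f : aT -> rT) : linear f -> forall x, linfun f x = f x.
Proof.
move=> f_lin x; pose g : {linear aT -> rT} := HB.pack f (GRing.isLinear.Build k aT rT _ f f_lin).
exact: (lfunE g).
Qed.

Lemma sym_opE A x : coords (sym_op form A x) = coords x *m Q *m A^T.
Proof.
have lin : linear (fun x => \sum_i \sum_j (A i j * form (E j) x) *: E i).
  move=> a y z; rewrite scaler_sumr -big_split; apply: eq_bigr => i _ /=.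
  rewrite scaler_sumr -big_split; apply: eq_bigr => j _ /=.
  by rewrite linearP /= mulrDr scalerDl scalerA mulrCA.
rewrite /sym_op lfun_id_of // coords_sum.
apply/rowP => l; rewrite summxE (bigD1 l) //= [X in _ + X]big1 ?addr0 => [|i ne]; last first.
    rewrite coords_sum summxE big1 // => j _.
  by rewrite coordsZ coords_basis !mxE eq_sym (negPf ne) andbF mulr0.
rewrite coords_sum summxE mxE; apply: eq_bigr => j _.
rewrite coordsZ coords_basis !mxE !eqxx mulr1 mulrC; congr (_ * _).
rewrite formE coords_basis -mulmxA -rowE mxE (_ : Q *m _ = ((coords x) *m Q)^T) ?mxE //.
by rewrite trmx_mul (gram_sym alb).
Qed.

(** As [idW] is defined through an inverse linear map, it suffices that [sym_op] is injective, by
    nondegeneracy, and that it sends [idT] to the projection. The operator of A is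
    [x |-> x *m Q *m A^T], so [Q'] stands for the identity of J. *)
Lemma idWE : idW form e = idT Q' u t.
Proof.
have Q'Q : Q' *m Q = 1%:M by apply: mulmx1C (gram_inv alb).
have lin : linear (sym_op form).
  move=> a A B; apply/lfunP => x; rewrite add_lfunE scale_lfunE.
  apply: coords_inj; rewrite linearD linearZ /= !sym_opE linearD linearZ /=.
  by rewrite mulmxDr scalemxAr.
have opE A : linfun (sym_op form) A = sym_op form A by rewrite lfun_id_of.
have inj : lker (linfun (sym_op form)) == 0%VS.
  apply/lker0P => A B; rewrite !opE => AB.
  apply: trmx_inj; rewrite -[A^T]mul1mx -[B^T]mul1mx -Q'Q -!mulmxA; congr (_ *m _).
  apply/row_matrixP => i; rewrite !row_mul !rowE -(coords_basis i).
  by rewrite -!sym_opE AB.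
rewrite /idW -[RHS](lker0_lfunK inj) opE; congr (_ _).
apply/lfunP => x; apply: coords_inj; rewrite sym_opE lfun_id_of; last first.
  move=> a y z; apply: coords_inj; rewrite linearP /= !coords_projW linearP /= mulmxDl.
  by rewrite scalemxAl.
rewrite coords_projW (trmx_idT alb) -mulmxA; congr (_ *m _).
by rewrite /idT mulmxBr (gram_inv alb) -scalemxAr mulmxA.
Qed.

End ProductFormulas.

(** * The products of the theorem as members of the family [prodmx] *)

Section Odot.
Variables (k : fieldType) (J : vectType k).
Variables (mul : {bilinear J -> J -> J}) (form : {biscalar J}) (e : J).

Local Notation n := (\dim {:J}).
Local Notation E i := ((vbasis {:J})`_i).
Local Notation L := (Lk mul).
Local Notation Q := (Qk form).
Local Notation Q' := (invmx Q).
Local Notation u := (ek e).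
Local Notation t := (3^-1 : k).

Implicit Types (q : J -> J -> J -> J -> 'M[k]_n) (A B X : 'M[k]_n).

Lemma sym_prodD q q' A B : sym_prod (fun a b c d => q a b c d + q' a b c d) A B
  = sym_prod q A B + sym_prod q' A B.
Proof.
rewrite /sym_prod -big_split; apply: eq_bigr => i _; rewrite -big_split.
apply: eq_bigr => j _; rewrite -big_split; apply: eq_bigr => r _.
by rewrite -big_split; apply: eq_bigr => s _; rewrite scalerDr.
Qed.

Lemma sym_prodZ x q A B : sym_prod (fun a b c d => x *: q a b c d) A B = x *: sym_prod q A B.
Proof.
rewrite /sym_prod scaler_sumr; apply: eq_bigr => i _; rewrite scaler_sumr.
apply: eq_bigr => j _; rewrite scaler_sumr; apply: eq_bigr => r _.
by rewrite scaler_sumr; apply: eq_bigr => s _; rewrite !scalerA mulrC.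
Qed.

Lemma sym_prodB q q' A B : sym_prod (fun a b c d => q a b c d - q' a b c d) A B
  = sym_prod q A B - sym_prod q' A B.
Proof.
rewrite -[X in _ - X]scale1r -scaleNr -sym_prodZ -sym_prodD.
by apply: eq_bigr => i _; apply: eq_bigr => j _; apply: eq_bigr => r _;
   apply: eq_bigr => s _; rewrite scaleN1r.
Qed.

Lemma sym_prod_swap_l q A B : A^T = A ->
  sym_prod q A B = sym_prod (fun a b c d => q b a c d) A B.
Proof.
move=> sA; rewrite /sym_prod exchange_big; apply: eq_bigr => i _; apply: eq_bigr => j _.
apply: eq_bigr => r _; apply: eq_bigr => s _; congr ((_ * _) *: _).
by rewrite -{1}sA mxE.
Qed.

Lemma sym_prod_swap_r q A B : B^T = B ->
  sym_prod q A B = sym_prod (fun a b c d => q a b d c) A B.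
Proof.
move=> sB; apply: eq_bigr => i _; apply: eq_bigr => j _.
rewrite exchange_big; apply: eq_bigr => r _; apply: eq_bigr => s _; congr ((_ * _) *: _).
by rewrite -{1}sB mxE.
Qed.

Lemma sym_prodPl q x A A' B : sym_prod q (x *: A + A') B = x *: sym_prod q A B + sym_prod q A' B.
Proof.
rewrite /sym_prod scaler_sumr -big_split; apply: eq_bigr => i _; rewrite scaler_sumr -big_split.
apply: eq_bigr => j _; rewrite scaler_sumr -big_split; apply: eq_bigr => r _.
rewrite scaler_sumr -big_split; apply: eq_bigr => s _ /=.
by rewrite !mxE mulrDl scalerDl scalerA mulrA.
Qed.

Lemma delta_outer (i j : 'I_n) : (delta_mx 0 i : 'rV[k]_n)^T *m delta_mx 0 j = delta_mx i j.
Proof. by rewrite trmx_delta mul_delta_mx. Qed.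

(** Pairing the first slots of A and B by the form gives A^T Q B, and the symmetry of A removes the
    transpose. *)
Lemma sym_prod_form (h : 'M[k]_n -> 'M[k]_n) A B : linear h -> A^T = A ->
  sym_prod (fun a b c d => form a c *: h ((coords b)^T *m coords d)) A B = h (A *m Q *m B).
Proof.
move=> h_lin sA; pose g : {linear 'M[k]_n -> 'M[k]_n} := HB.pack h (GRing.isLinear.Build k _ _ _ h h_lin).
have -> : h (A *m Q *m B) = \sum_j \sum_s (A *m Q *m B) j s *: h (delta_mx j s).
  rewrite -[h _]/(g _) [in LHS](matrix_sum_delta (A *m Q *m B)) linear_sum.
  by apply: eq_bigr => j _; rewrite linear_sum; apply: eq_bigr => s _; rewrite linearZ.
rewrite /sym_prod exchange_big; apply: eq_bigr => j _ /=.
under eq_bigr => i _ do rewrite exchange_big.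
rewrite exchange_big; apply: eq_bigr => s _ /=.
rewrite mxE scaler_suml exchange_big; apply: eq_bigr => r _ /=.
rewrite mxE mulr_suml scaler_suml; apply: eq_bigr => i _.
rewrite !coords_basis delta_outer scalerA; congr (_ *: _).
by rewrite -[in RHS]sA !mxE mulrAC.
Qed.

Lemma trace_delta (i j : 'I_n) (X : 'M[k]_n) : \tr (delta_mx i j *m X) = X j i.
Proof.
rewrite -(@mul_delta_mx _ n 1 n 0 i j) -mulmxA mxtrace_mulC -rowE -colE trace_mx11.
by rewrite !mxE.
Qed.

Lemma sym_prod_form2 X A B : A^T = A ->
  sym_prod (fun a b c d => (form a c * form b d) *: X) A B = (\tr (A *m Q *m B *m Q^T)) *: X.
Proof.
(* The second pairing is the linear functional [\tr (Y *m Q^T)] of the remaining tensor, which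
   reduces to [sym_prod_form]. *)
move=> sA; pose h (Y : 'M[k]_n) := \tr (Y *m Q^T) *: X.
have h_lin : linear h.
  by move=> a Y Z; rewrite /h mulmxDl -scalemxAl mxtraceD mxtraceZ scalerDl scalerA.
rewrite -[RHS]/(h (A *m Q *m B)) -sym_prod_form //.
apply: eq_bigr => i _; apply: eq_bigr => j _; apply: eq_bigr => r _; apply: eq_bigr => s _.
congr (_ *: _); rewrite /h scalerA; congr (_ * _ *: _).
by rewrite !coords_basis delta_outer trace_delta !mxE.
Qed.

Variable c : k.
Hypothesis alb : albert_axioms L Q Q' u c.
Hypothesis char2 : (2 : k) != 0.
Hypothesis char3 : (3 : k) != 0.
Hypothesis unit_form : u *m (Q *m u^T) = 3%:M.

Definition symm (X : 'M[k]_n) : 'M[k]_n := 2^-1 *: (X + X^T).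

Lemma symm_is_linear : linear symm.
Proof.
move=> a X Y; rewrite /symm [(_ + _)^T]linearP /= addrACA scalerDr; congr (_ + _).
by rewrite -(scalerDr a X) !scalerA mulrC.
Qed.
Let g : {linear 'M[k]_n -> 'M[k]_n} :=
  HB.pack symm (GRing.isLinear.Build k _ _ _ symm symm_is_linear).

Lemma symp_symm (a b : J) : symp a b = symm ((coords a)^T *m coords b).
Proof. exact: sympE. Qed.

Lemma symm_id X : X^T = X -> symm X = X.
Proof. by move=> sX; rewrite /symm sX -mulr2n -scaler_nat scalerA mulVf // scale1r. Qed.

Lemma starE A B : A^T = A -> B^T = B -> star mul form e A B = starmx L Q u t A B.
Proof.
(* Exchanging c and d, which is allowed as B is symmetric, identifies the two terms. *)
move=> sA sB; rewrite /star sym_prodD [X in _ + X]sym_prod_swap_r // -mulr2n.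
pose N := lmulT L Q u t.
have -> : sym_prod (fun a b c d => symp (mulW mul form e a c) (mulW mul form e b d)) A B
    = symm (2^-1 *: starmx L Q u t A B).
  have -> : 2^-1 *: starmx L Q u t A B = \sum_i \sum_j A i j *: ((N i)^T *m B *m N j).
    by rewrite /starmx scalerA mulVf // scale1r.
  have gsum (I : Type) (r : seq I) (F : I -> 'M[k]_n) : symm (\sum_(i <- r) F i) = \sum_(i <- r) symm (F i).
    exact: (linear_sum g).
  have gZ a X : symm (a *: X) = a *: symm X by rewrite -[LHS]/(g _) linearZ.
  rewrite gsum; apply: eq_bigr => i _; rewrite gsum; apply: eq_bigr => j _.
  rewrite gZ mulmx_quadratic gsum scaler_sumr; apply: eq_bigr => r _.
  rewrite gsum scaler_sumr; apply: eq_bigr => s _.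
  by rewrite gZ symp_symm !coords_mulW scalerA.
rewrite -scaler_nat symm_id; first by rewrite [LHS]scalerA mulfV // [LHS]scale1r.
by rewrite [LHS]linearZ /= trmx_star sA sB.
Qed.

(** The symmetry of A and B makes the four sums equal, and [anticomm] is twice the symmetrization of
    A Q B: four halves give the 2. *)
Lemma sym_prod_four (h : 'M[k]_n -> 'M[k]_n) A B : linear h -> A^T = A -> B^T = B ->
  sym_prod (fun a b c d => form a c *: h (symp b d) + form a d *: h (symp b c)
             + form b c *: h (symp a d) + form b d *: h (symp a c)) A B
  = 2 *: h (anticomm Q A B).
Proof.
move=> h_lin sA sB; pose hs X := h (symm X).
have hs_lin : linear hs by move=> a X Y; rewrite /hs symm_is_linear h_lin.
have base : sym_prod (fun a b c d => form a c *: h (symp b d)) A B = h (symm (A *m Q *m B)).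
  rewrite -[RHS]/(hs _) -sym_prod_form //.
  apply: eq_bigr => i _; apply: eq_bigr => j _; apply: eq_bigr => r _; apply: eq_bigr => s _.
  by rewrite symp_symm.
rewrite !sym_prodD [X in _ + X + _]sym_prod_swap_l // [X in _ + X + _ + _]sym_prod_swap_r //.
rewrite [X in _ + X]sym_prod_swap_l // [X in _ + X]sym_prod_swap_r // base.
pose hl : {linear 'M[k]_n -> 'M[k]_n} := HB.pack h (GRing.isLinear.Build k _ _ _ h h_lin).
have -> : anticomm Q A B = 2 *: symm (A *m Q *m B).
  rewrite /symm scalerA mulfV // scale1r /anticomm; congr (_ + _).
  by rewrite !trmx_mul sA sB (gram_sym alb) mulmxA.
rewrite -[h (2 *: _)]/(hl _) linearZ /= scalerA -mulr2n -addrA -mulr2n -mulrnDr addnn.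
rewrite -scaler_nat; congr (_ *: _); exact: (natrM _ 2 2).
Qed.

Lemma sym_prod_trace X A B : A^T = A -> B^T = B ->
  sym_prod (fun a b c d => (form a c * form b d + form a d * form b c) *: X) A B
  = (2 * \tr (A *m Q *m B *m Q)) *: X.
Proof.
move=> sA sB; rewrite -{2}(gram_sym alb) mulr_natl mulr2n scalerDl -{1}sym_prod_form2 //.
rewrite -sym_prod_form2 // [X in _ = _ + X]sym_prod_swap_r // -sym_prodD.
apply: eq_bigr => i _; apply: eq_bigr => j _; apply: eq_bigr => r _; apply: eq_bigr => s _.
by rewrite scalerDl.
Qed.

Lemma odot1E A B : A^T = A -> B^T = B ->
  odot1 mul form e A B = prodmx L Q Q' u t (coefs1 k) A B.
Proof.
move=> sA sB; rewrite /odot1 sym_prodB sym_prodD !sym_prodZ.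
rewrite (sym_prod_four (h := id)) // sym_prod_trace // -/(star mul form e A B) starE // (idWE alb).
rewrite /prodmx /coefs1 scale0r addr0 !scalerA; congr (_ *: _ + _ + _).
  by rewrite (natrM _ 2 3 : 6 = _) invfM mulrAC mulVf // mul1r.
rewrite -scaleNr -(natrM _ 3 26) mulrA (mulrAC 2) -(natrM _ 2 2); congr (_ *: _).
by rewrite mulNr.
Qed.

Lemma odot2E A B : A^T = A -> B^T = B ->
  odot2 mul form e A B = prodmx L Q Q' u t (coefs2 k) A B.
Proof.
move=> sA sB; pose I := idT Q' u t.
have sI : I^T = I by exact: (trmx_idT alb).
rewrite /odot2 sym_prodB !sym_prodZ.
rewrite (sym_prod_four (h := fun X => star mul form e X (idW form e) + 2 *: X)) //; last first.
  move=> a X Y; rewrite /star sym_prodPl !scalerDr addrACA; congr (_ + _).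
  by rewrite !scalerA mulrC.
rewrite sym_prod_trace // (idWE alb) starE //; last
  by rewrite /anticomm [LHS]linearD /= !trmx_mul sA sB (gram_sym alb) !mulmxA addrC.
rewrite /prodmx /coefs2 scale0r addr0 scale1r scalerA mulVf // scale1r.
rewrite [X in X - _]addrC scalerA -scaleNr -(natrM _ 3 26) mulrA (mulrAC 20) -(natrM _ 20 2).
by rewrite mulNr.
Qed.

End Odot.

(** * Descent and scalar extension *)

Section Extension.
Variables (k : fieldType) (n : nat) (L : 'I_n -> 'M[k]_n) (Q : 'M[k]_n) (e : 'rV[k]_n).
Implicit Types (p : 'M[k]_n -> 'M[k]_n -> 'M[k]_n) (s r : 'I_n * 'I_n).

Let C := lin_mx (constraints L Q e).

(** The matrix [1 - C C^+], with C^+ = [pinvmx C], projects onto the kernel of [constraints]. The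
    images of the matrix units span V' over k without a choice of basis; they are not free. *)
Definition gen s : 'M[k]_n :=
  vec_mx (mxvec (delta_mx s.1 s.2) *m (1%:M - C *m pinvmx C)).

Lemma gen_constraints s : constraints L Q e (gen s) = 0.
Proof.
apply: (can_inj mxvecK); rewrite linear0 -(mul_vec_lin (constraints L Q e)) vec_mxK -mulmxA.
by rewrite mulmxBl mul1mx mulmxKpV // subrr mulmx0.
Qed.

Lemma matrix_sum_pairs (R : pzRingType) (A : 'M[R]_n) :
  A = \sum_(s : 'I_n * 'I_n) A s.1 s.2 *: delta_mx s.1 s.2.
Proof. by rewrite -(pair_bigA _ (fun i j => A i j *: delta_mx i j)) -matrix_sum_delta. Qed.

Section Points.
Variables (R : comNzRingType) (f : {rmorphism k -> R}).
Local Notation "A ^f" := (map_mx f A).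
Local Notation inV A := (constraints (fun i => (L i)^f) Q^f e^f A = 0).

(* [delta - gen s] is a linear function of [constraints delta]; extending scalars, the
   corrections add up to the same function of [constraints A]. *)
Lemma inV_span (A : 'M[R]_n) : inV A -> A = \sum_s A s.1 s.2 *: (gen s)^f.
Proof.
move=> VA; pose G Y := vec_mx (mxvec Y *m pinvmx C) : 'M[k]_n.
have GE Y : G Y = \sum_i \sum_j Y i j *: G (delta_mx i j).
  rewrite /G {1}(matrix_sum_delta Y) linear_sum mulmx_suml linear_sum; apply: eq_bigr => i _.
  rewrite linear_sum mulmx_suml linear_sum; apply: eq_bigr => j _.
  by rewrite /= linearZ /= -scalemxAl linearZ.
have dE s : delta_mx s.1 s.2 = gen s + G (constraints L Q e (delta_mx s.1 s.2)).
  rewrite /gen /G -(mul_vec_lin (constraints L Q e)) -linearD /= -mulmxA -mulmxDr subrK mulmx1.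
  by rewrite mxvecK.
have mapE (M : 'M[k]_(n + n, 1 + n)) i j : f (M i j) = M^f i j by rewrite mxE.
rewrite {1}(matrix_sum_pairs A).
under eq_bigr => s _ do rewrite -(map_delta_mx f) dE map_mxD scalerDr.
rewrite big_split /= [X in _ + X](_ : _ = 0) ?addr0 //.
under eq_bigr => s _ do rewrite GE map_mx_sum scaler_sumr.
rewrite exchange_big big1 //= => i _.
under eq_bigr => s _ do rewrite map_mx_sum scaler_sumr.
rewrite exchange_big big1 //= => j _.
under eq_bigr => s _ do rewrite map_mxZ scalerA mapE map_constraints map_delta_mx.
rewrite -scaler_suml; set x := \sum_s _.
have -> : x = (constraints (fun i => (L i)^f) Q^f e^f A) i j.
  rewrite {1}(matrix_sum_pairs A) linear_sum summxE; apply: eq_bigr => s _.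
  by rewrite [X in _ = fun_of_matrix X i j]linearZ [RHS]mxE.
by rewrite VA mxE scale0r.
Qed.

(** A function to compute with in place of the relation [ext_prod_graph]. Taking the entries of A
    and B as coefficients of the generators makes it bilinear on all matrices. *)
Definition ext_prod p (A B : 'M[R]_n) : 'M[R]_n :=
  \sum_s \sum_r (A s.1 s.2 * B r.1 r.2) *: (p (gen s) (gen r))^f.

Lemma ext_prodP p a (A A' B : 'M[R]_n) :
  ext_prod p (a *: A + A') B = a *: ext_prod p A B + ext_prod p A' B.
Proof.
rewrite /ext_prod scaler_sumr -big_split; apply: eq_bigr => s _ /=.
rewrite scaler_sumr -big_split; apply: eq_bigr => r _ /=.
by rewrite !mxE mulrDl scalerDl scalerA mulrA.
Qed.

Lemma ext_prodPr p a (A B B' : 'M[R]_n) :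
  ext_prod p A (a *: B + B') = a *: ext_prod p A B + ext_prod p A B'.
Proof.
rewrite /ext_prod scaler_sumr -big_split; apply: eq_bigr => s _ /=.
rewrite scaler_sumr -big_split; apply: eq_bigr => r _ /=.
by rewrite !mxE mulrDr scalerDl scalerA mulrCA.
Qed.

Lemma ext_prod_sum p I (u : seq I) (a : I -> R) X J (v : seq J) (b : J -> R) Y :
  ext_prod p (\sum_(i <- u) a i *: X i) (\sum_(j <- v) b j *: Y j)
  = \sum_(i <- u) \sum_(j <- v) (a i * b j) *: ext_prod p (X i) (Y j).
Proof.
have z0l Z : ext_prod p 0 Z = 0.
  by have := ext_prodP p (-1) 0 0 Z; rewrite scaler0 addr0 scaleN1r addNr.
have z0r Z : ext_prod p Z 0 = 0.
  by have := ext_prodPr p (-1) Z 0 0; rewrite scaler0 addr0 scaleN1r addNr.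
elim: u => [|i u IH]; first by rewrite !big_nil z0l.
rewrite !big_cons ext_prodP IH; congr (_ + _).
elim: v {IH} => [|j v IH]; first by rewrite !big_nil z0r scaler0.
by rewrite !big_cons ext_prodPr scalerDr scalerA IH.
Qed.

End Points.

Variable p : 'M[k]_n -> 'M[k]_n -> 'M[k]_n.
Local Notation inV A := (constraints L Q e A = 0).
Hypothesis p_l : forall a A A' B, inV A -> inV A' -> inV B ->
  p (a *: A + A') B = a *: p A B + p A' B.
Hypothesis p_r : forall a A B B', inV A -> inV B -> inV B' ->
  p A (a *: B + B') = a *: p A B + p A B'.

Lemma inV_span_base A : inV A -> A = \sum_s A s.1 s.2 *: gen s.
Proof.
have idE m q (X : 'M[k]_(m, q)) : map_mx idfun X = X by apply/matrixP => i j; rewrite mxE.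
move=> VA; have := @inV_span k idfun A; rewrite -{1}[A]idE -map_constraints idE => /(_ VA).
by move=> {1}->; apply: eq_bigr => s _; rewrite idE.
Qed.

Lemma prod_gen A B : inV A -> inV B ->
  p A B = \sum_s \sum_r (A s.1 s.2 * B r.1 r.2) *: p (gen s) (gen r).
Proof.
have V0 : inV (0 : 'M[k]_n) by rewrite linear0.
have VD a X Y : inV X -> inV Y -> inV (a *: X + Y).
  by move=> VX VY; rewrite linearP /= VX VY scaler0 addr0.
have z0l Z : inV Z -> p 0 Z = 0.
  by move=> VZ; have := p_l (-1) V0 V0 VZ; rewrite scaler0 addr0 scaleN1r addNr.
have z0r Z : inV Z -> p Z 0 = 0.
  by move=> VZ; have := p_r (-1) VZ V0 V0; rewrite scaler0 addr0 scaleN1r addNr.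
(* The function p is arbitrary off V', so its linearity applies only to partial sums known to lie in
   V'. *)
have Vsum (u : seq ('I_n * 'I_n)) (a : _ -> k) : inV (\sum_(s <- u) a s *: gen s).
  by elim: u => [|s u IH]; rewrite ?big_nil // big_cons VD // gen_constraints.
move=> VA VB; rewrite {1}(inV_span_base VA) {1}(inV_span_base VB).
move: (index_enum _) {1 3}(index_enum _) => v u.
elim: u => [|s u IH]; first by rewrite !big_nil z0l.
rewrite !big_cons p_l ?gen_constraints // IH; congr (_ + _).
elim: v {IH} => [|r v IH]; first by rewrite !big_nil z0r ?scaler0 ?gen_constraints.
by rewrite !big_cons p_r ?gen_constraints // scalerDr scalerA IH.
Qed.

Lemma ext_prod_map (R : comNzRingType) (f : {rmorphism k -> R}) A B : inV A -> inV B ->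
  ext_prod f p (map_mx f A) (map_mx f B) = map_mx f (p A B).
Proof.
move=> VA VB; rewrite (prod_gen VA VB) map_mx_sum; apply: eq_bigr => s _.
rewrite map_mx_sum; apply: eq_bigr => r _.
by rewrite map_mxZ rmorphM !mxE.
Qed.

End Extension.

(* A linear system over k that is solvable over K is solvable over k. *)
Lemma span_descent (k K : fieldType) (f : {rmorphism k -> K}) (T : finType) (x y z : T -> k)
    (alpha beta : K) :
  (forall s, f (x s) = alpha * f (y s) + beta * f (z s)) ->
  exists a b, forall s, x s = a * y s + b * z s.
Proof.
move=> xyz; pose vec (v : T -> k) : 'rV[k]_#|T| := \row_i v (enum_val i).
have : (map_mx f (vec x) <= map_mx f (col_mx (vec y) (vec z)))%MS.
  apply/submxP; exists (row_mx alpha%:M beta%:M).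
  rewrite map_col_mx mul_row_col !mul_scalar_mx; apply/rowP => i.
  by rewrite !mxE xyz.
rewrite map_submx => /submxP[d dP]; exists (d 0 (lshift 1 0)), (d 0 (rshift 1 0)) => s.
move: dP; rewrite -{1}[d]hsubmxK mul_row_col [lsubmx d]mx11_scalar [rsubmx d]mx11_scalar.
by rewrite !mul_scalar_mx => /rowP/(_ (enum_rank s)); rewrite !mxE !enum_rankK.
Qed.

(** * Commutativity and linearity in the coefficients of the family [prodmx] *)

Section ProductSymmetry.
Variables (R : comNzRingType) (n : nat) (L : 'I_n -> 'M[R]_n) (Q Q' : 'M[R]_n) (e : 'rV[R]_n).
Variables (c t : R).
Implicit Types A B : 'M[R]_n.

Lemma eq_constraints N A : L =1 N -> constraints L Q e A = constraints N Q e A.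
Proof.
move=> LN; rewrite /constraints; congr block_mx; apply/row_matrixP => i; rewrite !rowK.
by apply: eq_bigr => j _; rewrite LN.
Qed.

Lemma eq_is_aut N g : L =1 N -> is_aut L g -> is_aut N g.
Proof. by move=> LN [inv h]; split=> // i; rewrite -!LN -(eq_lcomb _ LN). Qed.

Lemma prodmx_linear a b d1 d2 d3 d4 d1' d2' d3' d4' A B :
  prodmx L Q Q' e t (a * d1 + b * d1', a * d2 + b * d2', a * d3 + b * d3', a * d4 + b * d4') A B
  = a *: prodmx L Q Q' e t (d1, d2, d3, d4) A B
    + b *: prodmx L Q Q' e t (d1', d2', d3', d4') A B.
Proof.
rewrite /prodmx mulrDl -!(mulrA _ _ (\tr _)) !scalerDl !scalerDr !scalerA.
by do 3! (rewrite [RHS]addrACA; congr (_ + _)).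
Qed.

Hypothesis alb : albert_axioms L Q Q' e c.

(** The commutativity of J allows the indices of A and of B to be exchanged in the fourfold sum. *)
Lemma starmxC A B : starmx L Q e t A B = starmx L Q e t B A.
Proof.
have NC i r : row r (lmulT L Q e t i) = row i (lmulT L Q e t r).
  by rewrite !row_mul (mulC alb).
have E (X Y : 'M[R]_n) : starmx L Q e t X Y = 2 *: \sum_i \sum_j \sum_r \sum_s (X i j * Y r s)
    *: ((row r (lmulT L Q e t i))^T *m row s (lmulT L Q e t j)).
  congr (_ *: _); apply: eq_bigr => i _; apply: eq_bigr => j _.
  rewrite mulmx_quadratic scaler_sumr; apply: eq_bigr => r _.
  by rewrite scaler_sumr; apply: eq_bigr => s _; rewrite scalerA.
rewrite !E; congr (_ *: _).
under eq_bigr => i _ do rewrite exchange_big.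
rewrite exchange_big; apply: eq_bigr => r _ /=.
under eq_bigr => i _ do rewrite exchange_big.
rewrite exchange_big; apply: eq_bigr => s _ /=.
by apply: eq_bigr => i _; apply: eq_bigr => j _; rewrite mulrC !(NC _ r) !(NC _ s).
Qed.

Lemma prodmxC d A B : prodmx L Q Q' e t d A B = prodmx L Q Q' e t d B A.
Proof.
case: d => [[[d1 d2] d3] d4]; rewrite /prodmx (anticommC Q A) (starmxC A).
by congr (_ + (_ * _) *: _); rewrite -mulmxA mxtrace_mulC !mulmxA.
Qed.

End ProductSymmetry.

(** * Transfer of the axioms from the algebraic closure to k *)

Section AlbertAlgebra.
Variables (k : fieldType) (J : vectType k).
Variables (mul : {bilinear J -> J -> J}) (form : {biscalar J}) (e : J).
Hypothesis hchar : forall p : nat, p \in [pchar k] -> (13 < p)%N.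
Hypothesis he : forall x : J, mul e x = x /\ mul x e = x.

Local Notation n := (\dim {:J}).
Local Notation L := (Lk mul).
Local Notation Q := (Qk form).
Local Notation u := (ek e).

Lemma natf_unit (p : nat) : prime p -> (p <= 13)%N -> (p%:R : k) != 0.
Proof.
by move=> pp; rewrite leqNgt; apply: contraNneq => p0; apply: hchar; rewrite inE pp p0 eqxx.
Qed.

Lemma unit_lcomb : lcomb L u = 1%:M.
Proof.
apply/row_matrixP => i; rewrite rowE row1 -(coords_basis i) -coords_mul.
by have [-> _] := he (vbasis {:J})`_i.
Qed.

Lemma unit_row i : u *m L i = delta_mx 0 i.
Proof.
rewrite -(lcomb_delta L i) -(coords_basis i) -coords_mul.
by have [_ ->] := he (vbasis {:J})`_i.
Qed.

Variables (K : fieldType) (f : {rmorphism k -> K}) (phi : 'rV[K]_n -> 'M[octonion K]_3).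
Hypothesis phi_lin : forall c (x y : 'rV[K]_n) i j,
  phi (c *: x + y) i j = c *: phi x i j + phi y i j.
Hypothesis phi_inj : injective phi.
Hypothesis phi_herm : forall X, hermitian X <-> exists x, phi x = X.
Hypothesis phi_mul : forall x y, phi (ext_mul f mul x y) = h3mul (phi x) (phi y).
Hypothesis phi_form : forall x y, ext_form f form x y = h3form (phi x) (phi y).

Local Notation "A ^f" := (map_mx f A).
Local Notation Lf := (fun i => (L i)^f).

Lemma natK_unit (p : nat) : prime p -> (p <= 13)%N -> (p%:R : K) != 0.
Proof. by move=> pp p13; rewrite -(rmorph_nat f) fmorph_eq0 natf_unit. Qed.

Lemma albert_basis : exists b, standard_basis Lf Q^f u^f b.
Proof.
apply: (@isomorphism_basis _ _ _ _ _ phi) => //; try exact: natK_unit.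
- by move=> x y; rewrite -ext_mulE.
- by move=> x y; rewrite -ext_formE.
move=> x; rewrite /lcomb mulmx_sumr [RHS]row_sum_delta; apply: eq_bigr => i _.
by rewrite -scalemxAr -map_mxM unit_row map_delta_mx.
Qed.

(** The unit laws are given over k. The other axioms are identities over k, or the invertibility of
    Q, which the field extension reflects; over K they hold by the standard basis. *)
Lemma albert_axioms_coords : albert_axioms L Q (invmx Q) u 9^-1.
Proof.
have [b bP] := albert_basis.
have albK : albert_axioms Lf Q^f (invmx Q^f) u^f 9^-1.
  by apply: (sb_albert_axioms bP); rewrite ?(natrM _ 2 3) ?mulf_neq0 ?natK_unit.
split; [exact: unit_lcomb | exact: unit_row | move=> i j | move=> i j | ].
- by apply: (@map_mx_inj _ _ f _ _); rewrite !map_row (mulC albK).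
- apply: (fmorph_inj f); have := traceE albK i j; rewrite mxE => ->.
  by rewrite rmorphM fmorphV rmorph_nat -trace_map_mx map_lcomb map_row.
by rewrite mulmxV // -(map_unitmx f); have [] := mulmx1_unit (gram_inv albK).
Qed.

Lemma unit_norm_coords : u *m (Q *m u^T) = 3%:M.
Proof.
have [b bP] := albert_basis; apply: (@map_mx_inj _ _ f _ _).
rewrite !map_mxM -map_trmx map_scalar_mx rmorph_nat.
exact: (unit_norm (natK_unit (isT : prime 2) isT) bP).
Qed.

End AlbertAlgebra.

(** * Equivariance over k-algebras in terms of [ext_prod] *)

Section Products.
Variables (k : fieldType) (J : vectType k).
Variables (mul : {bilinear J -> J -> J}) (form : {biscalar J}) (e : J).

Local Notation n := (\dim {:J}).
Local Notation L := (Lk mul).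
Local Notation Q := (Qk form).
Local Notation Q' := (invmx Q).
Local Notation u := (ek e).
Local Notation t := (3^-1 : k).

Variable c : k.
Hypothesis alb : albert_axioms L Q Q' u c.
Hypothesis char2 : (2 : k) != 0.
Hypothesis char3 : (3 : k) != 0.
Hypothesis unit_form : u *m (Q *m u^T) = 3%:M.

Let VP := inV'P alb char2 char3 unit_form.

Section Points.
Variables (R : comNzRingType) (f : {rmorphism k -> R}).
Local Notation "A ^f" := (map_mx f A).
Local Notation Lf := (fun i => (L i)^f).
Local Notation inV A := (constraints Lf Q^f u^f A = 0).
Local Notation extp := (ext_prod L Q u f).

(** Shows that the graph is that of a function: whatever the expressions of A and B by elements of
    V', bilinearity of [ext_prod] leads to the same C. *)
Lemma ext_prod_graphP p A B C : bilinear_on_V' mul form e p ->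
  ext_prod_graph mul form e f p A B C <-> [/\ inV A, inV B & C = extp p A B].
Proof.
case=> _ [p_l p_r].
have p_l' a X X' Y : constraints L Q u X = 0 -> constraints L Q u X' = 0 ->
    constraints L Q u Y = 0 -> p (a *: X + X') Y = a *: p X Y + p X' Y.
  by move=> /VP VX /VP VX' /VP VY; exact: p_l.
have p_r' a X Y Y' : constraints L Q u X = 0 -> constraints L Q u Y = 0 ->
    constraints L Q u Y' = 0 -> p X (a *: Y + Y') = a *: p X Y + p X Y'.
  by move=> /VP VX /VP VY /VP VY'; exact: p_r.
split=> [[m [l [r [s [X [Y [VX [VY [-> [-> ->]]]]]]]]]]|[VA VB ->]].
  have Vsum q (a : 'I_q -> R) Z : (forall i, inV' mul form e (Z i)) -> inV (\sum_i a i *: (Z i)^f).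
    move=> VZ; rewrite linear_sum big1 // => i _.
    by rewrite linearZ /= -map_constraints (VP (Z i)).1 ?map_mx0 ?scaler0.
  split; [exact: Vsum | exact: Vsum | rewrite ext_prod_sum].
  apply: eq_bigr => i _; apply: eq_bigr => j _; rewrite ext_prod_map //; exact/VP.
pose T : finType := ('I_n * 'I_n)%type.
have sumT (V : nmodType) (F : T -> V) : \sum_s F s = \sum_(i < #|T|) F (enum_val i).
  by rewrite (reindex (@enum_val T T)) //; apply: onW_bij; exact: enum_val_bij.
have Vgen s : inV' mul form e (gen L Q u s) by apply/VP; exact: gen_constraints.
exists #|T|, #|T|, (fun i => A (enum_val i).1 (enum_val i).2),
  (fun i => B (enum_val i).1 (enum_val i).2),
  (fun i => gen L Q u (enum_val i)), (fun i => gen L Q u (enum_val i)).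
split; [by [] | split; [by [] | split; last split]].
- by rewrite {1}(inV_span VA) sumT.
- by rewrite {1}(inV_span VB) sumT.
by rewrite /ext_prod sumT; apply: eq_bigr => i _; rewrite sumT.
Qed.

Lemma equivariant_ext_prod p g A B : bilinear_on_V' mul form e p ->
  aut_equivariant mul form e p -> is_aut Lf g -> inV A -> inV B ->
  extp p (g^T *m A *m g) (g^T *m B *m g) = g^T *m extp p A B *m g.
Proof.
move=> p_bil p_eqv /aut_pointsP gP VA VB.
have /(p_eqv R f g gP) : ext_prod_graph mul form e f p A B (extp p A B).
  exact/(ext_prod_graphP _ _ _ p_bil).
by move=> /(ext_prod_graphP _ _ _ p_bil)[_ _ ->].
Qed.

(** Both sides are bilinear and the extension of V' is spanned by the generators, at which the
    hypothesis over k applies. *)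
Lemma ext_prod_prodmx d1 d2 d3 d4 p A B :
  (forall A B, constraints L Q u A = 0 -> constraints L Q u B = 0 ->
     p A B = prodmx L Q Q' u t (d1, d2, d3, d4) A B) ->
  inV A -> inV B ->
  extp p A B = prodmx Lf Q^f Q'^f u^f (f t) (f d1, f d2, f d3, f d4) A B.
Proof.
move=> pE VA VB; rewrite {2}(inV_span VA) {2}(inV_span VB).
set q := prodmx _ _ _ _ _ _.
have q_l a X X' Y : q (a *: X + X') Y = a *: q X Y + q X' Y by exact: prodmxP.
have q_r a X Y Y' : q X (a *: Y + Y') = a *: q X Y + q X Y' by exact: prodmxPr.
have z0l Z : q 0 Z = 0 by have := q_l (-1) 0 0 Z; rewrite scaler0 addr0 scaleN1r addNr.
have z0r Z : q Z 0 = 0 by have := q_r (-1) Z 0 0; rewrite scaler0 addr0 scaleN1r addNr.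
rewrite /ext_prod; move: (index_enum _) {1 3}(index_enum _) => v w.
elim: w => [|s w IH]; first by rewrite !big_nil z0l.
rewrite !big_cons q_l -IH; congr (_ + _).
elim: v {IH} => [|r v IH]; first by rewrite !big_nil z0r scaler0.
rewrite !big_cons q_r scalerDr scalerA -IH; congr (_ *: _ + _).
by rewrite pE ?gen_constraints // map_prodmx.
Qed.

End Points.

Section DualNumberPoints.
Variables (K : fieldType) (f : {rmorphism k -> K}).
Local Notation "A ^f" := (map_mx f A).
Local Notation Lf := (fun i => (L i)^f).
Local Notation inV A := (constraints Lf Q^f u^f A = 0).

(** The dual numbers over K form a k-algebra through f, so equivariance applies at the point 1 + eps
    D even though D is defined over K only. *)
Lemma equivariant_Leibniz p D A B : bilinear_on_V' mul form e p ->
  aut_equivariant mul form e p -> is_der Lf D -> inV A -> inV B ->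
  ext_prod L Q u f p (dact D A) B + ext_prod L Q u f p A (dact D B)
  = dact D (ext_prod L Q u f p A B).
Proof.
move=> p_bil p_eqv dD VA VB; pose h : {rmorphism K -> dual K} := @dual_const K.
pose hf : {rmorphism k -> dual K} := h \o f.
have comp m q (X : 'M[k]_(m, q)) : map_mx h X^f = map_mx hf X.
  by rewrite -map_mx_comp.
have hV X : inV X -> constraints (fun i => map_mx hf (L i)) (map_mx hf Q) (map_mx hf u) (map_mx h X) = 0.
  move=> VX; rewrite -!comp -(eq_constraints (L := fun i => map_mx h (L i)^f)) => [|i]; last exact: comp.
  by rewrite -map_constraints VX map_mx0.
apply: (@der_of_aut _ _ _ (ext_prod L Q u hf p)) => [a X X' Y|a X Y Y'|X Y|].
- exact: ext_prodP.
- exact: ext_prodPr.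
- rewrite /ext_prod map_mx_sum; apply: eq_bigr => s _; rewrite map_mx_sum.
  by apply: eq_bigr => r _; rewrite map_mxZ rmorphM !mxE comp.
apply: equivariant_ext_prod => //; try exact: hV.
by apply: eq_is_aut (exp_der_aut dD) => i; exact: comp.
Qed.

End DualNumberPoints.
End Products.

Theorem proposition5p14 (k : fieldType)
    (hchar : forall p : nat, p \in [pchar k] -> (13 < p)%N)
    (J : vectType k) (mul : {bilinear J -> J -> J}) (form : {biscalar J})
    (hJ : albert mul form)
    (e : J) (he : forall x : J, mul e x = x /\ mul x e = x)
    (p : 'M[k]_(\dim {:J}) -> 'M[k]_(\dim {:J}) -> 'M[k]_(\dim {:J})) :
  (bilinear_on_V' mul form e p /\ commutative_on_V' mul form e p /\
   aut_equivariant mul form e p) <->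
  exists alpha beta : k,
    forall A B : 'M[k]_(\dim {:J}), inV' mul form e A -> inV' mul form e B ->
      p A B = alpha *: odot1 mul form e A B + beta *: odot2 mul form e A B.
Proof.
have [K [f [phi [_ [phi_lin [phi_inj [phi_herm [phi_mul phi_form]]]]]]]] := hJ.
have char2 := natf_unit hchar (isT : prime 2) isT.
have char3 := natf_unit hchar (isT : prime 3) isT.
have char2K := natK_unit hchar f (isT : prime 2) isT.
have char3K := natK_unit hchar f (isT : prime 3) isT.
have char13K := natK_unit hchar f (isT : prime 13) isT.
have [b bP] := albert_basis hchar he phi_lin phi_inj phi_herm phi_mul phi_form.
have alb := albert_axioms_coords hchar he phi_lin phi_inj phi_herm phi_mul phi_form.
have unit_form := unit_norm_coords hchar he phi_lin phi_inj phi_herm phi_mul phi_form.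
set L := Lk mul in bP alb unit_form; set Q := Qk form in bP alb unit_form.
set u := ek e in bP alb unit_form.
have VP := inV'P alb char2 char3 unit_form.
have albK := map_albert_axioms f alb.
pose q1 := prodmx L Q (invmx Q) u 3^-1 (coefs1 k).
pose q2 := prodmx L Q (invmx Q) u 3^-1 (coefs2 k).
have odotE A B : inV' mul form e A -> inV' mul form e B ->
    odot1 mul form e A B = q1 A B /\ odot2 mul form e A B = q2 A B.
  move=> /VP/constraintsP[sA _ _] /VP/constraintsP[sB _ _].
  by rewrite (odot1E alb) // (odot2E alb).
have map_coefs1 : (f 3^-1, f 2, f 0, f (- (4 / 78))) = coefs1 K.
  by rewrite rmorphN rmorph0 rmorphM !fmorphV !rmorph_nat.
have map_coefs2 : (f 2, f 0, f 1, f (- (40 / 78))) = coefs2 K.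
  by rewrite rmorphN rmorph0 rmorph1 rmorphM !fmorphV !rmorph_nat.
have map_q1 A B : map_mx f (q1 A B) = prodmx (fun i => map_mx f (L i)) (map_mx f Q)
    (map_mx f (invmx Q)) (map_mx f u) 3^-1 (coefs1 K) (map_mx f A) (map_mx f B).
  by rewrite map_prodmx map_coefs1 fmorphV rmorph_nat.
have map_q2 A B : map_mx f (q2 A B) = prodmx (fun i => map_mx f (L i)) (map_mx f Q)
    (map_mx f (invmx Q)) (map_mx f u) 3^-1 (coefs2 K) (map_mx f A) (map_mx f B).
  by rewrite map_prodmx map_coefs2 fmorphV rmorph_nat.
have map_V A : constraints L Q u A = 0 -> constraints (fun i => map_mx f (L i))
    (map_mx f Q) (map_mx f u) (map_mx f A) = 0.
  by move=> VA; rewrite -map_constraints VA map_mx0.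
split=> [[p_bil [_ p_eqv]]|[alpha [beta pE]]].
  have [p_closed [p_l p_r]] := p_bil.
  have [||||alphaK [betaK PE]] := @equivariant_products _ _ _ _ _ _ _ char2K char3K char13K albK
    b bP (ext_prod L Q u f p).
  - move=> A B _ _; rewrite linear_sum big1 // => s _; rewrite linear_sum big1 // => r _.
    rewrite linearZ /= -map_constraints (VP _).1 ?map_mx0 ?scaler0 //.
    by apply: p_closed; apply/VP; exact: gen_constraints.
  - by move=> a A A' B _ _ _; exact: ext_prodP.
  - by move=> a A B B' _ _ _; exact: ext_prodPr.
  - by move=> D A B dD VA VB; apply: (equivariant_Leibniz alb).
  have comb_entry (F : fieldType) m l (a a' : F) (X Y : 'M[F]_(m, l)) i j :
    (a *: X + a' *: Y) i j = a * X i j + a' * Y i j by rewrite !mxE.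
  have map_entry m l (X : 'M[k]_(m, l)) i j : map_mx f X i j = f (X i j) by rewrite mxE.
  pose g := gen L Q u; have Vg s : constraints L Q u (g s) = 0 by exact: gen_constraints.
  have p_l' a A A' B : constraints L Q u A = 0 -> constraints L Q u A' = 0 ->
      constraints L Q u B = 0 -> p (a *: A + A') B = a *: p A B + p A' B.
    by move=> /VP VA /VP VA' /VP VB; exact: p_l.
  have p_r' a A B B' : constraints L Q u A = 0 -> constraints L Q u B = 0 ->
      constraints L Q u B' = 0 -> p A (a *: B + B') = a *: p A B + p A B'.
    by move=> /VP VA /VP VB /VP VB'; exact: p_r.
  (* The linear system to be descended: one equation in alpha and beta for each pair of generators
     and each matrix entry of their products. *)
  pose T : finType := (('I_(\dim {:J}) * 'I_(\dim {:J})) * ('I_(\dim {:J}) * 'I_(\dim {:J}))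
    * ('I_(\dim {:J}) * 'I_(\dim {:J})))%type.
  pose tensor (w : 'M[k]_(\dim {:J}) -> 'M[k]_(\dim {:J}) -> 'M[k]_(\dim {:J})) (z : T) :=
    w (g z.1.1) (g z.1.2) z.2.1 z.2.2.
  have [z|alpha [beta tE]] := @span_descent k K f T (tensor p) (tensor q1) (tensor q2) alphaK betaK.
    have := PE _ _ (map_V _ (Vg z.1.1)) (map_V _ (Vg z.1.2)).
    rewrite (ext_prod_map p_l' p_r') // -map_q1 -map_q2 => /matrixP/(_ z.2.1 z.2.2).
    by rewrite comb_entry !map_entry.
  exists alpha, beta => A B VA VB; have [-> ->] := odotE A B VA VB.
  move/VP: VA => VA; move/VP: VB => VB.
  have q1E := prod_gen (fun a X X' Y _ _ _ => prodmxP L Q (invmx Q) u 3^-1 (coefs1 k) a X X' Y)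
    (fun a X Y Y' _ _ _ => prodmxPr L Q (invmx Q) u 3^-1 (coefs1 k) a X Y Y') VA VB.
  have q2E := prod_gen (fun a X X' Y _ _ _ => prodmxP L Q (invmx Q) u 3^-1 (coefs2 k) a X X' Y)
    (fun a X Y Y' _ _ _ => prodmxPr L Q (invmx Q) u 3^-1 (coefs2 k) a X Y Y') VA VB.
  rewrite /q1 /q2 q1E q2E (prod_gen p_l' p_r' VA VB) !scaler_sumr -big_split.
  apply: eq_bigr => s _; rewrite !scaler_sumr -big_split; apply: eq_bigr => r _ /=.
  have scaleCA (a b' : k) (X : 'M[k]_(\dim {:J})) : a *: (b' *: X) = b' *: (a *: X).
    by rewrite !scalerA mulrC.
  rewrite [alpha *: _]scaleCA [beta *: _]scaleCA -scalerDr; congr (_ *: _).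
  by apply/matrixP => i j; rewrite comb_entry; exact: (tE (s, r, (i, j))).
(* The combination is itself a member of the family, so its equivariance over every k-algebra is
   [aut_prodmx], which holds over any commutative ring. *)
pose q := prodmx L Q (invmx Q) u 3^-1 (alpha * 3^-1 + beta * 2, alpha * 2 + beta * 0,
  alpha * 0 + beta * 1, alpha * - (4 / 78) + beta * - (40 / 78)).
have pq A B : inV' mul form e A -> inV' mul form e B -> p A B = q A B.
  by move=> VA VB; rewrite pE // /q prodmx_linear; have [-> ->] := odotE A B VA VB.
have p_bil : bilinear_on_V' mul form e p.
  have VD a A B : inV' mul form e A -> inV' mul form e B -> inV' mul form e (a *: A + B).
    by move=> /VP VA /VP VB; apply/VP; rewrite linearP /= VA VB scaler0 addr0.
  split; [move=> A B VA VB | split=> [a A A' B VA VA' VB | a A B B' VA VB VB']].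
  - rewrite pE //; have [-> ->] := odotE A B VA VB.
    move/VP: VA => VA; move/VP: VB => VB.
    (* Stability of V' was established over K, where the standard basis exists; it descends because
       the constraints commute with f and f is injective. *)
    have V1 : constraints L Q u (q1 A B) = 0.
      apply: (@map_mx_inj _ _ f); rewrite map_constraints map_q1 map_mx0.
      by apply: (prodmx1_closed char2K char3K char13K albK bP); exact: map_V.
    have V2 : constraints L Q u (q2 A B) = 0.
      apply: (@map_mx_inj _ _ f); rewrite map_constraints map_q2 map_mx0.
      by apply: (prodmx2_closed char2K char3K char13K albK bP); exact: map_V.
    by apply/VP; rewrite linearP /= linearZ /= V1 V2 !scaler0 addr0.
  - by rewrite !pq ?VD //; [exact: prodmxP | exact: VD].
  - by rewrite !pq ?VD //; [exact: prodmxPr | exact: VD].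
split; [by [] | split=> [A B VA VB|R h g /aut_pointsP gP A B C]].
  by rewrite !pq // /q (prodmxC _ alb).
have pq' X Y : constraints L Q u X = 0 -> constraints L Q u Y = 0 -> p X Y = q X Y.
  by move=> /VP VX /VP VY; exact: pq.
have albR := map_albert_axioms h alb.
move=> /(ext_prod_graphP alb char2 char3 unit_form h _ _ _ p_bil)[VA VB ->].
apply/(ext_prod_graphP alb char2 char3 unit_form h _ _ _ p_bil).
have VgA := aut_constraints albR gP VA; have VgB := aut_constraints albR gP VB.
by split=> //; rewrite !(ext_prod_prodmx pq') // (aut_prodmx _ albR gP).
Qed.
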